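(* Let $p>0$, $p\neq1$, let $D\subset\mathbb{R}^2$ be a bounded simply connected domain, and let $u_1,u_3\colon\partial D\to\mathbb{R}$ be given continuous functions. Consider: Problem (A): find $u\colon D\to\mathbb{R}$ such that $$\frac{\partial^4 u}{\partial y^4}+(p^2+1)\frac{\partial^4 u}{\partial x^2\partial y^2}+p^2\frac{\partial^4 u}{\partial x^4}=0\ \text{ in } D,$$ and, for every $(x_0,y_0)\in\partial D$, $$\lim_{(x,y)\to(x_0,y_0),\,(x,y)\in D}\frac{\partial u(x,y)}{\partial x}=u_1(x_0,y_0),\qquad \lim_{(x,y)\to(x_0,y_0),\,(x,y)\in D}\frac{\partial u(x,y)}{\partial y}=u_3(x_0,y_0).$$ Problem (B): find a monogenic function $\Phi\colon D_\zeta\to\mathbb{B}_0$ such that, for every $(x_0,y_0)\in\partial D$, with $\zeta_0=x_0e_1+y_0e_2$, $$\lim_{\zeta\to\zeta_0,\,\zeta\in D_\zeta}\mathrm{U}_1[\Phi(\zeta)]=u_1(x_0,y_0),\qquad \lim_{\zeta\to\zeta_0,\,\zeta\in D_\zeta}\mathrm{U}_3[\Phi(\zeta)]=\frac1p\,u_3(x_0,y_0).$$ Then Problem (A) is reduced to Problem (B) in the following sense. (i) If $u$ is a solution of Problem (A) and $\Phi_1\colon D_\zeta\to\mathbb{B}_0$ is a monogenic function with $\mathrm{U}_1[\Phi_1(\zeta)]=u(x,y)$ for all $\zeta=xe_1+ye_2\in D_\zeta$, then $\Phi:=\Phi_1'$ is a solution of Problem (B). (ii) If $\Phi$ is a solution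 of Problem (B), then, for any fixed point $(x_*,y_* )\in D$ and any real constant $C$, the function $$u(x,y)=\int_{(x_*,y_* )}^{(x,y)}\Bigl(\mathrm{U}_1[\Phi(xe_1+ye_2)]\,dx+p\,\mathrm{U}_3[\Phi(xe_1+ye_2)]\,dy\Bigr)+C,\qquad (x,y)\in D,$$ where the integral is taken along any piecewise smooth curve in $D$ joining $(x_*,y_* )$ with $(x,y)$, is a solution of Problem (A).
   Context: $\mathbb{B}_0$ is the commutative associative two-dimensional algebra over $\mathbb{C}$ with unit $e$ and basis $(e,\omega)$, $\omega^2=e$. It has the orthogonal idempotents $\mathcal{I}_1=\frac12(e+\omega)$, $\mathcal{I}_2=\frac12(e-\omega)$, with $\mathcal{I}_1\mathcal{I}_2=0$, $\mathcal{I}_1+\mathcal{I}_2=e$. Fix $p>0$, $p\neq1$, and the $\mathbb{C}$-basis of $\mathbb{B}_0$ $$e_1=e,\qquad e_2=i(\mathcal{I}_1+p\,\mathcal{I}_2),$$ whose multiplication table is $e_1e_2=e_2$, $e_2^2=p\,e_1+i(p+1)e_2$. Let $\mu_{e_1,e_2}=\{xe_1+ye_2: x,y\in\mathbb{R}\}$; every nonzero element of $\mu_{e_1,e_2}$ is invertible in $\mathbb{B}_0$. For a domain $D\subset\mathbb{R}^2$ put $D_\zeta=\{\zeta=xe_1+ye_2:(x,y)\in D\}$. A function $\Phi\colon D_\zeta\to\mathbb{B}_0$ is monogenic in $D_\zeta$ if at every $\zeta\in D_\zeta$ the limit $$\Phi'(\zeta)=\lim_{h\to0,\ h\in\mu_{e_1,e_2}}(\Phi(\zeta+h)-\Phi(\zeta))h^{-1}$$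 exists; $\Phi'$ is the derivative of $\Phi$. Every $\Phi\colon D_\zeta\to\mathbb{B}_0$ is written uniquely as $\Phi(\zeta)=U_1(x,y)e_1+U_2(x,y)\,ie_1+U_3(x,y)e_2+U_4(x,y)\,ie_2$ with real-valued $U_k\colon D\to\mathbb{R}$, $\zeta=xe_1+ye_2$, and $\mathrm{U}_k[\Phi]:=U_k$. Solutions of the differential equation are classical: real-valued functions with continuous partial derivatives up to order four. *)

(* Defs.v *)
From Stdlib Require Import Reals Lra Lia ClassicalEpsilon.
From Coquelicot Require Import Coquelicot.

Open Scope R_scope.

(** The pair [(z, w)] stands for [z e + w omega]; linear structure, norm and
    topology are Coquelicot's ones on the product [C * C]. *)
Definition B0 : Type := (C * C)%type.

Definition B0mul (a b : B0) : B0 :=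
  ((fst a * fst b + snd a * snd b)%C, (fst a * snd b + snd a * fst b)%C).

Definition B0unit : B0 := (RtoC 1, RtoC 0).
Definition B0omega : B0 := (RtoC 0, RtoC 1).

(** [(z e + w omega) (z e - w omega) = (z^2 - w^2) e]; the value is
    meaningful only when [z^2 <> w^2]. *)
Definition B0inv (a : B0) : B0 :=
  let d := (fst a * fst a - snd a * snd a)%C in
  ((fst a / d)%C, (- snd a / d)%C).

Definition I1 : B0 := scal (/ RtoC 2)%C (plus B0unit B0omega : B0).
Definition I2 : B0 := scal (/ RtoC 2)%C (minus B0unit B0omega : B0).

Definition e1 : B0 := B0unit.
Definition e2 (p : R) : B0 := scal Ci (plus I1 (scal (RtoC p) I2) : B0).

Definition zeta (p x y : R) : B0 :=
  plus (scal (RtoC x) e1 : B0) (scal (RtoC y) (e2 p) : B0).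

Definition mu (p : R) (h : B0) : Prop := exists x y : R, h = zeta p x y.

Definition D_zeta (p : R) (D : R * R -> Prop) (z : B0) : Prop :=
  exists x y : R, D (x, y) /\ z = zeta p x y.

(** Complex coordinates in the basis [(e1, e2)]: since
    [e2 = i/2 ((1 + p) e + (1 - p) omega)], the equality
    [z e + w omega = a e1 + b e2] gives [b = - 2 i w / (1 - p)] and
    [a = z - (1 + p) / (1 - p) w]; see [U_decomposition] and [U_unique]. *)
Definition coord1 (p : R) (a : B0) : C :=
  (fst a - RtoC ((1 + p) / (1 - p)) * snd a)%C.
Definition coord2 (p : R) (a : B0) : C :=
  (RtoC (- 2 / (1 - p)) * (Ci * snd a))%C.

Definition U1 (p : R) (a : B0) : R := Re (coord1 p a).
Definition U2 (p : R) (a : B0) : R := Im (coord1 p a).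
Definition U3 (p : R) (a : B0) : R := Re (coord2 p a).
Definition U4 (p : R) (a : B0) : R := Im (coord2 p a).

Definition B0comb (p a1 a2 a3 a4 : R) : B0 :=
  plus (plus (scal (RtoC a1) e1 : B0) (scal (RtoC a2) (scal Ci e1 : B0) : B0) : B0)
       (plus (scal (RtoC a3) (e2 p) : B0)
             (scal (RtoC a4) (scal Ci (e2 p) : B0) : B0) : B0).

Ltac B0_expand :=
  cbv [B0comb zeta U1 U2 U3 U4 coord1 coord2 e1 e2 I1 I2 B0mul B0inv B0unit
       B0omega B0];
  cbn;
  cbv [prod_scal prod_plus prod_opp prod_zero minus plus opp zero scal mult];
  cbn;
  cbv [prod_scal prod_plus prod_opp prod_zero minus plus opp zero scal mult
       Cplus Cminus Cmult Copp Cinv Cdiv RtoC Ci Re Im];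
  cbn.

Lemma I1_I2 :
  B0mul I1 I1 = I1 /\ B0mul I2 I2 = I2 /\ B0mul I1 I2 = zero /\
  plus I1 I2 = B0unit.
Proof.
repeat split; B0_expand; apply f_equal2; apply f_equal2; field.
Qed.

Lemma e2_square (p : R) :
  B0mul (e2 p) (e2 p) =
  plus (scal (RtoC p) e1 : B0) (scal (Ci * RtoC (p + 1))%C (e2 p) : B0).
Proof. B0_expand; apply f_equal2; apply f_equal2; field. Qed.

Lemma U_decomposition (p : R) (a : B0) : p <> 1 ->
  a = B0comb p (U1 p a) (U2 p a) (U3 p a) (U4 p a).
Proof.
intros Hp; destruct a as [[a b] [c d]].
B0_expand; apply f_equal2; apply f_equal2; field; lra.
Qed.

Lemma U_unique (p a1 a2 a3 a4 : R) : p <> 1 ->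
  U1 p (B0comb p a1 a2 a3 a4) = a1 /\ U2 p (B0comb p a1 a2 a3 a4) = a2 /\
  U3 p (B0comb p a1 a2 a3 a4) = a3 /\ U4 p (B0comb p a1 a2 a3 a4) = a4.
Proof. intros Hp; repeat split; B0_expand; field; lra. Qed.

Definition is_mono_derive (p : R) (Phi : B0 -> B0) (z l : B0) : Prop :=
  filterlim (fun h : B0 => B0mul (minus (Phi (plus z h)) (Phi z)) (B0inv h))
    (within (mu p) (locally' (zero : B0))) (locally (l : B0)).

Definition monogenic (p : R) (D : R * R -> Prop) (Phi : B0 -> B0) : Prop :=
  forall z : B0, D_zeta p D z -> exists l : B0, is_mono_derive p Phi z l.

(** The derivative as a total function, arbitrary where the limit does not
    exist. *)
Definition mono_derive (p : R) (Phi : B0 -> B0) (z : B0) : B0 :=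
  epsilon (inhabits (zero : B0)) (is_mono_derive p Phi z).

Lemma B0inv_mu (p : R) (h : B0) : 0 < p -> p <> 1 ->
  mu p h -> h <> zero -> B0mul h (B0inv h) = B0unit.
Proof.
intros Hp Hp1 [x [y ->]] Hn.
assert (Hxy : x <> 0 \/ y <> 0).
{ destruct (Req_dec x 0) as [-> | Hx]; [right | now left].
  intros ->; apply Hn; B0_expand; apply f_equal2; apply f_equal2; ring. }
set (z := zeta p x y).
assert (Hd : (fst z * fst z - snd z * snd z)%C
             = ((RtoC x + Ci * RtoC y) * (RtoC x + Ci * RtoC (p * y)))%C).
{ unfold z; B0_expand; apply f_equal2; field. }
assert (H1 : forall q, q <> 0 -> (RtoC x + Ci * RtoC (q * y))%C <> RtoC 0).
{ intros q Hq H; injection H; intros H2 H3.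
  assert (Ey : q * y = 0) by lra.
  assert (y = 0) by (apply Rmult_integral in Ey; tauto).
  subst y; destruct Hxy; lra. }
assert (Hnz : (fst z * fst z - snd z * snd z)%C <> RtoC 0).
{ rewrite Hd; apply Cmult_neq_0; [|apply H1; lra].
  rewrite <- (Rmult_1_l y); apply H1; lra. }
unfold B0mul, B0inv, B0unit; cbn [fst snd].
apply f_equal2; field; exact Hnz.
Qed.

Lemma mono_derive_unique (p : R) (Phi : B0 -> B0) (z l : B0) :
  is_mono_derive p Phi z l -> mono_derive p Phi z = l.
Proof.
intros Hl.
assert (He : is_mono_derive p Phi z (mono_derive p Phi z))
  by exact (epsilon_spec _ _ (ex_intro _ l Hl)).
assert (HF : ProperFilter' (within (mu p) (locally' (zero : B0)))).
{ constructor.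
  - intros [eps Heps].
    assert (He2 : 0 < eps / 2 < eps) by (pose proof (cond_pos eps); lra).
    apply (Heps (zeta p (eps / 2) 0)).
    + repeat split; B0_expand; unfold ball; simpl; unfold AbsRing_ball; simpl;
        unfold abs, minus, plus, opp; simpl; apply Rabs_def1; lra.
    + intros H; apply (f_equal (fun a : B0 => Re (fst a))) in H; revert H;
      B0_expand; lra.
    + now exists (eps / 2), 0.
  - apply within_filter, within_filter, locally_filter. }
exact (@filterlim_locally_unique _ C_AbsRing
         (prod_NormedModule C_AbsRing C_NormedModule C_NormedModule)
         _ HF _ _ _ He Hl).
Qed.

Definition is_domain (D : R * R -> Prop) : Prop :=
  open D /\ (exists P, D P) /\
  (forall A B : R * R -> Prop, open A -> open B ->
     (forall P, D P -> A P \/ B P) ->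
     (exists P, D P /\ A P) -> (exists P, D P /\ B P) ->
     exists P, D P /\ A P /\ B P).

Definition bounded_set (D : R * R -> Prop) : Prop :=
  exists M : R, forall P, D P -> norm P <= M.

(** Every loop in [D] is null-homotopic in [D], relative to its base point. *)
Definition simply_connected (D : R * R -> Prop) : Prop :=
  forall g : R -> R * R,
    continuous_on (fun t => 0 <= t <= 1) g ->
    (forall t, 0 <= t <= 1 -> D (g t)) ->
    g 0 = g 1 ->
    exists H : R * R -> R * R,
      continuous_on (fun st => 0 <= fst st <= 1 /\ 0 <= snd st <= 1) H /\
      (forall s t, 0 <= s <= 1 -> 0 <= t <= 1 -> D (H (s, t))) /\
      (forall t, 0 <= t <= 1 -> H (0, t) = g t) /\
      (forall t, 0 <= t <= 1 -> H (1, t) = g 0) /\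
      (forall s, 0 <= s <= 1 -> H (s, 0) = g 0 /\ H (s, 1) = g 0).

Definition boundary (D : R * R -> Prop) (P : R * R) : Prop :=
  forall eps : posreal,
    (exists Q, ball P eps Q /\ D Q) /\ (exists Q, ball P eps Q /\ ~ D Q).

(** Smooth means C^1 here; a nonvanishing tangent is not required.
    One-sided differentiability at the end points follows from the continuity
    of [dg] on the closed interval. *)
Definition C1_on (a b : R) (g : R -> R) : Prop :=
  continuous_on (fun t => a <= t <= b) g /\
  exists dg : R -> R,
    continuous_on (fun t => a <= t <= b) dg /\
    forall t, a < t < b -> is_derive g t (dg t).

Definition piecewise_smooth (a b : R) (X Y : R -> R) : Prop :=
  exists (n : nat) (t : nat -> R),
    t 0%nat = a /\ t n = b /\
    forall i, (i < n)%nat ->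
      t i < t (S i) /\ C1_on (t i) (t (S i)) X /\ C1_on (t i) (t (S i)) Y.

Definition curve_in (D : R * R -> Prop) (P Q : R * R) (a b : R)
  (X Y : R -> R) : Prop :=
  a < b /\ piecewise_smooth a b X Y /\
  (forall t, a <= t <= b -> D (X t, Y t)) /\
  (X a, Y a) = P /\ (X b, Y b) = Q.

(** The integral of [f dx + g dy]; the finitely many parameters where [X] or
    [Y] is not differentiable do not affect the Riemann integral. *)
Definition is_curve_int (f g : R -> R -> R) (a b : R) (X Y : R -> R) (l : R)
  : Prop :=
  is_RInt (fun t => f (X t) (Y t) * Derive X t + g (X t) (Y t) * Derive Y t)
    a b l.

(** [u] is, on [D], the function [int_{P}^{(x,y)} (f dx + g dy) + c]: each
    point of [D] is reached by a curve, and along every such curve the integral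
    exists and has the same value [u x y - c]. *)
Definition is_curve_primitive (D : R * R -> Prop) (f g : R -> R -> R)
  (P : R * R) (c : R) (u : R -> R -> R) : Prop :=
  forall x y, D (x, y) ->
    (exists a b X Y, curve_in D P (x, y) a b X Y) /\
    (forall a b X Y, curve_in D P (x, y) a b X Y ->
       exists l, is_curve_int f g a b X Y l /\ u x y = l + c).

Definition problemA (p : R) (D : R * R -> Prop) (u1 u3 : R * R -> R)
  (u : R -> R -> R) : Prop :=
  (forall x y, D (x, y) ->
     ex_diff_n u 4 x y /\
     partial_derive 0 4 u x y + (p ^ 2 + 1) * partial_derive 2 2 u x y
       + p ^ 2 * partial_derive 4 0 u x y = 0) /\
  (forall x0 y0, boundary D (x0, y0) ->
     filterlim (fun P : R * R => partial_derive 1 0 u (fst P) (snd P))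
       (within D (locally (x0, y0))) (locally (u1 (x0, y0))) /\
     filterlim (fun P : R * R => partial_derive 0 1 u (fst P) (snd P))
       (within D (locally (x0, y0))) (locally (u3 (x0, y0)))).

Definition problemB (p : R) (D : R * R -> Prop) (u1 u3 : R * R -> R)
  (Phi : B0 -> B0) : Prop :=
  monogenic p D Phi /\
  (forall x0 y0, boundary D (x0, y0) ->
     filterlim (fun z : B0 => U1 p (Phi z))
       (within (D_zeta p D) (locally (zeta p x0 y0)))
       (locally (u1 (x0, y0))) /\
     filterlim (fun z : B0 => U3 p (Phi z))
       (within (D_zeta p D) (locally (zeta p x0 y0)))
       (locally (1 / p * u3 (x0, y0)))).

(* Main.v *)
Require Import Defs.
From Stdlib Require Import Reals Lra Lia ClassicalEpsilon Classical.
From Coquelicot Require Import Coquelicot.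
Open Scope R_scope.

(** The mean value formula meets the same obstacle, since its proof differentiates under the
    integral sign and needs [F'] continuous. It is therefore applied first to a local primitive of
    [F], whose derivative [F] is continuous; this shows that [F'] is continuous, and only then can
    [F] itself take the place of the primitive. The formula is chosen because its integrand has no
    singular kernel: the proof uses derivatives in the radius and in the angle only.

    A null-homotopy is merely continuous, so its intermediate loops carry no Riemann integral of the
    form; a function on the parameter square replaces these integrals. One bisection lemma serves
    Goursat, the construction of this function, and the compactness and connectedness of an
    interval. *)

(** In idempotent coordinates [Phi = F1 I1 + F2 I2], and [Phi] is monogenic iff
    [F1] is holomorphic in [x + i y] and [F2] in [x + i p y].  Both are real
    Cauchy-Riemann systems [U_y = - q V_x], [V_y = q U_x], with [q = 1] and
    [q = p].  Goursat's lemma and the mean value formula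
    [F' = (2 PI r)^-1 * integral of F(z + r exp(i t)) exp(- i t)], whose right
    side only involves [F], show that the derivative of such a system is again
    one; this makes [Phi1'] monogenic and gives all the derivatives of [u].  In
    terms of [F1], [F2] the form [U1 dx + p U3 dy] is closed, hence locally
    exact, and a null-homotopy lifts it to a primitive along the square, which
    makes its integral path independent.  Each of [F1], [F2] contributes
    [q^4 - (p^2 + 1) q^2 + p^2 = 0] to the equation. *)

(** * Bisection *)

(** A two-dimensional Cousin lemma: every bad rectangle has a bad quarter, and nested bad rectangles
    shrink to a point where the local hypothesis applies. Sides of length zero are allowed, so that
    freezing one pair of bounds gives the one-dimensional version. *)
Lemma quadrisection (Pr : R -> R -> R -> R -> Prop) (a0 b0 c0 d0 : R) :
  a0 <= b0 -> c0 <= d0 ->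
  (forall a m b c n d, a0 <= a -> a <= m -> m <= b -> b <= b0 ->
     c0 <= c -> c <= n -> n <= d -> d <= d0 ->
     m - a = b - m -> n - c = d - n ->
     Pr a m c n -> Pr m b c n -> Pr a m n d -> Pr m b n d -> Pr a b c d) ->
  (forall x y, a0 <= x <= b0 -> c0 <= y <= d0 ->
     exists del, 0 < del /\
       forall a b c d, a0 <= a -> a <= x -> x <= b -> b <= b0 ->
         c0 <= c -> c <= y -> y <= d -> d <= d0 ->
         b - a < del -> d - c < del -> Pr a b c d) ->
  Pr a0 b0 c0 d0.
Proof.
intros Hab Hcd Hglue Hloc.
destruct (classic (Pr a0 b0 c0 d0)) as [H | Hn]; [exact H | exfalso].
pose (q := (R * R * (R * R))%type).
pose (ok := fun w : q => let '((a, b), (c, d)) := w in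
  (a0 <= a /\ a <= b /\ b <= b0 /\ c0 <= c /\ c <= d /\ d <= d0) /\
  ~ Pr a b c d).
pose (sub := fun w w' : q => let '((a, b), (c, d)) := w in
  let '((a', b'), (c', d')) := w' in
  a <= a' /\ b' <= b /\ c <= c' /\ d' <= d /\ b' - a' = (b - a) / 2 /\
  d' - c' = (d - c) / 2).
assert (Hstep : forall w, ok w -> exists w', ok w' /\ sub w w').
{ intros [[a b] [c d]] [(H1 & H2 & H3 & H4 & H5 & H6) HP].
  set (m := (a + b) / 2); set (n := (c + d) / 2).
  assert (Hm : m = (a + b) / 2) by reflexivity.
  assert (Hn' : n = (c + d) / 2) by reflexivity.
  clearbody m n.
  apply NNPP; intros Hno; apply HP.
  apply (Hglue a m b c n d); try lra; apply NNPP; intros Hx; apply Hno.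
  - exists ((a, m), (c, n)); simpl; repeat split; try lra; exact Hx.
  - exists ((m, b), (c, n)); simpl; repeat split; try lra; exact Hx.
  - exists ((a, m), (n, d)); simpl; repeat split; try lra; exact Hx.
  - exists ((m, b), (n, d)); simpl; repeat split; try lra; exact Hx. }
(* A total successor function obtained by choice; it is controlled only on rectangles satisfying
   [ok]. *)
pose (next := fun w => epsilon (inhabits w) (fun w' => ok w' /\ sub w w')).
assert (Hnext : forall w, ok w -> ok (next w) /\ sub w (next w)).
{ intros w Hw; unfold next; apply epsilon_spec, Hstep, Hw. }
pose (s := fix s (k : nat) : q :=
  match k with O => ((a0, b0), (c0, d0)) | S k => next (s k) end).
assert (Hs : forall k, ok (s k)).
{ induction k as [|k IH].
  - simpl; repeat split; try lra; exact Hn.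
  - apply (Hnext _ IH). }
pose (A := fun k => fst (fst (s k))); pose (B := fun k => snd (fst (s k))).
pose (C' := fun k => fst (snd (s k))); pose (E := fun k => snd (snd (s k))).
assert (HS : forall k, A k <= A (S k) /\ B (S k) <= B k /\ C' k <= C' (S k) /\
   E (S k) <= E k /\ B (S k) - A (S k) = (B k - A k) / 2 /\
   E (S k) - C' (S k) = (E k - C' k) / 2).
{ intros k; pose proof (proj2 (Hnext _ (Hs k))) as H; revert H.
  unfold A, B, C', E; simpl.
  destruct (s k) as [[? ?] [? ?]]; destruct (next _) as [[? ?] [? ?]].
  simpl; tauto. }
assert (HO : forall k, (a0 <= A k /\ A k <= B k /\ B k <= b0 /\ c0 <= C' k /\
   C' k <= E k /\ E k <= d0) /\ ~ Pr (A k) (B k) (C' k) (E k)).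
{ intros k; generalize (Hs k); unfold A, B, C', E.
  destruct (s k) as [[? ?] [? ?]]; simpl; tauto. }
assert (HA : forall k j, A k <= A (k + j)%nat /\ B (k + j)%nat <= B k /\
   C' k <= C' (k + j)%nat /\ E (k + j)%nat <= E k).
{ intros k; induction j as [|j IH].
  - rewrite Nat.add_0_r; lra.
  - rewrite Nat.add_succ_r; pose proof (HS (k + j)%nat); lra. }
assert (HAB : forall k j, A k <= B j /\ C' k <= E j).
{ intros k j; destruct (Nat.le_ge_cases k j) as [H | H].
  - pose proof (HA k (j - k)%nat) as H'; replace (k + (j - k))%nat with j in H' by lia.
    pose proof (HO j); lra.
  - pose proof (HA j (k - j)%nat) as H'; replace (j + (k - j))%nat with k in H' by lia.
    pose proof (HO k); lra. }
(* Every left end is at most every right end, so the suprema of the left and of the lower ends lie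
   in all the rectangles. *)
destruct (completeness (fun z => exists k, z = A k)) as [x [Hx1 Hx2]].
{ exists b0; intros z [k ->]; pose proof (HO k); lra. }
{ exists (A 0%nat), 0%nat; reflexivity. }
destruct (completeness (fun z => exists k, z = C' k)) as [y [Hy1 Hy2]].
{ exists d0; intros z [k ->]; pose proof (HO k); lra. }
{ exists (C' 0%nat), 0%nat; reflexivity. }
assert (HX : forall k, A k <= x <= B k /\ C' k <= y <= E k).
{ intros k; repeat split.
  - apply Hx1; exists k; reflexivity.
  - apply Hx2; intros z [j ->]; apply HAB.
  - apply Hy1; exists k; reflexivity.
  - apply Hy2; intros z [j ->]; apply HAB. }
destruct (Hloc x y) as [del [Hdel Hd]].
{ pose proof (HX 0%nat); pose proof (HO 0%nat); lra. }
{ pose proof (HX 0%nat); pose proof (HO 0%nat); lra. }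
assert (Hlen : forall k, B k - A k = (b0 - a0) * (/ 2) ^ k /\
   E k - C' k = (d0 - c0) * (/ 2) ^ k).
{ induction k as [|k IH]; [unfold A, B, C', E; simpl; lra |].
  pose proof (HS k); simpl; lra. }
(* [L] dominates both side lengths; the summand 1 keeps it positive when the rectangle is a
   point. *)
pose (L := (b0 - a0) + (d0 - c0) + 1).
destruct (pow_lt_1_zero (/ 2)) with (y := del / L) as [N HN].
{ rewrite Rabs_pos_eq; lra. }
{ apply Rdiv_lt_0_compat; unfold L; lra. }
specialize (HN N (Nat.le_refl _)).
assert (Hp : 0 < (/ 2) ^ N) by (apply pow_lt; lra).
rewrite Rabs_pos_eq in HN by lra.
assert (HL : L * (/ 2) ^ N < del).
{ apply Rmult_lt_reg_r with (/ L); [apply Rinv_0_lt_compat; unfold L; lra |].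
  replace (L * (/ 2) ^ N * / L) with ((/ 2) ^ N) by (field; unfold L; lra).
  exact HN. }
assert ((b0 - a0) * (/ 2) ^ N < del /\ (d0 - c0) * (/ 2) ^ N < del).
{ assert (0 <= (b0 - a0) * (/ 2) ^ N) by (apply Rmult_le_pos; lra).
  assert (0 <= (d0 - c0) * (/ 2) ^ N) by (apply Rmult_le_pos; lra).
  unfold L in HL; lra. }
pose proof (HO N) as [HO1 HO2]; pose proof (HX N); pose proof (Hlen N).
apply HO2, Hd; lra.
Qed.

Lemma interval_cousin (Pr : R -> R -> Prop) (a b : R) : a <= b ->
  (forall c m d, a <= c -> c <= m -> m <= d -> d <= b ->
     Pr c m -> Pr m d -> Pr c d) ->
  (forall t, a <= t <= b -> exists del, 0 < del /\
     forall c d, a <= c -> c <= t -> t <= d -> d <= b -> d - c < del ->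
       Pr c d) ->
  Pr a b.
Proof.
intros Hab Hg Hl.
apply (quadrisection (fun _ _ c d => Pr c d) 0 0 a b); try lra.
- intros; now apply (Hg c n d).
- intros x y _ Hy; destruct (Hl y Hy) as [del [H1 H2]].
  exists del; split; [exact H1 | intros; apply H2; lra].
Qed.

(** Connectedness of the interval through Cousin's lemma: [f c = f d] passes to adjacent intervals,
    and on a short interval around [t] both ends are compared with [f t]. *)
Lemma locally_constant_interval (f : R -> R) (a b : R) : a <= b ->
  (forall t, a <= t <= b -> exists del, 0 < del /\
     forall t', a <= t' <= b -> Rabs (t' - t) < del -> f t' = f t) ->
  forall t, a <= t <= b -> f t = f a.
Proof.
intros Hab Hl t Ht; symmetry.
apply (interval_cousin (fun c d => f c = f d) a t); try lra.
- intros; congruence.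
- intros s Hs; destruct (Hl s) as [del [H1 H2]]; [lra |].
  exists del; split; [exact H1 | intros c d Hc1 Hc2 Hd1 Hd2 Hcd].
  transitivity (f s); [| symmetry]; apply H2; try lra; apply Rabs_def1; lra.
Qed.

(** Compactness of the interval: a [del] valid near each point becomes a common one, since two
    adjacent intervals can share the smaller of their values. *)
Lemma interval_uniform (Q : R -> R -> Prop) (a b : R) : a <= b ->
  (forall t, a <= t <= b -> exists del, 0 < del /\
     forall t', a <= t' <= b -> Rabs (t' - t) < del -> Q del t') ->
  (forall del del' t, 0 < del' <= del -> Q del t -> Q del' t) ->
  exists del, 0 < del /\ forall t, a <= t <= b -> Q del t.
Proof.
intros Hab Hl Hmon.
apply (interval_cousin (fun c d => exists del, 0 < del /\
         forall t, c <= t <= d -> Q del t) a b Hab).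
- intros c m d _ _ _ _ [d1 [H1 H1']] [d2 [H2 H2']].
  exists (Rmin d1 d2); split; [now apply Rmin_glb_lt |].
  assert (H3 : 0 < Rmin d1 d2) by now apply Rmin_glb_lt.
  intros t Ht; destruct (Rle_dec t m).
  + apply (Hmon d1); [split; [lra | apply Rmin_l] | apply H1'; lra].
  + apply (Hmon d2); [split; [lra | apply Rmin_r] | apply H2'; lra].
- intros t Ht; destruct (Hl t Ht) as [del [H1 H2]].
  exists del; split; [exact H1 | intros c d Hc1 Hc2 Hd1 Hd2 Hcd].
  exists del; split; [exact H1 |].
  intros t' Ht'; apply H2; [lra | apply Rabs_def1; lra].
Qed.

Lemma differentiable_pt_lim_continuity (f : R -> R -> R) (x y l1 l2 : R) :
  differentiable_pt_lim f x y l1 l2 -> continuity_2d_pt f x y.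
Proof.
intros H; apply differentiable_continuity_pt; now exists l1, l2.
Qed.

Lemma continuity_2d_pt_continuous (f : R -> R -> R) (T : UniformSpace)
  (X Y : T -> R) (t : T) :
  continuity_2d_pt f (X t) (Y t) -> continuous X t -> continuous Y t ->
  continuous (fun s => f (X s) (Y s)) t.
Proof.
intros Hf HX HY.
apply (continuous_comp_2 X Y f t HX HY).
apply continuity_2d_pt_filterlim; exact Hf.
Qed.

Lemma RInt_near_const (f : R -> R) (a b k M : R) : a <= b -> ex_RInt f a b ->
  (forall t, a <= t <= b -> Rabs (f t - k) <= M) ->
  Rabs (RInt f a b - k * (b - a)) <= M * (b - a).
Proof.
intros Hab Hf HM.
assert (Hk : ex_RInt (fun _ : R => k) a b) by apply ex_RInt_const.
replace (RInt f a b - k * (b - a)) with (RInt (fun t => f t - k) a b).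
- rewrite Rmult_comm; apply abs_RInt_le_const; try easy.
  apply (ex_RInt_minus f (fun _ => k)); easy.
- transitivity (minus (RInt f a b) (RInt (fun _ => k) a b)).
  + apply (RInt_minus f (fun _ => k)); easy.
  + rewrite RInt_const; unfold minus, plus, opp, scal; simpl; unfold mult; simpl; ring.
Qed.

(** * Goursat for closed forms *)

(** The shared [l2] expresses [A_y = B_x]. Differentiability at the single point is all that
    monogenicity provides. *)
Definition closed_at (A B : R -> R -> R) (x y : R) : Prop :=
  exists l1 l2 l3,
    differentiable_pt_lim A x y l1 l2 /\ differentiable_pt_lim B x y l2 l3.

Lemma closed_at_continuity (A B : R -> R -> R) (x y : R) :
  closed_at A B x y -> continuity_2d_pt A x y /\ continuity_2d_pt B x y.
Proof.
intros [l1 [l2 [l3 [HA HB]]]]; split;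
  [now apply (differentiable_pt_lim_continuity A x y l1 l2)
  |now apply (differentiable_pt_lim_continuity B x y l2 l3)].
Qed.

Lemma Rabs_minus_le (x y : R) : Rabs (x - y) <= Rabs x + Rabs y.
Proof. rewrite <- (Rabs_Ropp y); exact (Rabs_triang x (- y)). Qed.

Lemma ex_RInt_slice1 (A : R -> R -> R) (a b y : R) :
  (forall x, Rmin a b <= x <= Rmax a b -> continuity_2d_pt A x y) ->
  ex_RInt (fun x => A x y) a b.
Proof.
intros H; apply (ex_RInt_continuous (V := R_CompleteNormedModule)).
intros z Hz; apply (continuity_2d_pt_continuous A _ (fun s => s) (fun _ => y)).
- now apply H.
- apply continuous_id.
- apply continuous_const.
Qed.

Lemma ex_RInt_slice2 (A : R -> R -> R) (a b x : R) :
  (forall y, Rmin a b <= y <= Rmax a b -> continuity_2d_pt A x y) ->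
  ex_RInt (fun y => A x y) a b.
Proof.
intros H; apply (ex_RInt_continuous (V := R_CompleteNormedModule)).
intros z Hz; apply (continuity_2d_pt_continuous A _ (fun _ => x) (fun s => s)).
- now apply H.
- apply continuous_const.
- apply continuous_id.
Qed.

Lemma RInt_Chasles_R (f : R -> R) (a b c : R) :
  ex_RInt f a b -> ex_RInt f b c -> RInt f a c = RInt f a b + RInt f b c.
Proof. intros H1 H2; symmetry; exact (RInt_Chasles f a b c H1 H2). Qed.

Lemma RInt_minus_R (f g : R -> R) (a b : R) :
  ex_RInt f a b -> ex_RInt g a b ->
  RInt (fun t => f t - g t) a b = RInt f a b - RInt g a b.
Proof. intros H1 H2; exact (RInt_minus f g a b H1 H2). Qed.

(* The sides are grouped in opposite pairs, so that near a point of
   differentiability the linear parts of [A] and [B] contribute the opposite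
   amounts [-+ A_y (b - a) (d - c)], whence no integral of a linear function
   has to be computed. *)
Lemma goursat_rectangle (A B : R -> R -> R) (a0 b0 c0 d0 : R) :
  a0 <= b0 -> c0 <= d0 ->
  (forall x y, a0 <= x <= b0 -> c0 <= y <= d0 -> closed_at A B x y) ->
  RInt (fun x => A x c0) a0 b0 + RInt (fun y => B b0 y) c0 d0 =
  RInt (fun x => A x d0) a0 b0 + RInt (fun y => B a0 y) c0 d0.
Proof.
intros Hab Hcd Hcl.
assert (EA : forall a b y, a0 <= a <= b0 -> a0 <= b <= b0 -> c0 <= y <= d0 ->
  ex_RInt (fun x => A x y) a b).
{ intros a b y Ha Hb Hy; apply ex_RInt_slice1; intros x Hx.
  apply (closed_at_continuity A B), Hcl; [| exact Hy].
  revert Hx; apply Rmin_case; apply Rmax_case; lra. }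
assert (EB : forall c d x, c0 <= c <= d0 -> c0 <= d <= d0 -> a0 <= x <= b0 ->
  ex_RInt (fun y => B x y) c d).
{ intros c d x Hc Hd Hx; apply ex_RInt_slice2; intros y Hy.
  apply (closed_at_continuity A B), Hcl; [exact Hx |].
  revert Hy; apply Rmin_case; apply Rmax_case; lra. }
pose (E := fun a b c d =>
  RInt (fun x => A x c) a b - RInt (fun x => A x d) a b +
  (RInt (fun y => B b y) c d - RInt (fun y => B a y) c d)).
assert (HE : forall eps, 0 < eps ->
  Rabs (E a0 b0 c0 d0) <= 2 * eps * ((b0 - a0) + (d0 - c0)) ^ 2).
{ intros eps Heps.
  (* The bound is quadratic in the half-perimeter: each quarter has half of it, so the four bounds
     add up exactly to the bound of the whole. *)
  apply (quadrisection (fun a b c d =>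
     Rabs (E a b c d) <= 2 * eps * ((b - a) + (d - c)) ^ 2) a0 b0 c0 d0 Hab Hcd).
  - intros a m b c n d Ha Hm Hmb Hb Hc Hn Hnd Hd Hm2 Hn2.
    assert (Esum : E a b c d = E a m c n + E m b c n + E a m n d + E m b n d).
    { unfold E.
      rewrite (RInt_Chasles_R (fun x => A x c) a m b); try (apply EA; lra).
      rewrite (RInt_Chasles_R (fun x => A x d) a m b); try (apply EA; lra).
      rewrite (RInt_Chasles_R (fun y => B b y) c n d); try (apply EB; lra).
      rewrite (RInt_Chasles_R (fun y => B a y) c n d); try (apply EB; lra).
      ring. }
    rewrite Esum; intros H1 H2 H3 H4.
    set (w := (m - a) + (n - c)).
    replace ((m - a) + (n - c)) with w in H1 by reflexivity.
    replace ((b - m) + (n - c)) with w in H2 by (unfold w; lra).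
    replace ((m - a) + (d - n)) with w in H3 by (unfold w; lra).
    replace ((b - m) + (d - n)) with w in H4 by (unfold w; lra).
    replace ((b - a) + (d - c)) with (2 * w) by (unfold w; lra).
    pose proof (Rabs_triang (E a m c n + E m b c n + E a m n d) (E m b n d)).
    pose proof (Rabs_triang (E a m c n + E m b c n) (E a m n d)).
    pose proof (Rabs_triang (E a m c n) (E m b c n)).
    replace (2 * eps * (2 * w) ^ 2) with (4 * (2 * eps * w ^ 2)) by ring.
    lra.
  - intros x y Hx Hy.
    destruct (Hcl x y Hx Hy) as [l1 [l2 [l3 [HA HB]]]].
    destruct (HA (mkposreal eps Heps)) as [dA HA'].
    destruct (HB (mkposreal eps Heps)) as [dB HB']; simpl in HA', HB'.
    exists (Rmin dA dB); split; [apply Rmin_glb_lt; apply cond_pos |].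
    intros a b c d Ha Hax Hxb Hb Hc Hcy Hyd Hd Hw Hh.
    assert (Hw1 : b - a < dA) by (apply Rlt_le_trans with (1 := Hw), Rmin_l).
    assert (Hw2 : b - a < dB) by (apply Rlt_le_trans with (1 := Hw), Rmin_r).
    assert (Hh1 : d - c < dA) by (apply Rlt_le_trans with (1 := Hh), Rmin_l).
    assert (Hh2 : d - c < dB) by (apply Rlt_le_trans with (1 := Hh), Rmin_r).
    set (s := (b - a) + (d - c)).
    assert (Hmax : forall u v, a <= u <= b -> c <= v <= d ->
      eps * Rmax (Rabs (u - x)) (Rabs (v - y)) <= eps * s).
    { intros u v Hu Hv; apply Rmult_le_compat_l; [lra |].
      apply Rmax_lub; apply Rabs_le; unfold s; lra. }
    (* Two values of [A] are compared with their linear approximations, each with error at most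
       [eps * s]; hence the factor 2 here and in the final bound. *)
    assert (I1 : Rabs (RInt (fun t => A t c - A t d) a b
                       - (l2 * (c - d)) * (b - a)) <= 2 * eps * s * (b - a)).
    { apply RInt_near_const; [lra | |].
      - apply (ex_RInt_minus (V := R_NormedModule)); apply EA; lra.
      - intros t Ht.
        assert (T1 := HA' t c); assert (T2 := HA' t d).
        assert (M1 := Hmax t c); assert (M2 := Hmax t d).
        replace (2 * eps * s) with (eps * s + eps * s) by ring.
        apply Rle_trans with (2 := Rplus_le_compat _ _ _ _
          (M1 ltac:(lra) ltac:(lra)) (M2 ltac:(lra) ltac:(lra))).
        apply Rle_trans with (2 := Rplus_le_compat _ _ _ _
          (T1 ltac:(apply Rabs_def1; lra) ltac:(apply Rabs_def1; lra))
          (T2 ltac:(apply Rabs_def1; lra) ltac:(apply Rabs_def1; lra))).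
        match goal with |- Rabs ?u <= Rabs ?v + Rabs ?w => replace u with (v - w) by ring end.
        apply Rabs_minus_le. }
    assert (I2 : Rabs (RInt (fun t => B b t - B a t) c d
                       - (l2 * (b - a)) * (d - c)) <= 2 * eps * s * (d - c)).
    { apply RInt_near_const; [lra | |].
      - apply (ex_RInt_minus (V := R_NormedModule)); apply EB; lra.
      - intros t Ht.
        assert (T1 := HB' b t); assert (T2 := HB' a t).
        assert (M1 := Hmax b t); assert (M2 := Hmax a t).
        replace (2 * eps * s) with (eps * s + eps * s) by ring.
        apply Rle_trans with (2 := Rplus_le_compat _ _ _ _
          (M1 ltac:(lra) ltac:(lra)) (M2 ltac:(lra) ltac:(lra))).
        apply Rle_trans with (2 := Rplus_le_compat _ _ _ _
          (T1 ltac:(apply Rabs_def1; lra) ltac:(apply Rabs_def1; lra))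
          (T2 ltac:(apply Rabs_def1; lra) ltac:(apply Rabs_def1; lra))).
        match goal with |- Rabs ?u <= Rabs ?v + Rabs ?w => replace u with (v - w) by ring end.
        apply Rabs_minus_le. }
    rewrite RInt_minus_R in I1 by (apply EA; lra).
    rewrite RInt_minus_R in I2 by (apply EB; lra).
    replace (2 * eps * s ^ 2) with (2 * eps * s * (b - a) + 2 * eps * s * (d - c))
      by (unfold s; ring).
    apply Rle_trans with (2 := Rplus_le_compat _ _ _ _ I1 I2).
    apply Rle_trans with (2 := Rabs_triang _ _).
    apply Req_le, f_equal; unfold E.
    change (fun y => B b y) with (B b); change (fun y => B a y) with (B a); ring. }
assert (HE0 : E a0 b0 c0 d0 = 0).
{ apply Rabs_eq_0, Rle_antisym; [| apply Rabs_pos].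
  apply Rnot_lt_le; intros Hlt.
  (* For [eps = e / K] the bound reads [e <= (e / K) * (K - 1)], impossible when [e > 0]. *)
  set (K := 2 * ((b0 - a0) + (d0 - c0)) ^ 2 + 1).
  assert (HK : 0 < K) by (unfold K; pose proof (pow2_ge_0 ((b0 - a0) + (d0 - c0))); lra).
  specialize (HE (Rabs (E a0 b0 c0 d0) / K) ltac:(apply Rdiv_lt_0_compat; lra)).
  set (e := Rabs (E a0 b0 c0 d0)) in *.
  assert (H : e = e / K * K) by (field; lra).
  assert (0 < e / K) by (apply Rdiv_lt_0_compat; lra).
  unfold K in H at 2; rewrite Rmult_plus_distr_l in H; lra. }
unfold E in HE0; lra.
Qed.

(** * Local primitives on squares *)

Definition near_sq (x0 y0 r x y : R) : Prop :=
  Rabs (x - x0) < r /\ Rabs (y - y0) < r.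

Lemma near_sq_between (x0 y0 r x y x' y' u v : R) :
  near_sq x0 y0 r x y -> near_sq x0 y0 r x' y' ->
  Rmin x x' <= u <= Rmax x x' -> Rmin y y' <= v <= Rmax y y' ->
  near_sq x0 y0 r u v.
Proof.
intros [H1 H2] [H3 H4] Hu Hv.
apply Rabs_def2 in H1; apply Rabs_def2 in H2; apply Rabs_def2 in H3;
  apply Rabs_def2 in H4.
split; apply Rabs_def1; revert Hu Hv;
  apply Rmin_case; apply Rmax_case; apply Rmin_case; apply Rmax_case; lra.
Qed.

Lemma RInt_swap_R (f : R -> R) (a b : R) :
  ex_RInt f a b -> RInt f b a = - RInt f a b.
Proof.
intros H; symmetry; exact (opp_RInt_swap (V := R_CompleteNormedModule) f a b H).
Qed.

Lemma closed_ex_RInt1 (A B : R -> R -> R) (x0 y0 r c d s : R) :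
  (forall x y, near_sq x0 y0 r x y -> closed_at A B x y) ->
  near_sq x0 y0 r c s -> near_sq x0 y0 r d s ->
  ex_RInt (fun t => A t s) c d.
Proof.
intros Hcl Hc Hd; apply ex_RInt_slice1; intros t Ht.
apply (closed_at_continuity A B), Hcl.
apply (near_sq_between x0 y0 r c s d s); try assumption.
rewrite Rmin_left, Rmax_left; lra.
Qed.

Lemma closed_ex_RInt2 (A B : R -> R -> R) (x0 y0 r c d s : R) :
  (forall x y, near_sq x0 y0 r x y -> closed_at A B x y) ->
  near_sq x0 y0 r s c -> near_sq x0 y0 r s d ->
  ex_RInt (fun t => B s t) c d.
Proof.
intros Hcl Hc Hd; apply ex_RInt_slice2; intros t Ht.
apply (closed_at_continuity A B), Hcl.
apply (near_sq_between x0 y0 r s c s d); try assumption.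
rewrite Rmin_left, Rmax_left; lra.
Qed.

(** The opposite corners may come in any relative position: reversing an integral changes its sign,
    and the four orderings reduce to the increasing one. *)
Lemma goursat_corners (A B : R -> R -> R) (x0 y0 r x y x' y' : R) :
  (forall u v, near_sq x0 y0 r u v -> closed_at A B u v) ->
  near_sq x0 y0 r x y -> near_sq x0 y0 r x' y' ->
  RInt (fun t => A t y) x x' + RInt (fun t => B x' t) y y' =
  RInt (fun t => A t y') x x' + RInt (fun t => B x t) y y'.
Proof.
intros Hcl Hxy Hxy'.
assert (H : forall a b c d, a <= b -> c <= d ->
  (a = Rmin x x' /\ b = Rmax x x' /\ c = Rmin y y' /\ d = Rmax y y') ->
  RInt (fun x => A x c) a b + RInt (fun y => B b y) c d =
  RInt (fun x => A x d) a b + RInt (fun y => B a y) c d).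
{ intros a b c d Hab Hcd (-> & -> & -> & ->).
  apply goursat_rectangle; try assumption.
  intros u v Hu Hv; apply Hcl.
  now apply (near_sq_between x0 y0 r x y x' y'). }
assert (N1 : near_sq x0 y0 r x y') by (destruct Hxy, Hxy'; now split).
assert (N2 : near_sq x0 y0 r x' y) by (destruct Hxy, Hxy'; now split).
assert (EA := closed_ex_RInt1 A B x0 y0 r x x' y Hcl Hxy N2).
assert (EA' := closed_ex_RInt1 A B x0 y0 r x x' y' Hcl N1 Hxy').
assert (EB := closed_ex_RInt2 A B x0 y0 r y y' x Hcl Hxy N1).
assert (EB' := closed_ex_RInt2 A B x0 y0 r y y' x' Hcl N2 Hxy').
assert (H' := H (Rmin x x') (Rmax x x') (Rmin y y') (Rmax y y')
  (Rle_trans _ _ _ (Rmin_l _ _) (Rmax_l _ _))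
  (Rle_trans _ _ _ (Rmin_l _ _) (Rmax_l _ _)) ltac:(repeat split)).
clear H; revert H'.
destruct (Rle_dec x x');
  [rewrite (Rmin_left x x'), (Rmax_right x x') by lra
  | rewrite (Rmin_right x x'), (Rmax_left x x') by lra];
(destruct (Rle_dec y y');
  [rewrite (Rmin_left y y'), (Rmax_right y y') by lra
  | rewrite (Rmin_right y y'), (Rmax_left y y') by lra]);
 rewrite ?(RInt_swap_R _ x x'), ?(RInt_swap_R _ y y');
 try (intros; lra); auto.
Qed.

Lemma RInt_near_const_gen (f : R -> R) (a b k M : R) : ex_RInt f a b ->
  (forall t, Rmin a b <= t <= Rmax a b -> Rabs (f t - k) <= M) ->
  Rabs (RInt f a b - k * (b - a)) <= M * Rabs (b - a).
Proof.
intros Hf HM; destruct (Rle_dec a b) as [H | H].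
- rewrite (Rabs_pos_eq (b - a)) by lra.
  rewrite Rmin_left, Rmax_right in HM by lra.
  now apply RInt_near_const.
- rewrite (Rabs_minus_sym b a), (Rabs_pos_eq (a - b)) by lra.
  rewrite Rmin_right, Rmax_left in HM by lra.
  rewrite RInt_swap_R by now apply ex_RInt_swap.
  replace (- RInt f b a - k * (b - a)) with (- (RInt f b a - k * (a - b))) by ring.
  rewrite Rabs_Ropp; apply RInt_near_const; [lra | now apply ex_RInt_swap | exact HM].
Qed.

(** The primitive is the integral along the horizontal segment from the centre followed by the
    vertical one. Its increments in [y] are immediate; those in [x] are read off the path that goes
    vertically first, which Goursat shows to be equivalent. *)
Lemma goursat_primitive (A B : R -> R -> R) (x0 y0 r : R) :
  (forall x y, near_sq x0 y0 r x y -> closed_at A B x y) ->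
  exists F : R -> R -> R, forall x y, near_sq x0 y0 r x y ->
    differentiable_pt_lim F x y (A x y) (B x y).
Proof.
intros Hcl.
exists (fun x y => RInt (fun t => A t y0) x0 x + RInt (fun t => B x t) y0 y).
intros x y Hxy eps.
assert (Hr : 0 < r) by (destruct Hxy as [H _]; pose proof (Rabs_pos (x - x0)); lra).
assert (H0 : near_sq x0 y0 r x0 y0).
{ split; rewrite Rminus_diag, Rabs_R0; exact Hr. }
destruct (closed_at_continuity A B x y (Hcl x y Hxy)) as [CA CB].
destruct (CA (pos_div_2 eps)) as [dA HA].
destruct (CB (pos_div_2 eps)) as [dB HB]; simpl in HA, HB.
assert (Hdel : 0 < Rmin (Rmin dA dB) (Rmin (r - Rabs (x - x0)) (r - Rabs (y - y0)))).
{ destruct Hxy; repeat apply Rmin_glb_lt; try apply cond_pos; lra. }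
exists (mkposreal _ Hdel); simpl; intros u v Hu Hv.
apply Rmin_Rgt in Hu; apply Rmin_Rgt in Hv.
destruct Hu as [Hu1 Hu2], Hv as [Hv1 Hv2].
apply Rmin_Rgt in Hu1; apply Rmin_Rgt in Hu2;
  apply Rmin_Rgt in Hv1; apply Rmin_Rgt in Hv2.
assert (Huv : near_sq x0 y0 r u v).
{ split.
  - replace (u - x0) with ((u - x) + (x - x0)) by ring.
    pose proof (Rabs_triang (u - x) (x - x0)); lra.
  - replace (v - y0) with ((v - y) + (y - y0)) by ring.
    pose proof (Rabs_triang (v - y) (y - y0)); lra. }
assert (Huy : near_sq x0 y0 r u y) by (destruct Hxy, Huv; now split).
assert (Eb : forall s c d, near_sq x0 y0 r s c -> near_sq x0 y0 r s d ->
  ex_RInt (fun t => B s t) c d).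
{ intros s c d; exact (closed_ex_RInt2 A B x0 y0 r c d s Hcl). }
assert (Ea : forall s c d, near_sq x0 y0 r c s -> near_sq x0 y0 r d s ->
  ex_RInt (fun t => A t s) c d).
{ intros s c d; exact (closed_ex_RInt1 A B x0 y0 r c d s Hcl). }
assert (N1 : forall s t, near_sq x0 y0 r s t -> near_sq x0 y0 r x0 t /\ near_sq x0 y0 r s y0).
{ intros s t [? ?]; destruct H0; repeat split; assumption. }
(* [F x y] and [F u y] are both rewritten over vertical-first paths, so they differ by the integral
   of [A] at height [y] from [x] to [u]. The increment from [(x, y)] to [(u, v)] is thus an integral
   along two short sides, where continuity makes [A] and [B] nearly constant. *)
assert (Gx := goursat_corners A B x0 y0 r x0 y0 x y Hcl H0 Hxy).
assert (Gu := goursat_corners A B x0 y0 r x0 y0 u y Hcl H0 Huy).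
assert (ExA : RInt (fun t => A t y) x0 u = RInt (fun t => A t y) x0 x + RInt (fun t => A t y) x u).
{ apply RInt_Chasles_R; apply Ea; try assumption; now apply (N1 x y). }
assert (ExB : RInt (fun t => B u t) y0 v = RInt (fun t => B u t) y0 y + RInt (fun t => B u t) y v).
{ apply RInt_Chasles_R; apply Eb; try assumption; now apply (N1 u y). }
assert (I1 : Rabs (RInt (fun t => A t y) x u - A x y * (u - x)) <= eps / 2 * Rabs (u - x)).
{ apply RInt_near_const_gen; [now apply Ea |].
  intros t Ht; left; apply HA; [| rewrite Rminus_diag, Rabs_R0; apply cond_pos].
  apply Rle_lt_trans with (Rabs (u - x)); [| easy].
  revert Ht; unfold Rabs, Rmin, Rmax; repeat destruct Rcase_abs; repeat destruct Rle_dec; lra. }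
assert (I2 : Rabs (RInt (fun t => B u t) y v - B x y * (v - y)) <= eps / 2 * Rabs (v - y)).
{ apply RInt_near_const_gen; [now apply Eb |].
  intros t Ht; left; apply HB; [easy |].
  apply Rle_lt_trans with (Rabs (v - y)); [| easy].
  revert Ht; unfold Rabs, Rmin, Rmax; repeat destruct Rcase_abs; repeat destruct Rle_dec; lra. }
assert (M1 : eps / 2 * Rabs (u - x) <= eps / 2 * Rmax (Rabs (u - x)) (Rabs (v - y))).
{ apply Rmult_le_compat_l; [pose proof (cond_pos eps); lra | apply Rmax_l]. }
assert (M2 : eps / 2 * Rabs (v - y) <= eps / 2 * Rmax (Rabs (u - x)) (Rabs (v - y))).
{ apply Rmult_le_compat_l; [pose proof (cond_pos eps); lra | apply Rmax_r]. }
match goal with |- Rabs ?w <= _ => replace w with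
  ((RInt (fun t => A t y) x u - A x y * (u - x)) +
   (RInt (fun t => B u t) y v - B x y * (v - y))) by lra end.
apply Rle_trans with (1 := Rabs_triang _ _).
lra.
Qed.

(** * Integrals depending on two parameters *)

Lemma continuous_Rplus {T : UniformSpace} (f g : T -> R) (x : T) :
  continuous f x -> continuous g x -> continuous (fun t => f t + g t) x.
Proof. exact (continuous_plus (V := R_NormedModule) f g x). Qed.

Lemma continuous_Rminus {T : UniformSpace} (f g : T -> R) (x : T) :
  continuous f x -> continuous g x -> continuous (fun t => f t - g t) x.
Proof. exact (continuous_minus (V := R_NormedModule) f g x). Qed.

Lemma continuous_Rmult {T : UniformSpace} (f g : T -> R) (x : T) :
  continuous f x -> continuous g x -> continuous (fun t => f t * g t) x.
Proof. exact (continuous_mult (K := R_AbsRing) f g x). Qed.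

Lemma continuous_Rcos {T : UniformSpace} (f : T -> R) (x : T) :
  continuous f x -> continuous (fun t => cos (f t)) x.
Proof. intros H; apply (continuous_comp f cos x H), continuous_cos. Qed.

Lemma continuous_Rsin {T : UniformSpace} (f : T -> R) (x : T) :
  continuous f x -> continuous (fun t => sin (f t)) x.
Proof. intros H; apply (continuous_comp f sin x H), continuous_sin. Qed.

Lemma continuous_fst_comp {T U V : UniformSpace} (f : T -> U * V) (x : T) :
  continuous f x -> continuous (fun t => fst (f t)) x.
Proof. intros H; apply (continuous_comp f fst x H), continuous_fst. Qed.

Lemma continuous_snd_comp {T U V : UniformSpace} (f : T -> U * V) (x : T) :
  continuous f x -> continuous (fun t => snd (f t)) x.
Proof. intros H; apply (continuous_comp f snd x H), continuous_snd. Qed.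

Ltac cont :=
  lazymatch goal with
  | |- continuous (fun _ => ?c) _ => exact (continuous_const c _)
  | |- continuous (fun x => x) _ => exact (continuous_id _)
  | |- continuous (fun x => @?f x + @?g x) ?y =>
      refine (continuous_Rplus f g y _ _); cont
  | |- continuous (fun x => @?f x - @?g x) ?y =>
      refine (continuous_Rminus f g y _ _); cont
  | |- continuous (fun x => @?f x * @?g x) ?y =>
      refine (continuous_Rmult f g y _ _); cont
  | |- continuous (fun x => cos (@?f x)) ?y =>
      refine (continuous_Rcos f y _); cont
  | |- continuous (fun x => sin (@?f x)) ?y =>
      refine (continuous_Rsin f y _); cont
  | |- continuous (fun x => fst (@?f x)) ?y =>
      refine (continuous_fst_comp f y _); cont
  | |- continuous (fun x => snd (@?f x)) ?y =>
      refine (continuous_snd_comp f y _); cont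
  | _ => assumption
  end.

(** Joint continuity in the integration variable and both parameters, from which uniformity over a
    compact interval can be extracted. *)
Definition param_continuous (G : R -> R -> R -> R) (t x y : R) : Prop :=
  continuous (fun w : R * (R * R) => G (fst w) (fst (snd w)) (snd (snd w)))
    (t, (x, y)).

Lemma param_continuous_slice (G : R -> R -> R -> R) (t x y : R) :
  param_continuous G t x y -> continuous (fun s => G s x y) t.
Proof.
intros H.
apply (continuous_comp (fun s : R => (s, (x, y)) : R * (R * R))
  (fun w : R * (R * R) => G (fst w) (fst (snd w)) (snd (snd w)))); [| exact H].
apply (continuous_comp_2 (fun s : R => s) (fun _ : R => (x, y) : R * R)
        (fun s w => (s, w) : R * (R * R)) t).
- apply continuous_id.
- apply continuous_const.
- apply filterlim_ext with (fun w : R * (R * R) => w); [intros [? ?]; reflexivity |].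
  apply filterlim_id.
Qed.

(** Near each [t], both [G t' x y] and [G t' x0 y0] are within [eps / 2] of [G t x0 y0]; compactness
    then makes the neighbourhood of [(x0, y0)] independent of [t]. *)
Lemma param_uniform (G : R -> R -> R -> R) (a b x0 y0 : R) : a <= b ->
  (forall t, a <= t <= b -> param_continuous G t x0 y0) ->
  forall eps, 0 < eps -> exists del, 0 < del /\
    forall t, a <= t <= b -> forall x y, near_sq x0 y0 del x y ->
      Rabs (G t x y - G t x0 y0) < eps.
Proof.
intros Hab HG eps Heps.
apply (interval_uniform (fun del t => forall x y, near_sq x0 y0 del x y ->
      Rabs (G t x y - G t x0 y0) < eps) a b Hab).
- intros t Ht.
  assert (He : 0 < eps / 2) by lra.
  destruct (proj1 (filterlim_locally _ _) (HG t Ht) (mkposreal _ He)) as [del Hdel].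
  exists del; split; [apply cond_pos |].
  intros t' _ Ht' x y [Hx Hy].
  assert (H1 : Rabs (G t' x y - G t x0 y0) < eps / 2).
  { apply (Hdel (t', (x, y))); repeat split; assumption. }
  assert (H2 : Rabs (G t' x0 y0 - G t x0 y0) < eps / 2).
  { apply (Hdel (t', (x0, y0))); [repeat split; [assumption | |]]; apply ball_center. }
  apply Rabs_def2 in H1; apply Rabs_def2 in H2; apply Rabs_def1; lra.
- intros del del' t [H1 H2] H x y [Hx Hy]; apply H; split; lra.
Qed.

Lemma RInt_param_continuity (G : R -> R -> R -> R) (a b x0 y0 r : R) :
  a <= b -> 0 < r ->
  (forall t, a <= t <= b -> forall x y, near_sq x0 y0 r x y -> param_continuous G t x y) ->
  continuity_2d_pt (fun x y => RInt (fun t => G t x y) a b) x0 y0.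
Proof.
intros Hab Hr HG eps.
(* The summand 1 avoids a division by zero when [a = b]. *)
assert (He : 0 < eps / (b - a + 1)) by (apply Rdiv_lt_0_compat; [apply cond_pos | lra]).
assert (H0 : near_sq x0 y0 r x0 y0) by (split; rewrite Rminus_diag, Rabs_R0; lra).
assert (Hex : forall x y, near_sq x0 y0 r x y -> ex_RInt (fun t => G t x y) a b).
{ intros x y Hxy; apply (ex_RInt_continuous (V := R_CompleteNormedModule)).
  intros t Ht; rewrite Rmin_left, Rmax_right in Ht by lra.
  apply param_continuous_slice, HG; assumption. }
destruct (param_uniform G a b x0 y0 Hab (fun t Ht => HG t Ht x0 y0 H0) _ He)
  as [del [Hdel H]].
assert (Hd : 0 < Rmin del r) by now apply Rmin_glb_lt.
exists (mkposreal _ Hd); simpl; intros x y Hx Hy.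
apply Rmin_Rgt in Hx; apply Rmin_Rgt in Hy.
assert (Hxy : near_sq x0 y0 r x y) by (split; lra).
rewrite <- RInt_minus_R by (apply Hex; assumption).
apply Rle_lt_trans with ((b - a) * (eps / (b - a + 1))).
- apply abs_RInt_le_const; [exact Hab | |].
  + apply (ex_RInt_minus (V := R_NormedModule)); apply Hex; assumption.
  + intros t Ht; left; apply H; [exact Ht | split; lra].
- apply Rlt_le_trans with ((b - a + 1) * (eps / (b - a + 1))).
  + apply Rmult_lt_compat_r; lra.
  + apply Req_le; field; lra.
Qed.

Lemma differentiable_pt_lim_slope (F : R -> R -> R) (x y u v l1 l2 s : R) :
  differentiable_pt_lim F (x + s * u) (y + s * v) l1 l2 ->
  is_derive (fun s => F (x + s * u) (y + s * v)) s (l1 * u + l2 * v).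
Proof.
intros H; apply is_derive_Reals.
apply (derivable_pt_lim_comp_2d F (fun s => x + s * u) (fun s => y + s * v)).
- exact H.
- apply is_derive_Reals; auto_derive; [easy | ring].
- apply is_derive_Reals; auto_derive; [easy | ring].
Qed.

Lemma segment_mean_value (F A B : R -> R -> R) (x y x' y' : R) :
  (forall s, 0 <= s <= 1 ->
     differentiable_pt_lim F (x + s * (x' - x)) (y + s * (y' - y))
       (A (x + s * (x' - x)) (y + s * (y' - y)))
       (B (x + s * (x' - x)) (y + s * (y' - y)))) ->
  exists s, 0 <= s <= 1 /\ F x' y' - F x y =
    A (x + s * (x' - x)) (y + s * (y' - y)) * (x' - x) +
    B (x + s * (x' - x)) (y + s * (y' - y)) * (y' - y).
Proof.
intros H.
destruct (MVT_gen (fun s => F (x + s * (x' - x)) (y + s * (y' - y))) 0 1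
  (fun s => A (x + s * (x' - x)) (y + s * (y' - y)) * (x' - x) +
    B (x + s * (x' - x)) (y + s * (y' - y)) * (y' - y))) as [s [Hs Heq]].
- rewrite Rmin_left, Rmax_right by lra; intros s Hs.
  exact (differentiable_pt_lim_slope F x y (x' - x) (y' - y) _ _ s (H s ltac:(lra))).
- rewrite Rmin_left, Rmax_right by lra; intros s Hs.
  apply continuity_pt_filterlim.
  apply (ex_derive_continuous (V := R_NormedModule)
    (fun s => F (x + s * (x' - x)) (y + s * (y' - y))) s).
  eexists; exact (differentiable_pt_lim_slope F x y (x' - x) (y' - y) _ _ s (H s ltac:(lra))).
- rewrite Rmin_left, Rmax_right in Hs by lra.
  exists s; split; [exact Hs |].
  replace (x + 1 * (x' - x)) with x' in Heq by ring.
  replace (y + 1 * (y' - y)) with y' in Heq by ring.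
  replace (x + 0 * (x' - x)) with x in Heq by ring.
  replace (y + 0 * (y' - y)) with y in Heq by ring.
  rewrite Heq; ring.
Qed.

Lemma near_sq_segment (x0 y0 r x y x' y' s : R) :
  near_sq x0 y0 r x y -> near_sq x0 y0 r x' y' -> 0 <= s <= 1 ->
  near_sq x0 y0 r (x + s * (x' - x)) (y + s * (y' - y)).
Proof.
assert (K : forall z z', 0 <= s <= 1 -> Rmin z z' <= z + s * (z' - z) <= Rmax z z').
{ intros z z' Hs; destruct (Rle_dec z z') as [H | H];
  [rewrite Rmin_left, Rmax_right by lra | rewrite Rmin_right, Rmax_left by lra];
  nra. }
intros H1 H2 Hs; apply (near_sq_between x0 y0 r x y x' y'); auto.
Qed.

Lemma near_sq_mono (x0 y0 r r' x y : R) :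
  r <= r' -> near_sq x0 y0 r x y -> near_sq x0 y0 r' x y.
Proof. intros H [H1 H2]; split; lra. Qed.

Lemma near_sq_center (x0 y0 r : R) : 0 < r -> near_sq x0 y0 r x0 y0.
Proof. intros H; split; rewrite Rminus_diag, Rabs_R0; exact H. Qed.

(** The mean value theorem along the segment from [(x0, y0)] turns the remainder of [G t] into
    increments of [G1 t] and [G2 t] from that point, which are small uniformly in [t]. *)
Lemma RInt_param_differentiable (G G1 G2 : R -> R -> R -> R) (a b x0 y0 r : R) :
  a <= b -> 0 < r ->
  (forall t, a <= t <= b -> forall x y, near_sq x0 y0 r x y ->
     differentiable_pt_lim (G t) x y (G1 t x y) (G2 t x y)) ->
  (forall t, a <= t <= b -> forall x y, near_sq x0 y0 r x y ->
     param_continuous G t x y) ->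
  (forall t, a <= t <= b ->
     param_continuous G1 t x0 y0 /\ param_continuous G2 t x0 y0) ->
  differentiable_pt_lim (fun x y => RInt (fun t => G t x y) a b) x0 y0
    (RInt (fun t => G1 t x0 y0) a b) (RInt (fun t => G2 t x0 y0) a b).
Proof.
intros Hab Hr HD HG H12 eps.
(* One half for each partial derivative; the length is increased by 1 so that [a = b] is
   harmless. *)
set (e := eps / (2 * (b - a + 1))).
assert (He : 0 < e) by (unfold e; apply Rdiv_lt_0_compat; [apply cond_pos | lra]).
assert (H0 := near_sq_center x0 y0 r Hr).
assert (Hexc : forall f : R -> R, (forall t, a <= t <= b -> continuous f t) -> ex_RInt f a b).
{ intros f Hf; apply (ex_RInt_continuous (V := R_CompleteNormedModule)).
  intros t Ht; rewrite Rmin_left, Rmax_right in Ht by lra; auto. }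
assert (Hex : forall x y, near_sq x0 y0 r x y -> ex_RInt (fun t => G t x y) a b).
{ intros x y Hxy; apply Hexc; intros t Ht.
  apply param_continuous_slice, HG; assumption. }
assert (Hex1 : ex_RInt (fun t => G1 t x0 y0) a b).
{ apply Hexc; intros t Ht; apply param_continuous_slice, H12, Ht. }
assert (Hex2 : ex_RInt (fun t => G2 t x0 y0) a b).
{ apply Hexc; intros t Ht; apply param_continuous_slice, H12, Ht. }
destruct (param_uniform G1 a b x0 y0 Hab (fun t Ht => proj1 (H12 t Ht)) _ He)
  as [d1 [Hd1 U1']].
destruct (param_uniform G2 a b x0 y0 Hab (fun t Ht => proj2 (H12 t Ht)) _ He)
  as [d2 [Hd2 U2']].
assert (Hd : 0 < Rmin (Rmin d1 d2) r) by now repeat apply Rmin_glb_lt.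
set (d := Rmin (Rmin d1 d2) r) in *.
assert (Hdd : d <= d1 /\ d <= d2 /\ d <= r).
{ pose proof (Rmin_l (Rmin d1 d2) r); pose proof (Rmin_r (Rmin d1 d2) r).
  pose proof (Rmin_l d1 d2); pose proof (Rmin_r d1 d2); fold d in H, H1; lra. }
exists (mkposreal _ Hd); simpl; intros x y Hx Hy.
assert (Hxy : near_sq x0 y0 d x y) by now split.
set (h := x - x0); set (k := y - y0).
assert (Eint : RInt (fun t => G t x y - G t x0 y0 - (h * G1 t x0 y0 + k * G2 t x0 y0)) a b =
  RInt (fun t => G t x y) a b - RInt (fun t => G t x0 y0) a b
  - (RInt (fun t => G1 t x0 y0) a b * h + RInt (fun t => G2 t x0 y0) a b * k)).
{ assert (S1 : is_RInt (fun t => h * G1 t x0 y0) a b (h * RInt (fun t => G1 t x0 y0) a b)).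
  { apply (is_RInt_scal (V := R_NormedModule)), (RInt_correct (V := R_CompleteNormedModule)), Hex1. }
  assert (S2 : is_RInt (fun t => k * G2 t x0 y0) a b (k * RInt (fun t => G2 t x0 y0) a b)).
  { apply (is_RInt_scal (V := R_NormedModule)), (RInt_correct (V := R_CompleteNormedModule)), Hex2. }
  assert (S3 := is_RInt_plus (V := R_NormedModule) _ _ _ _ _ _ S1 S2).
  assert (S4 : is_RInt (fun t => G t x y) a b (RInt (fun t => G t x y) a b)).
  { apply (RInt_correct (V := R_CompleteNormedModule)), Hex.
    apply (near_sq_mono _ _ d); [lra | exact Hxy]. }
  assert (S5 : is_RInt (fun t => G t x0 y0) a b (RInt (fun t => G t x0 y0) a b)).
  { apply (RInt_correct (V := R_CompleteNormedModule)), Hex, H0. }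
  assert (S6 := is_RInt_minus (V := R_NormedModule) _ _ _ _ _ _
    (is_RInt_minus (V := R_NormedModule) _ _ _ _ _ _ S4 S5) S3).
  apply (is_RInt_unique (V := R_CompleteNormedModule)) in S6.
  etransitivity; [exact S6 |].
  unfold minus, plus, opp; simpl; ring. }
rewrite <- Eint.
set (M := Rmax (Rabs h) (Rabs k)).
assert (HM : 0 <= M) by (apply Rle_trans with (2 := Rmax_l _ _), Rabs_pos).
apply Rle_trans with ((b - a) * (2 * e * M)).
- apply abs_RInt_le_const; [exact Hab | |].
  { apply (ex_RInt_minus (V := R_NormedModule)
      (fun t => G t x y - G t x0 y0) (fun t => h * G1 t x0 y0 + k * G2 t x0 y0)).
    - apply (ex_RInt_minus (V := R_NormedModule)); apply Hex; [| exact H0].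
      apply (near_sq_mono _ _ d); [lra | exact Hxy].
    - apply (ex_RInt_plus (V := R_NormedModule));
      apply (ex_RInt_scal (V := R_NormedModule)); assumption. }
  intros t Ht.
  destruct (segment_mean_value (G t) (G1 t) (G2 t) x0 y0 x y) as [s [Hs ->]].
  { intros s Hs; apply HD; [exact Ht |].
    apply (near_sq_mono _ _ d); [lra |].
    apply near_sq_segment; [now apply near_sq_center | exact Hxy | exact Hs]. }
  assert (Hn := near_sq_segment x0 y0 d x0 y0 x y s (near_sq_center x0 y0 d Hd) Hxy Hs).
  fold h k; fold h k in Hn.
  set (X := x0 + s * h) in *; set (Y := y0 + s * k) in *.
  replace (G1 t X Y * h + G2 t X Y * k - (h * G1 t x0 y0 + k * G2 t x0 y0))
    with ((G1 t X Y - G1 t x0 y0) * h + (G2 t X Y - G2 t x0 y0) * k) by ring.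
  apply Rle_trans with (1 := Rabs_triang _ _); rewrite !Rabs_mult.
  replace (2 * e * M) with (e * M + e * M) by ring.
  apply Rplus_le_compat; apply Rmult_le_compat; try apply Rabs_pos.
  + left; apply U1'; [exact Ht | apply (near_sq_mono _ _ d); [lra | exact Hn]].
  + apply Rmax_l.
  + left; apply U2'; [exact Ht | apply (near_sq_mono _ _ d); [lra | exact Hn]].
  + apply Rmax_r.
- replace (eps * M) with ((b - a + 1) * (2 * e * M)) by (unfold e; field; lra).
  apply Rmult_le_compat_r; [| lra].
  apply Rmult_le_pos; lra.
Qed.

(** * Cauchy-Riemann systems *)

(** [U + i V] is differentiable at [(x, y)] as a function of [x + i q y], with
    derivative [a + i b]. *)
Definition cr (q : R) (U V : R -> R -> R) (a b x y : R) : Prop :=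
  differentiable_pt_lim U x y a (- (q * b)) /\
  differentiable_pt_lim V x y b (q * a).

Lemma differentiable_pt_lim_lin (F G : R -> R -> R) (al be c x y f1 f2 g1 g2 : R) :
  differentiable_pt_lim F x y f1 f2 -> differentiable_pt_lim G x y g1 g2 ->
  differentiable_pt_lim (fun u v => al * F u v + be * G u v + c) x y
    (al * f1 + be * g1) (al * f2 + be * g2).
Proof.
intros HF HG.
apply (differentiable_pt_lim_comp (fun u v => al * u + be * v + c) F G);
  [| exact HF | exact HG].
(* The affine map has zero remainder, so any radius serves. *)
intros eps; exists eps; intros u v _ _.
match goal with |- Rabs ?w <= _ => replace w with 0 by ring end.
rewrite Rabs_R0; apply Rmult_le_pos; [left; apply cond_pos |].
apply Rle_trans with (2 := Rmax_l _ _), Rabs_pos.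
Qed.

Lemma differentiable_pt_lim_scal (F : R -> R -> R) (al x y f1 f2 : R) :
  differentiable_pt_lim F x y f1 f2 ->
  differentiable_pt_lim (fun u v => al * F u v) x y (al * f1) (al * f2).
Proof.
intros HF; assert (H := differentiable_pt_lim_lin F F al 0 0 x y _ _ _ _ HF HF).
replace (al * f1) with (al * f1 + 0 * f1) by ring.
replace (al * f2) with (al * f2 + 0 * f2) by ring.
apply differentiable_pt_lim_ext with (2 := H).
exists (mkposreal 1 Rlt_0_1); intros; ring.
Qed.

Lemma cr_unique (q : R) (U V : R -> R -> R) (a b a' b' x y : R) :
  cr q U V a b x y -> cr q U V a' b' x y -> a = a' /\ b = b'.
Proof.
intros [H1 H2] [H3 H4].
apply differentiable_pt_lim_unique in H1; apply differentiable_pt_lim_unique in H2;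
apply differentiable_pt_lim_unique in H3; apply differentiable_pt_lim_unique in H4.
split; [transitivity (Derive (fun t => U t y) x) | transitivity (Derive (fun t => V t y) x)];
 [symmetry | | symmetry |]; tauto.
Qed.

Lemma cr_ext (q : R) (U V U' V' : R -> R -> R) (a b x y : R) :
  locally_2d (fun u v => U u v = U' u v /\ V u v = V' u v) x y ->
  cr q U V a b x y -> cr q U' V' a b x y.
Proof.
intros [d Hd] [H1 H2]; split.
- apply differentiable_pt_lim_ext with (2 := H1); exists d; intros; now apply Hd.
- apply differentiable_pt_lim_ext with (2 := H2); exists d; intros; now apply Hd.
Qed.

Lemma cr_continuity (q : R) (U V : R -> R -> R) (a b x y : R) :
  cr q U V a b x y -> continuity_2d_pt U x y /\ continuity_2d_pt V x y.
Proof.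
intros [H1 H2]; split; eapply differentiable_pt_lim_continuity; eassumption.
Qed.

(* Multiplication by [- i]. *)
Lemma cr_rotate (q : R) (U V : R -> R -> R) (a b x y : R) :
  cr q U V a b x y -> cr q V (fun u v => -1 * U u v) b (- a) x y.
Proof.
intros [H1 H2]; split.
- replace (- (q * - a)) with (q * a) by ring; exact H2.
- replace (- a) with (-1 * a) by ring; replace (q * b) with (-1 * - (q * b)) by ring.
  now apply differentiable_pt_lim_scal.
Qed.

(** The two forms integrated are the real and imaginary parts of [(U + i V) (dx + i q dy)], and the
    Cauchy-Riemann equations are exactly their closedness. *)
Lemma cr_primitive (q : R) (U V : R -> R -> R) (x0 y0 r : R) :
  (forall x y, near_sq x0 y0 r x y -> exists a b, cr q U V a b x y) ->
  exists P Q : R -> R -> R, forall x y, near_sq x0 y0 r x y ->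
    cr q P Q (U x y) (V x y) x y.
Proof.
intros H.
destruct (goursat_primitive U (fun x y => - q * V x y) x0 y0 r) as [P HP].
{ intros x y Hxy; destruct (H x y Hxy) as [a [b [H1 H2]]].
  exists a, (- q * b), (- q * (q * a)); split.
  - replace (- q * b) with (- (q * b)) by ring; exact H1.
  - now apply differentiable_pt_lim_scal. }
destruct (goursat_primitive V (fun x y => q * U x y) x0 y0 r) as [Q HQ].
{ intros x y Hxy; destruct (H x y Hxy) as [a [b [H1 H2]]].
  exists b, (q * a), (q * - (q * b)); split; [exact H2 |].
  now apply differentiable_pt_lim_scal. }
exists P, Q; intros x y Hxy; split; [| now apply HQ].
replace (- (q * V x y)) with (- q * V x y) by ring; now apply HP.
Qed.

(** * Mean value formula and regularity of the derivative *)

Lemma Rabs_cos_le (t : R) : Rabs (cos t) <= 1.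
Proof. apply Rabs_le, COS_bound. Qed.

Lemma Rabs_sin_le (t : R) : Rabs (sin t) <= 1.
Proof. apply Rabs_le, SIN_bound. Qed.

(** The ellipse is the circle of radius [|s|] in the variable [x + i q y]; its vertical half-axis
    [|s| / |q|] accounts for the second bound on [rho]. *)
Lemma near_sq_ellipse (q x0 y0 R0 rho s t : R) : q <> 0 ->
  rho <= R0 -> rho * Rabs (/ q) <= R0 -> Rabs s < rho ->
  near_sq x0 y0 R0 (x0 + s * cos t) (y0 + s * / q * sin t).
Proof.
intros Hq H1 H2 Hs.
assert (Hq' : 0 < Rabs (/ q)) by now apply Rabs_pos_lt, Rinv_neq_0_compat.
split.
- replace (x0 + s * cos t - x0) with (s * cos t) by ring; rewrite Rabs_mult.
  pose proof (Rabs_cos_le t); pose proof (Rabs_pos (cos t)); pose proof (Rabs_pos s); nra.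
- replace (y0 + s * / q * sin t - y0) with (s * / q * sin t) by ring.
  rewrite !Rabs_mult.
  assert (Rabs s * Rabs (/ q) < R0) by nra.
  assert (0 <= Rabs s * Rabs (/ q)) by (apply Rmult_le_pos; apply Rabs_pos).
  pose proof (Rabs_sin_le t); pose proof (Rabs_pos (sin t)); nra.
Qed.

(** The radius is the only genuine parameter; the second one is a dummy that fits the integral to
    the two-parameter lemmas. *)
Lemma param_continuous_radius (P : R -> R -> R) (q x0 y0 t s v : R) :
  continuity_2d_pt P (x0 + s * cos t) (y0 + s * / q * sin t) ->
  param_continuous (fun t s _ => P (x0 + s * cos t) (y0 + s * / q * sin t)) t s v.
Proof.
intros H; unfold param_continuous.
apply (continuity_2d_pt_continuous P _
  (fun w : R * (R * R) => x0 + fst (snd w) * cos (fst w))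
  (fun w : R * (R * R) => y0 + fst (snd w) * / q * sin (fst w))).
- exact H.
- cont.
- cont.
Qed.

Lemma param_continuous_center (P : R -> R -> R) (q r x y t : R) :
  continuity_2d_pt P (x + r * cos t) (y + r * / q * sin t) ->
  param_continuous (fun t x y => P (x + r * cos t) (y + r * / q * sin t)) t x y.
Proof.
intros H; unfold param_continuous.
apply (continuity_2d_pt_continuous P _
  (fun w : R * (R * R) => fst (snd w) + r * cos (fst w))
  (fun w : R * (R * R) => snd (snd w) + r * / q * sin (fst w))).
- exact H.
- cont.
- cont.
Qed.

Lemma param_continuous_trig (F G : R -> R -> R -> R) (t x y al be : R) :
  param_continuous F t x y -> param_continuous G t x y ->
  param_continuous (fun t x y => al * F t x y * cos t + be * G t x y * sin t) t x y.
Proof. unfold param_continuous; intros; cont. Qed.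

Lemma param_continuous_ext (F G : R -> R -> R -> R) (t x y : R) :
  (forall t x y, F t x y = G t x y) ->
  param_continuous F t x y -> param_continuous G t x y.
Proof. intros H; apply continuous_ext; intros; apply H. Qed.

(* With [k s] the integral for the radius [s], differentiating under the
   integral sign gives [k' s] = integral of [U], and integrating the
   [t]-derivative of [Q cos t - P sin t] over a period gives [s k' s = k s];
   hence [k s / s] is constant, with limit [k' 0 = 2 PI U x0 y0]. *)
Lemma cr_mean (q : R) (P Q U V : R -> R -> R) (x0 y0 R0 rho r : R) : q <> 0 ->
  (forall x y, near_sq x0 y0 R0 x y -> cr q P Q (U x y) (V x y) x y /\
     continuity_2d_pt U x y /\ continuity_2d_pt V x y) ->
  0 < r -> r < rho -> rho <= R0 -> rho * Rabs (/ q) <= R0 ->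
  RInt (fun t => P (x0 + r * cos t) (y0 + r * / q * sin t) * cos t +
                 Q (x0 + r * cos t) (y0 + r * / q * sin t) * sin t) 0 (2 * PI)
  = 2 * PI * r * U x0 y0.
Proof.
intros Hq H Hr Hrho HR1 HR2.
assert (HPI := PI_RGT_0).
set (X := fun s t => x0 + s * cos t); set (Y := fun s t => y0 + s * / q * sin t).
assert (HN : forall s t, Rabs s < rho -> near_sq x0 y0 R0 (X s t) (Y s t)).
{ intros s t Hs; now apply (near_sq_ellipse q x0 y0 R0 rho). }
(* With [F = P + i Q] the integrand is the real part of [F exp(- i t)]. *)
pose (k := (fun s => RInt (fun t => P (X s t) (Y s t) * cos t + Q (X s t) (Y s t) * sin t) 0 (2 * PI)) : R -> R).
pose (m := (fun s => RInt (fun t => U (X s t) (Y s t)) 0 (2 * PI)) : R -> R).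
assert (Hk : forall s, Rabs s < rho -> derivable_pt_lim k s (m s)).
{ intros s Hs.
  (* [k] is regarded as a function of two variables whose second partial derivative is the integral
     of zero. *)
  apply (differentiable_pt_lim_proj1_1 k s 0).
  assert (Hpos : 0 < rho - Rabs s) by lra.
  assert (Hnear : forall s' v, near_sq s 0 (rho - Rabs s) s' v -> Rabs s' < rho).
  { intros s' v [H1 _]; pose proof (Rabs_triang_inv s' s); lra. }
  assert (HZ : RInt (fun _ : R => 0) 0 (2 * PI) = 0).
  { rewrite RInt_const; unfold scal; simpl; unfold mult; simpl; ring. }
  enough (HD : differentiable_pt_lim (fun u _ => k u) s 0 (m s)
    (RInt (fun _ : R => 0) 0 (2 * PI))) by (rewrite HZ in HD; exact HD).
  apply (RInt_param_differentiable
    (fun t s _ => P (X s t) (Y s t) * cos t + Q (X s t) (Y s t) * sin t)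
    (fun t s _ => U (X s t) (Y s t)) (fun _ _ _ => 0) 0 (2 * PI) s 0 (rho - Rabs s));
    [lra | exact Hpos | | |].
  - intros t _ s' v Hs'; apply Hnear in Hs'.
    destruct (H _ _ (HN s' t Hs')) as [[H1 H2] _].
    apply (differentiable_pt_lim_proj1_0
      (fun s' => P (X s' t) (Y s' t) * cos t + Q (X s' t) (Y s' t) * sin t)).
    assert (DX : derivable_pt_lim (fun s => X s t) s' (cos t)).
    { apply is_derive_Reals; unfold X; auto_derive; [easy | ring]. }
    assert (DY : derivable_pt_lim (fun s => Y s t) s' (/ q * sin t)).
    { apply is_derive_Reals; unfold Y; auto_derive; [easy | ring]. }
    assert (D1 := derivable_pt_lim_comp_2d P _ _ s' _ _ _ _ H1 DX DY).
    assert (D2 := derivable_pt_lim_comp_2d Q _ _ s' _ _ _ _ H2 DX DY).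
    assert (D3 := derivable_pt_lim_plus _ _ _ _ _
      (derivable_pt_lim_mult _ _ _ _ _ D1 (derivable_pt_lim_const (cos t) s'))
      (derivable_pt_lim_mult _ _ _ _ _ D2 (derivable_pt_lim_const (sin t) s'))).
    match type of D3 with derivable_pt_lim _ _ ?l =>
      replace (U (X s' t) (Y s' t)) with l; [exact D3 |] end.
    (* The contributions of [V] cancel, and those of [U] carry the factors [cos^2] and [sin^2]. *)
    pose proof (sin2_cos2 t) as Ht; unfold Rsqr in Ht; unfold fct_cte.
    transitivity (U (X s' t) (Y s' t) * (sin t * sin t + cos t * cos t));
      [field; exact Hq | rewrite Ht; ring].
  - intros t _ s' v Hs'; apply Hnear in Hs'.
    destruct (H _ _ (HN s' t Hs')) as [Hcr _].
    destruct (cr_continuity _ _ _ _ _ _ _ Hcr).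
    apply (param_continuous_ext (fun t s v =>
      1 * P (X s t) (Y s t) * cos t + 1 * Q (X s t) (Y s t) * sin t)).
    { intros; ring. }
    apply (param_continuous_trig (fun t s v => P (X s t) (Y s t))
       (fun t s v => Q (X s t) (Y s t))); now apply param_continuous_radius.
  - intros t _; destruct (H _ _ (HN s t Hs)) as [_ [HU _]]; split.
    + now apply param_continuous_radius.
    + apply continuous_const. }
assert (Hm : forall s, Rabs s < rho -> k s = s * m s).
{ intros s Hs.
  assert (CF : forall F, (forall x y, near_sq x0 y0 R0 x y -> continuity_2d_pt F x y) ->
    forall t, continuous (fun t => F (X s t) (Y s t)) t).
  { intros F HF t; apply (continuity_2d_pt_continuous F).
    - now apply HF, HN.
    - unfold X; cont.
    - unfold Y; cont. }
  assert (CP := CF P (fun x y Hxy => proj1 (cr_continuity _ _ _ _ _ _ _ (proj1 (H x y Hxy))))).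
  assert (CQ := CF Q (fun x y Hxy => proj2 (cr_continuity _ _ _ _ _ _ _ (proj1 (H x y Hxy))))).
  assert (CU := CF U (fun x y Hxy => proj1 (proj2 (H x y Hxy)))).
  assert (Hex : forall f : R -> R, (forall t, continuous f t) -> ex_RInt f 0 (2 * PI)).
  { intros f Hf; apply (ex_RInt_continuous (V := R_CompleteNormedModule)); auto. }
  assert (I : is_RInt (fun t => s * U (X s t) (Y s t) -
      (P (X s t) (Y s t) * cos t + Q (X s t) (Y s t) * sin t)) 0 (2 * PI) 0).
  (* [L] is the imaginary part of [F exp(- i t)]. It takes the same value at [0] and [2 PI], so its
     derivative integrates to zero. *)
  { set (L := fun t => Q (X s t) (Y s t) * cos t - P (X s t) (Y s t) * sin t).
    replace 0 with (minus (L (2 * PI)) (L 0)) at 2.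
    2:{ unfold L, X, Y; rewrite cos_2PI, sin_2PI, cos_0, sin_0.
        unfold minus, plus, opp; simpl; ring. }
    apply (is_RInt_derive (V := R_CompleteNormedModule) L).
    - intros t _; apply is_derive_Reals.
      destruct (H _ _ (HN s t Hs)) as [[H1 H2] _].
      assert (DX : derivable_pt_lim (fun t => X s t) t (- s * sin t)).
      { apply is_derive_Reals; unfold X; auto_derive; [easy | ring]. }
      assert (DY : derivable_pt_lim (fun t => Y s t) t (s * / q * cos t)).
      { apply is_derive_Reals; unfold Y; auto_derive; [easy | ring]. }
      assert (D1 := derivable_pt_lim_comp_2d P _ _ t _ _ _ _ H1 DX DY).
      assert (D2 := derivable_pt_lim_comp_2d Q _ _ t _ _ _ _ H2 DX DY).
      assert (D3 := derivable_pt_lim_minus _ _ _ _ _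
        (derivable_pt_lim_mult _ _ _ _ _ D2 (derivable_pt_lim_cos t))
        (derivable_pt_lim_mult _ _ _ _ _ D1 (derivable_pt_lim_sin t))).
      match type of D3 with derivable_pt_lim _ _ ?l =>
        match goal with |- derivable_pt_lim _ _ ?l' =>
        replace l' with l; [exact D3 |] end end.
      pose proof (sin2_cos2 t) as Ht; unfold Rsqr in Ht.
      transitivity (s * U (X s t) (Y s t) * (sin t * sin t + cos t * cos t) -
        (P (X s t) (Y s t) * cos t + Q (X s t) (Y s t) * sin t));
       [field; exact Hq | rewrite Ht; ring].
    - intros t _; specialize (CP t); specialize (CQ t); specialize (CU t); cont. }
  apply (is_RInt_unique (V := R_CompleteNormedModule)) in I.
  rewrite (RInt_minus_R (fun t => s * U (X s t) (Y s t))
    (fun t => P (X s t) (Y s t) * cos t + Q (X s t) (Y s t) * sin t)) in I.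
  - assert (S : RInt (fun t => s * U (X s t) (Y s t)) 0 (2 * PI) = s * m s).
    { exact (RInt_scal (V := R_CompleteNormedModule) _ 0 (2 * PI) s (Hex _ CU)). }
    unfold k; lra.
  - apply Hex; intros t; specialize (CU t); cont.
  - apply Hex; intros t; specialize (CP t); specialize (CQ t); cont. }
assert (H0 : Rabs 0 < rho) by (rewrite Rabs_R0; lra).
assert (Hm0 : m 0 = 2 * PI * U x0 y0).
{ unfold m, X, Y.
  rewrite (RInt_ext _ (fun _ => U x0 y0)).
  - rewrite RInt_const; unfold scal; simpl; unfold mult; simpl; ring.
  - intros t _; apply (f_equal2 U); ring. }
assert (Hk0 : k 0 = 0) by (rewrite (Hm 0 H0); apply Rmult_0_l).
assert (Hconst : forall s, 0 < s -> s <= r -> k s / s = k r / r).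
{ intros s Hs Hsr.
  destruct (MVT_gen (fun s => k s / s) s r (fun _ => 0)) as [c [_ Hc]].
  - rewrite Rmin_left, Rmax_right by lra; intros c Hc.
    assert (Hcr : Rabs c < rho) by (rewrite Rabs_pos_eq; lra).
    apply is_derive_Reals.
    assert (D := derivable_pt_lim_div k (fun s => s) c _ _ (Hk c Hcr)
      (derivable_pt_lim_id c) ltac:(lra)).
    match type of D with derivable_pt_lim _ _ ?l => replace 0 with l; [exact D |] end.
    rewrite (Hm c Hcr); unfold Rsqr; field; lra.
  - rewrite Rmin_left, Rmax_right by lra; intros c Hc.
    assert (Hcr : Rabs c < rho) by (rewrite Rabs_pos_eq; lra).
    apply derivable_continuous_pt.
    eexists; exact (derivable_pt_lim_div k (fun s => s) c _ _ (Hk c Hcr)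
      (derivable_pt_lim_id c) ltac:(lra)).
  - lra. }
(* A positive distance between the two sides would serve as epsilon in the derivative of [k] at 0,
   where [k 0 = 0]; a small [s] contradicts it because [k s / s = k r / r]. *)
assert (Hlim : k r / r = 2 * PI * U x0 y0).
{ apply Rminus_diag_uniq, Rabs_eq_0, Rle_antisym; [| apply Rabs_pos].
  apply Rnot_lt_le; intros Hlt.
  destruct (Hk 0 H0 _ Hlt) as [d Hd].
  set (s := Rmin (d / 2) r).
  assert (Hs : 0 < s) by (apply Rmin_glb_lt; [pose proof (cond_pos d); lra | lra]).
  assert (Hs1 : s <= d / 2) by apply Rmin_l.
  assert (Hs2 : s <= r) by apply Rmin_r.
  specialize (Hd s ltac:(lra) ltac:(rewrite Rabs_pos_eq by lra; pose proof (cond_pos d); lra)).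
  rewrite Rplus_0_l, Hk0, Hm0, Rminus_0_r, (Hconst s Hs Hs2) in Hd; lra. }
change (k r = 2 * PI * r * U x0 y0).
replace (k r) with (k r / r * r) by (field; lra).
rewrite Hlim; ring.
Qed.

(** The coefficients select a part of the mean value integral: [1, 1] with [F, G] gives the real
    part of [(F + i G) exp(- i t)], and [1, -1] with [G, F] the imaginary part. *)
Definition ellipse_int (q r al be : R) (F G : R -> R -> R) (x y : R) : R :=
  RInt (fun t => al * F (x + r * cos t) (y + r * / q * sin t) * cos t +
                 be * G (x + r * cos t) (y + r * / q * sin t) * sin t) 0 (2 * PI).

Lemma ellipse_int_param_continuous (q r al be : R) (F G : R -> R -> R) (t x y : R) :
  continuity_2d_pt F (x + r * cos t) (y + r * / q * sin t) ->
  continuity_2d_pt G (x + r * cos t) (y + r * / q * sin t) ->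
  param_continuous (fun t x y =>
    al * F (x + r * cos t) (y + r * / q * sin t) * cos t +
    be * G (x + r * cos t) (y + r * / q * sin t) * sin t) t x y.
Proof.
intros HF HG.
apply (param_continuous_trig (fun t x y => F (x + r * cos t) (y + r * / q * sin t))
  (fun t x y => G (x + r * cos t) (y + r * / q * sin t)));
now apply param_continuous_center.
Qed.

(** Extracts a constant even when signs have moved between the coefficients and the functions; this
    is how the y-derivatives of the mean value formula are recognised as Cauchy-Riemann partners of
    the x-derivatives. *)
Lemma ellipse_int_scal (q r al be c : R) (F G F' G' : R -> R -> R) (x y : R) al' be' :
  (forall t, continuity_2d_pt F (x + r * cos t) (y + r * / q * sin t)) ->
  (forall t, continuity_2d_pt G (x + r * cos t) (y + r * / q * sin t)) ->
  (forall u v, al' * F' u v = c * (al * F u v) /\ be' * G' u v = c * (be * G u v)) ->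
  ellipse_int q r al' be' F' G' x y = c * ellipse_int q r al be F G x y.
Proof.
intros HF HG HE; unfold ellipse_int.
etransitivity; [| apply (RInt_scal (V := R_CompleteNormedModule) _ 0 (2 * PI) c)].
- apply (RInt_ext (V := R_CompleteNormedModule)); intros t _.
  destruct (HE (x + r * cos t) (y + r * / q * sin t)) as [-> ->].
  unfold scal; simpl; unfold mult; simpl; ring.
- apply (ex_RInt_continuous (V := R_CompleteNormedModule)); intros t _.
  exact (param_continuous_slice _ t x y
    (ellipse_int_param_continuous q r al be F G t x y (HF t) (HG t))).
Qed.

Lemma ellipse_int_continuity (q r al be : R) (F G : R -> R -> R) (x y rho : R) :
  0 < rho ->
  (forall x' y' t, near_sq x y rho x' y' ->
    continuity_2d_pt F (x' + r * cos t) (y' + r * / q * sin t) /\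
    continuity_2d_pt G (x' + r * cos t) (y' + r * / q * sin t)) ->
  continuity_2d_pt (ellipse_int q r al be F G) x y.
Proof.
intros Hr H; assert (HPI := PI_RGT_0).
apply (RInt_param_continuity _ 0 (2 * PI) x y rho); [lra | exact Hr |].
intros t _ x' y' Hxy; destruct (H x' y' t Hxy).
now apply ellipse_int_param_continuous.
Qed.

Lemma ellipse_int_differentiable (q r al be : R) (F G F1 F2 G1 G2 : R -> R -> R)
  (x y rho : R) : 0 < rho ->
  (forall x' y' t, near_sq x y rho x' y' ->
    let X := x' + r * cos t in let Y := y' + r * / q * sin t in
    differentiable_pt_lim F X Y (F1 X Y) (F2 X Y) /\
    differentiable_pt_lim G X Y (G1 X Y) (G2 X Y) /\
    continuity_2d_pt F1 X Y /\ continuity_2d_pt F2 X Y /\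
    continuity_2d_pt G1 X Y /\ continuity_2d_pt G2 X Y) ->
  differentiable_pt_lim (ellipse_int q r al be F G) x y
    (ellipse_int q r al be F1 G1 x y) (ellipse_int q r al be F2 G2 x y).
Proof.
intros Hr H; assert (HPI := PI_RGT_0).
unfold ellipse_int.
apply (RInt_param_differentiable
  (fun t x y => al * F (x + r * cos t) (y + r * / q * sin t) * cos t +
                be * G (x + r * cos t) (y + r * / q * sin t) * sin t)
  (fun t x y => al * F1 (x + r * cos t) (y + r * / q * sin t) * cos t +
                be * G1 (x + r * cos t) (y + r * / q * sin t) * sin t)
  (fun t x y => al * F2 (x + r * cos t) (y + r * / q * sin t) * cos t +
                be * G2 (x + r * cos t) (y + r * / q * sin t) * sin t)
  0 (2 * PI) x y rho); [lra | exact Hr | | |].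
- intros t _ x' y' Hxy.
  destruct (H x' y' t Hxy) as (HF & HG & _).
  set (X := x' + r * cos t) in *; set (Y := y' + r * / q * sin t) in *.
  assert (T : forall K K1 K2, differentiable_pt_lim K X Y K1 K2 ->
    differentiable_pt_lim (fun x y => K (x + r * cos t) (y + r * / q * sin t)) x' y' K1 K2).
  { intros K K1 K2 HK eps; destruct (HK eps) as [d Hd]; exists d; intros u v Hu Hv.
    specialize (Hd (u + r * cos t) (v + r * / q * sin t)); unfold X, Y in *.
    replace (u + r * cos t - (x' + r * cos t)) with (u - x') in Hd by ring.
    replace (v + r * / q * sin t - (y' + r * / q * sin t)) with (v - y') in Hd by ring.
    now apply Hd. }
  apply T in HF; apply T in HG.
  assert (HL := differentiable_pt_lim_lin _ _ (al * cos t) (be * sin t) 0 x' y' _ _ _ _ HF HG).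
  replace (al * F1 X Y * cos t + be * G1 X Y * sin t)
    with (al * cos t * F1 X Y + be * sin t * G1 X Y) by ring.
  replace (al * F2 X Y * cos t + be * G2 X Y * sin t)
    with (al * cos t * F2 X Y + be * sin t * G2 X Y) by ring.
  apply differentiable_pt_lim_ext with (2 := HL).
  exists (mkposreal 1 Rlt_0_1); intros; ring.
- intros t _ x' y' Hxy; destruct (H x' y' t Hxy) as (HF & HG & _).
  apply ellipse_int_param_continuous; eapply differentiable_pt_lim_continuity; eassumption.
- intros t _.
  destruct (H x y t (near_sq_center x y rho Hr)) as (_ & _ & H1 & H2 & H3 & H4).
  split; now apply ellipse_int_param_continuous.
Qed.

Lemma near_sq_triangle (x0 y0 x y x' y' r r' : R) :
  near_sq x0 y0 r x y -> near_sq x y r' x' y' -> near_sq x0 y0 (r + r') x' y'.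
Proof.
intros [H1 H2] [H3 H4]; split.
- replace (x' - x0) with ((x' - x) + (x - x0)) by ring.
  apply Rle_lt_trans with (1 := Rabs_triang _ _); lra.
- replace (y' - y0) with ((y' - y) + (y - y0)) by ring.
  apply Rle_lt_trans with (1 := Rabs_triang _ _); lra.
Qed.

Lemma near_sq_open (x0 y0 r x y : R) : near_sq x0 y0 r x y ->
  exists d, 0 < d /\ forall x' y', near_sq x y d x' y' -> near_sq x0 y0 r x' y'.
Proof.
intros [H1 H2].
exists (Rmin (r - Rabs (x - x0)) (r - Rabs (y - y0))); split.
- apply Rmin_glb_lt; lra.
- intros x' y' [H3 H4]; apply Rmin_Rgt in H3; apply Rmin_Rgt in H4; split.
  + replace (x' - x0) with ((x' - x) + (x - x0)) by ring.
    apply Rle_lt_trans with (1 := Rabs_triang _ _); lra.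
  + replace (y' - y0) with ((y' - y) + (y - y0)) by ring.
    apply Rle_lt_trans with (1 := Rabs_triang _ _); lra.
Qed.

(** The mean value formula expresses [U + i V] by its primitive [P + i Q]. Under the integral sign
    [P] and [Q] have continuous partials, built from [U] and [V], so the integral is differentiable
    and inherits the Cauchy-Riemann equations. The continuity of [E1] and [E2] allows the lemma to
    be applied again, one derivative further. *)
Lemma cr_bootstrap (q : R) (P Q U V : R -> R -> R) (x0 y0 R0 : R) : q <> 0 ->
  0 < R0 ->
  (forall x y, near_sq x0 y0 R0 x y -> cr q P Q (U x y) (V x y) x y /\
     continuity_2d_pt U x y /\ continuity_2d_pt V x y) ->
  exists E1 E2 : R -> R -> R, forall x y, near_sq x0 y0 (R0 / 2) x y ->
    cr q U V (E1 x y) (E2 x y) x y /\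
    continuity_2d_pt E1 x y /\ continuity_2d_pt E2 x y.
Proof.
intros Hq HR H; assert (HPI := PI_RGT_0).
assert (Haq : 0 < Rabs q) by now apply Rabs_pos_lt.
(* Both half-axes of the ellipses stay below [R0 / 4]. Centres vary by [R0 / 4] around a point of
   the half square, so the ellipses remain within [R0 / 2 + R0 / 4 + R0 / 4]. *)
set (rho := Rmin (R0 / 4) (R0 / 4 * Rabs q)); set (r := rho / 2).
assert (Hrho : 0 < rho).
{ apply Rmin_glb_lt; [lra | apply Rmult_lt_0_compat; lra]. }
assert (Hrho1 : rho <= R0 / 4) by apply Rmin_l.
assert (Hrho2 : rho * Rabs (/ q) <= R0 / 4).
{ rewrite Rabs_inv.
  replace (R0 / 4) with (R0 / 4 * Rabs q * / Rabs q) by (field; lra).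
  apply Rmult_le_compat_r; [left; now apply Rinv_0_lt_compat | apply Rmin_r]. }
assert (Hr : 0 < r < rho) by (unfold r; lra).
assert (HN : forall x y x' y' t, near_sq x0 y0 (R0 / 2) x y ->
  near_sq x y (R0 / 4) x' y' ->
  near_sq x0 y0 R0 (x' + r * cos t) (y' + r * / q * sin t)).
{ intros x y x' y' t H1 H2.
  replace R0 with (R0 / 2 + R0 / 4 + R0 / 4) by field.
  apply (near_sq_triangle _ _ x' y'); [now apply (near_sq_triangle _ _ x y) |].
  apply (near_sq_ellipse q x' y' (R0 / 4) rho); try assumption.
  rewrite Rabs_pos_eq; lra. }
assert (Hsub : forall x y x' y', near_sq x0 y0 (R0 / 2) x y ->
  near_sq x y (R0 / 4) x' y' -> near_sq x0 y0 R0 x' y').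
{ intros x y x' y' H1 H2; apply (near_sq_mono _ _ (R0 / 2 + R0 / 4)); [lra |].
  now apply (near_sq_triangle _ _ x y). }
set (c := / (2 * PI * r)).
assert (Hc : c * (2 * PI * r) = 1) by (unfold c; field; split; lra).
assert (FU : forall x y, near_sq x0 y0 (R0 / 2) x y ->
  U x y = c * ellipse_int q r 1 1 P Q x y).
{ intros x y Hxy.
  transitivity (c * (2 * PI * r * U x y)); [rewrite <- Rmult_assoc, Hc; ring |].
  f_equal; symmetry.
  etransitivity; [| apply (cr_mean q P Q U V x y (R0 / 4) rho r)]; try easy; try lra.
  - apply (RInt_ext (V := R_CompleteNormedModule)); intros t _; rewrite !Rmult_1_l; reflexivity.
  - intros; now apply H, (Hsub x y). }
assert (FV : forall x y, near_sq x0 y0 (R0 / 2) x y ->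
  V x y = c * ellipse_int q r 1 (-1) Q P x y).
{ intros x y Hxy.
  transitivity (c * (2 * PI * r * V x y)); [rewrite <- Rmult_assoc, Hc; ring |].
  f_equal; symmetry.
  (* The real-part formula for [- i (P + i Q) = Q - i P], whose derivative is [V - i U]. *)
  etransitivity; [| apply (cr_mean q Q (fun u v => -1 * P u v) V
    (fun u v => - U u v) x y (R0 / 4) rho r)]; try easy; try lra.
  - apply (RInt_ext (V := R_CompleteNormedModule)); intros t _; rewrite !Rmult_1_l; reflexivity.
  - intros x' y' Hxy'; destruct (H x' y' (Hsub x y x' y' Hxy Hxy')) as (H1 & H2 & H3).
    split; [now apply cr_rotate | split; [exact H3 | now apply continuity_2d_pt_opp]]. }
assert (Hloc : forall (W K : R -> R -> R) x y k1 k2,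
  (forall x y, near_sq x0 y0 (R0 / 2) x y -> W x y = c * K x y) ->
  near_sq x0 y0 (R0 / 2) x y -> differentiable_pt_lim K x y k1 k2 ->
  differentiable_pt_lim W x y (c * k1) (c * k2)).
{ intros W K x y k1 k2 HW Hxy HK.
  destruct (near_sq_open _ _ _ _ _ Hxy) as [d [Hd Hd']].
  apply differentiable_pt_lim_ext with (fun u v => c * K u v).
  - exists (mkposreal d Hd); intros u v Hu Hv; symmetry; apply HW, Hd'; now split.
  - now apply differentiable_pt_lim_scal. }
(* The derivative is the same mean with [U + i V] in place of [P + i Q]. *)
exists (fun x y => c * ellipse_int q r 1 1 U V x y),
  (fun x y => c * ellipse_int q r 1 (-1) V U x y).
intros x y Hxy.
assert (HC : forall t, near_sq x0 y0 R0 (x + r * cos t) (y + r * / q * sin t)).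
{ intros t; apply (HN x y); [exact Hxy | apply near_sq_center; lra]. }
assert (HD : forall x' y', near_sq x0 y0 R0 x' y' ->
  differentiable_pt_lim P x' y' (U x' y') (- q * V x' y') /\
  differentiable_pt_lim Q x' y' (V x' y') (q * U x' y') /\
  continuity_2d_pt U x' y' /\ continuity_2d_pt V x' y' /\
  continuity_2d_pt (fun u v => - q * V u v) x' y' /\
  continuity_2d_pt (fun u v => q * U u v) x' y').
{ intros x' y' Hxy'; destruct (H x' y' Hxy') as ([H1 H2] & H3 & H4).
  rewrite <- Ropp_mult_distr_l.
  repeat split; try assumption;
  (apply continuity_2d_pt_mult; [apply continuity_2d_pt_const | assumption]). }
split; [split | split].
- replace (- (q * (c * ellipse_int q r 1 (-1) V U x y)))
    with (c * ellipse_int q r 1 1 (fun u v => - q * V u v) (fun u v => q * U u v) x y).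
  + apply (Hloc U (ellipse_int q r 1 1 P Q)); try assumption.
    apply (ellipse_int_differentiable q r 1 1 P Q U (fun u v => - q * V u v)
      V (fun u v => q * U u v) x y (R0 / 4)); [lra |].
    intros x' y' t Hxy'; cbv zeta.
    destruct (HD _ _ (HN x y x' y' t Hxy Hxy')); tauto.
  + rewrite (ellipse_int_scal q r 1 (-1) (- q) V U).
    * ring.
    * intros t; destruct (HD _ _ (HC t)); tauto.
    * intros t; destruct (HD _ _ (HC t)); tauto.
    * intros u v; split; ring.
- replace (q * (c * ellipse_int q r 1 1 U V x y))
    with (c * ellipse_int q r 1 (-1) (fun u v => q * U u v) (fun u v => - q * V u v) x y).
  + apply (Hloc V (ellipse_int q r 1 (-1) Q P)); try assumption.
    apply (ellipse_int_differentiable q r 1 (-1) Q P V (fun u v => q * U u v)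
      U (fun u v => - q * V u v) x y (R0 / 4)); [lra |].
    intros x' y' t Hxy'; cbv zeta.
    destruct (HD _ _ (HN x y x' y' t Hxy Hxy')); tauto.
  + rewrite (ellipse_int_scal q r 1 1 q U V).
    * ring.
    * intros t; destruct (HD _ _ (HC t)); tauto.
    * intros t; destruct (HD _ _ (HC t)); tauto.
    * intros u v; split; ring.
- apply continuity_2d_pt_mult; [apply continuity_2d_pt_const |].
  apply (ellipse_int_continuity q r 1 1 U V x y (R0 / 4)); [lra |].
  intros x' y' t Hxy'; destruct (HD _ _ (HN x y x' y' t Hxy Hxy')); tauto.
- apply continuity_2d_pt_mult; [apply continuity_2d_pt_const |].
  apply (ellipse_int_continuity q r 1 (-1) V U x y (R0 / 4)); [lra |].
  intros x' y' t Hxy'; destruct (HD _ _ (HN x y x' y' t Hxy Hxy')); tauto.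
Qed.

(** No continuity of [a + i b] is known. Bootstrapping a primitive of [U + i V] produces a
    continuous derivative of [U + i V], which uniqueness identifies with [a + i b] on the half
    square; a second bootstrap, with [U + i V] as the primitive, differentiates it. *)
Lemma cr_derivative (q : R) (U V a b : R -> R -> R) (x0 y0 R0 : R) : q <> 0 ->
  0 < R0 ->
  (forall x y, near_sq x0 y0 R0 x y -> cr q U V (a x y) (b x y) x y) ->
  exists a' b', cr q a b a' b' x0 y0.
Proof.
intros Hq HR H.
destruct (cr_primitive q U V x0 y0 R0) as [P [Q HPQ]].
{ intros x y Hxy; eexists; eexists; exact (H x y Hxy). }
destruct (cr_bootstrap q P Q U V x0 y0 R0 Hq HR) as [E1 [E2 HE]].
{ intros x y Hxy; split; [now apply HPQ |]; eapply cr_continuity, H, Hxy. }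
assert (HR2 : 0 < R0 / 2) by lra.
destruct (cr_bootstrap q U V E1 E2 x0 y0 (R0 / 2) Hq HR2 HE) as [F1 [F2 HF]].
exists (F1 x0 y0), (F2 x0 y0).
apply (cr_ext q E1 E2).
- exists (mkposreal _ HR2); simpl; intros u v Hu Hv.
  assert (Huv : near_sq x0 y0 (R0 / 2) u v) by now split.
  apply (cr_unique q U V _ _ _ _ u v); [apply HE, Huv |].
  apply H, (near_sq_mono _ _ (R0 / 2)); [lra | exact Huv].
- apply HF, near_sq_center; lra.
Qed.

(** * Primitives along a homotopy *)

Definition primitive_on (A B F : R -> R -> R) (x0 y0 r : R) : Prop :=
  forall x y, near_sq x0 y0 r x y -> differentiable_pt_lim F x y (A x y) (B x y).

Lemma primitive_on_mono (A B F : R -> R -> R) (x0 y0 r r' : R) :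
  r' <= r -> primitive_on A B F x0 y0 r -> primitive_on A B F x0 y0 r'.
Proof. intros Hr H x y Hxy; now apply H, (near_sq_mono _ _ r'). Qed.

(** [F - G] has zero differential and a square is convex, so the mean value theorem on the segment
    applies. *)
Lemma primitive_difference (A B F G : R -> R -> R) (x0 y0 r x y x' y' : R) :
  primitive_on A B F x0 y0 r -> primitive_on A B G x0 y0 r ->
  near_sq x0 y0 r x y -> near_sq x0 y0 r x' y' ->
  F x' y' - F x y = G x' y' - G x y.
Proof.
intros HF HG H H'.
destruct (segment_mean_value (fun u v => 1 * F u v + -1 * G u v + 0)
  (fun _ _ => 0) (fun _ _ => 0) x y x' y') as [s [_ Hs]]; [| lra].
intros s Hs.
assert (N := near_sq_segment x0 y0 r x y x' y' s H H' Hs).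
assert (D := differentiable_pt_lim_lin F G 1 (-1) 0 _ _ _ _ _ _ (HF _ _ N) (HG _ _ N)).
match type of D with differentiable_pt_lim _ _ _ ?l1 ?l2 =>
  replace l1 with 0 in D by ring; replace l2 with 0 in D by ring end.
exact D.
Qed.

(** [h] is a primitive of [A dx + B dy] along the map [(X, Y)] of the rectangle
    [[a, b] x [c, d]]; it need not factor through [(X, Y)]. *)
Definition lifts (A B X Y h : R -> R -> R) (a b c d : R) : Prop :=
  forall s t, a <= s <= b -> c <= t <= d -> exists F r del,
    0 < r /\ 0 < del /\ primitive_on A B F (X s t) (Y s t) r /\
    forall s' t', a <= s' <= b -> c <= t' <= d -> near_sq s t del s' t' ->
      h s' t' - h s t = F (X s' t') (Y s' t') - F (X s t) (Y s t).

Definition sq_continuous_on (X Y : R -> R -> R) (a b c d : R) : Prop :=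
  forall s t, a <= s <= b -> c <= t <= d -> forall eps, 0 < eps ->
    exists del, 0 < del /\ forall s' t', a <= s' <= b -> c <= t' <= d ->
      near_sq s t del s' t' -> near_sq (X s t) (Y s t) eps (X s' t') (Y s' t').

Lemma sq_continuous_on_sub (X Y : R -> R -> R) (a b c d a' b' c' d' : R) :
  a <= a' -> b' <= b -> c <= c' -> d' <= d ->
  sq_continuous_on X Y a b c d -> sq_continuous_on X Y a' b' c' d'.
Proof.
intros Ha Hb Hc Hd H s t Hs Ht eps Heps.
destruct (H s t ltac:(lra) ltac:(lra) eps Heps) as [del [H1 H2]].
exists del; split; [exact H1 | intros; apply H2; lra || assumption].
Qed.

Lemma sq_continuous_on_transpose (X Y : R -> R -> R) (a b c d : R) :
  sq_continuous_on X Y a b c d ->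
  sq_continuous_on (fun s t => X t s) (fun s t => Y t s) c d a b.
Proof.
intros H s t Hs Ht eps Heps.
destruct (H t s Ht Hs eps Heps) as [del [H1 H2]].
exists del; split; [exact H1 | intros s' t' Hs' Ht' [N1 N2]].
apply H2; try assumption; now split.
Qed.

Lemma lifts_transpose (A B X Y h : R -> R -> R) (a b c d : R) :
  lifts A B X Y h a b c d ->
  lifts A B (fun s t => X t s) (fun s t => Y t s) (fun s t => h t s) c d a b.
Proof.
intros H s t Hs Ht.
destruct (H t s Ht Hs) as (F & r & del & H1 & H2 & H3 & H4).
exists F, r, del; repeat split; try assumption.
intros s' t' Hs' Ht' [N1 N2]; apply H4; try assumption; now split.
Qed.

(** On the common edge both lifts are locally a primitive composed with [(X, Y)] up to constants, so
    their difference is locally constant, hence constant there. Shifting [h2] by it makes the two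
    lifts match. *)
Lemma lifts_glue (A B X Y : R -> R -> R) (a m b c d : R) :
  a <= m -> m <= b -> c <= d -> sq_continuous_on X Y a b c d ->
  (exists h, lifts A B X Y h a m c d) -> (exists h, lifts A B X Y h m b c d) ->
  exists h, lifts A B X Y h a b c d.
Proof.
intros Ham Hmb Hcd Hcont [h1 H1] [h2 H2].
(* At an edge point the two lifts come with different primitives [F1] and [F2]. The second is traded
   for the first, which requires the nearby images to stay in a square where both are primitives. *)
assert (Hmid : forall t, c <= t <= d -> exists F r del, 0 < r /\ 0 < del /\
  primitive_on A B F (X m t) (Y m t) r /\
  (forall s' t', a <= s' <= m -> c <= t' <= d -> near_sq m t del s' t' ->
      h1 s' t' - h1 m t = F (X s' t') (Y s' t') - F (X m t) (Y m t)) /\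
  (forall s' t', m <= s' <= b -> c <= t' <= d -> near_sq m t del s' t' ->
      h2 s' t' - h2 m t = F (X s' t') (Y s' t') - F (X m t) (Y m t))).
{ intros t Ht.
  destruct (H1 m t ltac:(lra) Ht) as (F1 & r1 & d1 & Hr1 & Hd1 & P1 & E1).
  destruct (H2 m t ltac:(lra) Ht) as (F2 & r2 & d2 & Hr2 & Hd2 & P2 & E2).
  assert (Hr : 0 < Rmin r1 r2) by now apply Rmin_glb_lt.
  destruct (Hcont m t ltac:(lra) Ht _ Hr) as [d3 [Hd3 C3]].
  exists F1, (Rmin r1 r2), (Rmin d1 (Rmin d2 d3)).
  assert (M1 : Rmin d1 (Rmin d2 d3) <= d1) by apply Rmin_l.
  assert (M2 : Rmin d1 (Rmin d2 d3) <= d2).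
  { apply Rle_trans with (1 := Rmin_r _ _), Rmin_l. }
  assert (M3 : Rmin d1 (Rmin d2 d3) <= d3).
  { apply Rle_trans with (1 := Rmin_r _ _), Rmin_r. }
  assert (Q1 := primitive_on_mono _ _ _ _ _ _ _ (Rmin_l r1 r2) P1).
  assert (Q2 := primitive_on_mono _ _ _ _ _ _ _ (Rmin_r r1 r2) P2).
  repeat split; try assumption.
  - now repeat apply Rmin_glb_lt.
  - intros s' t' Hs' Ht' N; apply E1; try assumption.
    now apply (near_sq_mono _ _ _ d1) in N.
  - intros s' t' Hs' Ht' N; rewrite E2; try assumption.
    + apply (primitive_difference A B F2 F1 (X m t) (Y m t) (Rmin r1 r2)); try assumption.
      * now apply near_sq_center.
      * apply C3; try assumption; [lra | now apply (near_sq_mono _ _ _ d3) in N].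
    + now apply (near_sq_mono _ _ _ d2) in N. }
assert (Hk : forall t, c <= t <= d -> h1 m t - h2 m t = h1 m c - h2 m c).
{ apply (locally_constant_interval (fun t => h1 m t - h2 m t) c d Hcd).
  intros t Ht; destruct (Hmid t Ht) as (F & r & del & _ & Hdel & _ & E1 & E2).
  exists del; split; [exact Hdel | intros t' Ht' Htt'].
  assert (N : near_sq m t del m t') by (split; [rewrite Rminus_diag, Rabs_R0 |]; assumption).
  assert (e1 := E1 m t' ltac:(lra) Ht' N); assert (e2 := E2 m t' ltac:(lra) Ht' N); lra. }
set (k := h1 m c - h2 m c) in *.
exists (fun s t => if Rle_dec s m then h1 s t else h2 s t + k).
intros s t Hs Ht; destruct (Rtotal_order s m) as [Hsm | [-> | Hsm]].
- destruct (H1 s t ltac:(lra) Ht) as (F & r & del & Hr & Hdel & P & E).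
  (* This radius keeps the neighbourhood on one side of the edge. *)
  exists F, r, (Rmin del (m - s)); repeat split; try assumption.
  { apply Rmin_glb_lt; lra. }
  intros s' t' Hs' Ht' N.
  assert (N' := near_sq_mono _ _ _ _ _ _ (Rmin_l _ _) N).
  apply (near_sq_mono _ _ _ _ _ _ (Rmin_r _ _)) in N; destruct N as [N _].
  apply Rabs_def2 in N.
  destruct (Rle_dec s' m); [| lra]; destruct (Rle_dec s m); [| lra].
  apply E; lra || assumption.
- destruct (Hmid t Ht) as (F & r & del & Hr & Hdel & P & E1 & E2).
  exists F, r, del; repeat split; try assumption.
  intros s' t' Hs' Ht' N; destruct (Rle_dec m m); [| lra].
  destruct (Rle_dec s' m).
  + apply E1; lra || assumption.
  + rewrite <- E2; [| lra | assumption | assumption].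
    pose proof (Hk t Ht); lra.
- destruct (H2 s t ltac:(lra) Ht) as (F & r & del & Hr & Hdel & P & E).
  exists F, r, (Rmin del (s - m)); repeat split; try assumption.
  { apply Rmin_glb_lt; lra. }
  intros s' t' Hs' Ht' N.
  assert (N' := near_sq_mono _ _ _ _ _ _ (Rmin_l _ _) N).
  apply (near_sq_mono _ _ _ _ _ _ (Rmin_r _ _)) in N; destruct N as [N _].
  apply Rabs_def2 in N.
  destruct (Rle_dec s' m); [lra |]; destruct (Rle_dec s m); [lra |].
  rewrite <- E; lra || assumption.
Qed.

Definition locally_exact (D : R * R -> Prop) (A B : R -> R -> R) : Prop :=
  forall x y, D (x, y) -> exists F r, 0 < r /\ primitive_on A B F x y r.

(** On a small rectangle the image lies in one square, and a local primitive composed with the map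
    is a lift. Four quarters are glued in two pairs, and the two halves are glued by the same lemma
    after exchanging the parameters. *)
Lemma homotopy_lift (D : R * R -> Prop) (A B X Y : R -> R -> R) (a b c d : R) :
  a <= b -> c <= d -> locally_exact D A B -> sq_continuous_on X Y a b c d ->
  (forall s t, a <= s <= b -> c <= t <= d -> D (X s t, Y s t)) ->
  exists h, lifts A B X Y h a b c d.
Proof.
intros Hab Hcd HE Hcont HD.
apply (quadrisection (fun a b c d => exists h, lifts A B X Y h a b c d) a b c d Hab Hcd).
- intros a' m b' c' n d' Ha Hm Hmb Hb Hc Hn Hnd Hd _ _ L1 L2 L3 L4.
  assert (K1 : exists h, lifts A B X Y h a' b' c' n).
  { apply (lifts_glue A B X Y a' m b' c' n); try assumption.
    apply (sq_continuous_on_sub X Y a b c d); lra || assumption. }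
  assert (K2 : exists h, lifts A B X Y h a' b' n d').
  { apply (lifts_glue A B X Y a' m b' n d'); try assumption.
    apply (sq_continuous_on_sub X Y a b c d); lra || assumption. }
  destruct (lifts_glue A B (fun s t => X t s) (fun s t => Y t s) c' n d' a' b') as [h Hh];
    try lra.
  + apply (sq_continuous_on_sub _ _ c d a b); try lra.
    now apply sq_continuous_on_transpose.
  + destruct K1 as [h1 K1]; eexists; exact (lifts_transpose _ _ _ _ _ _ _ _ _ K1).
  + destruct K2 as [h2 K2]; eexists; exact (lifts_transpose _ _ _ _ _ _ _ _ _ K2).
  + exists (fun s t => h t s); exact (lifts_transpose _ _ _ _ _ _ _ _ _ Hh).
- intros s t Hs Ht.
  destruct (HE _ _ (HD s t Hs Ht)) as (F & r & Hr & HF).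
  destruct (Hcont s t Hs Ht r Hr) as [del [Hdel Hc]].
  exists del; split; [exact Hdel |].
  intros a' b' c' d' Ha Has Hsb Hb Hc' Hct Htd Hd Hw Hh.
  exists (fun s t => F (X s t) (Y s t)).
  intros u v Hu Hv.
  assert (N : near_sq (X s t) (Y s t) r (X u v) (Y u v)).
  { apply Hc; [lra | lra | split; apply Rabs_def1; lra]. }
  destruct (near_sq_open _ _ _ _ _ N) as [r' [Hr' Hsub]].
  exists F, r', 1; repeat split; try lra.
  intros x y Hxy; apply HF, Hsub, Hxy.
Qed.

Lemma continuous_on_eps {T U : UniformSpace} (D : T -> Prop) (f : T -> U) (x : T) :
  continuous_on D f -> D x -> forall eps : posreal, exists del : posreal,
    forall y, ball x del y -> D y -> ball (f x) eps (f y).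
Proof.
intros Hf Hx eps.
assert (HF : Filter (within D (locally x))) by apply within_filter, locally_filter.
exact (proj1 (filterlim_locally f (f x)) (Hf x Hx) eps).
Qed.

(** The one-parameter form of [lifts]: the increment of [f] stands for the integral of the form when
    the path is only continuous. *)
Definition path_lifts (A B : R -> R -> R) (X Y f : R -> R) (a b : R) : Prop :=
  forall t, a <= t <= b -> exists F r del,
    0 < r /\ 0 < del /\ primitive_on A B F (X t) (Y t) r /\
    forall t', a <= t' <= b -> Rabs (t' - t) < del ->
      f t' - f t = F (X t') (Y t') - F (X t) (Y t).

(** The homotopy is constant on the sides [t = 0], [s = 1] and [t = 1], so the lift takes one value
    at all four corners of the square; its restriction to the side [s = 0] lifts the loop. *)
Lemma loop_lift (D : R * R -> Prop) (A B : R -> R -> R) (g : R -> R * R) :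
  simply_connected D -> locally_exact D A B ->
  continuous_on (fun t => 0 <= t <= 1) g ->
  (forall t, 0 <= t <= 1 -> D (g t)) -> g 0 = g 1 ->
  exists f, f 0 = f 1 /\
    path_lifts A B (fun t => fst (g t)) (fun t => snd (g t)) f 0 1.
Proof.
intros HD HE Hg HgD Hloop.
destruct (HD g Hg HgD Hloop) as (H & Hc & HHD & H0 & H1 & Hs).
destruct (homotopy_lift D A B (fun s t => fst (H (s, t))) (fun s t => snd (H (s, t)))
  0 1 0 1) as [h Hh]; try lra; try assumption.
{ intros s t Hs1 Ht1 eps Heps.
  destruct (continuous_on_eps _ H (s, t) Hc (conj Hs1 Ht1) (mkposreal eps Heps))
    as [del Hdel].
  exists del; split; [apply cond_pos |].
  intros s' t' Hs' Ht' [N1 N2].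
  destruct (Hdel (s', t')) as [B1 B2]; [now split | now split |].
  split; [exact B1 | exact B2]. }
{ intros s t Hs1 Ht1; rewrite <- surjective_pairing; now apply HHD. }
assert (E1 : h 1 0 = h 0 0).
{ apply (locally_constant_interval (fun s => h s 0) 0 1); try lra.
  intros s Hs1; destruct (Hh s 0 ltac:(lra) ltac:(lra)) as (F & r & del & _ & Hdel & _ & E).
  exists del; split; [exact Hdel | intros s' Hs' N].
  apply Rminus_diag_uniq; rewrite E; [| lra | lra | now apply (conj N);
  rewrite Rminus_diag, Rabs_R0].
  rewrite (proj1 (Hs s' Hs')), (proj1 (Hs s Hs1)); ring. }
assert (E2 : h 1 1 = h 0 1).
{ apply (locally_constant_interval (fun s => h s 1) 0 1); try lra.
  intros s Hs1; destruct (Hh s 1 ltac:(lra) ltac:(lra)) as (F & r & del & _ & Hdel & _ & E).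
  exists del; split; [exact Hdel | intros s' Hs' N].
  apply Rminus_diag_uniq; rewrite E; [| lra | lra | now apply (conj N);
  rewrite Rminus_diag, Rabs_R0].
  rewrite (proj2 (Hs s' Hs')), (proj2 (Hs s Hs1)); ring. }
assert (E3 : h 1 1 = h 1 0).
{ apply (locally_constant_interval (fun t => h 1 t) 0 1); try lra.
  intros t Ht; destruct (Hh 1 t ltac:(lra) ltac:(lra)) as (F & r & del & _ & Hdel & _ & E).
  exists del; split; [exact Hdel | intros t' Ht' N].
  apply Rminus_diag_uniq; rewrite E; [| lra | lra | split;
  [now rewrite Rminus_diag, Rabs_R0 | exact N]].
  rewrite (H1 t' Ht'), (H1 t Ht); ring. }
exists (fun t => h 0 t); split; [lra |].
intros t Ht; destruct (Hh 0 t ltac:(lra) Ht) as (F & r & del & Hr & Hdel & P & E).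
exists F, r, del; rewrite (H0 t Ht) in P; repeat split; try assumption.
intros t' Ht' N; rewrite E; [| lra | assumption | split;
[now rewrite Rminus_diag, Rabs_R0 | exact N]].
rewrite (H0 t Ht), (H0 t' Ht'); reflexivity.
Qed.

(** * Curve integrals *)

Lemma continuous_on_intro {T U : UniformSpace} (D : T -> Prop) (f : T -> U) :
  (forall x, D x -> forall eps : posreal, exists del : posreal,
    forall y, ball x del y -> D y -> ball (f x) eps (f y)) ->
  continuous_on D f.
Proof.
intros H x Hx.
assert (HF : Filter (within D (locally x))) by apply within_filter, locally_filter.
apply (proj2 (filterlim_locally f (f x))); intros eps; exact (H x Hx eps).
Qed.

Lemma continuous_on_eq {T U : UniformSpace} (D : T -> Prop) (f g : T -> U) :
  (forall x, D x -> f x = g x) -> continuous_on D f -> continuous_on D g.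
Proof.
intros E H; apply continuous_on_intro; intros x Hx eps.
destruct (continuous_on_eps D f x H Hx eps) as [del Hdel].
exists del; intros y B Hy; rewrite <- !E by assumption; now apply Hdel.
Qed.

Lemma continuous_on_interval_glue {U : UniformSpace} (f : R -> U) (a m b : R) :
  a <= m <= b -> continuous_on (fun t => a <= t <= m) f ->
  continuous_on (fun t => m <= t <= b) f -> continuous_on (fun t => a <= t <= b) f.
Proof.
intros Hm H1 H2; apply continuous_on_intro; intros x Hx eps.
destruct (Rtotal_order x m) as [Hxm | [-> | Hxm]].
- destruct (continuous_on_eps _ f x H1 ltac:(simpl; lra) eps) as [del Hdel].
  assert (Hd : 0 < Rmin del (m - x)) by (apply Rmin_glb_lt; [apply cond_pos | lra]).
  exists (mkposreal _ Hd); intros y Hy Hyab.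
  change (Rabs (y - x) < Rmin del (m - x)) in Hy.
  assert (Hy1 := Rlt_le_trans _ _ _ Hy (Rmin_l _ _)).
  assert (Hy2 := Rlt_le_trans _ _ _ Hy (Rmin_r _ _)); apply Rabs_def2 in Hy2.
  apply Hdel; [exact Hy1 | lra].
- destruct (continuous_on_eps _ f m H1 ltac:(simpl; lra) eps) as [d1 Hd1].
  destruct (continuous_on_eps _ f m H2 ltac:(simpl; lra) eps) as [d2 Hd2].
  assert (Hd : 0 < Rmin d1 d2) by (apply Rmin_glb_lt; apply cond_pos).
  exists (mkposreal _ Hd); intros y Hy Hyab.
  change (Rabs (y - m) < Rmin d1 d2) in Hy.
  assert (Hy1 := Rlt_le_trans _ _ _ Hy (Rmin_l _ _)).
  assert (Hy2 := Rlt_le_trans _ _ _ Hy (Rmin_r _ _)).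
  destruct (Rle_dec y m); [apply Hd1 | apply Hd2]; lra || assumption.
- destruct (continuous_on_eps _ f x H2 ltac:(simpl; lra) eps) as [del Hdel].
  assert (Hd : 0 < Rmin del (x - m)) by (apply Rmin_glb_lt; [apply cond_pos | lra]).
  exists (mkposreal _ Hd); intros y Hy Hyab.
  change (Rabs (y - x) < Rmin del (x - m)) in Hy.
  assert (Hy1 := Rlt_le_trans _ _ _ Hy (Rmin_l _ _)).
  assert (Hy2 := Rlt_le_trans _ _ _ Hy (Rmin_r _ _)); apply Rabs_def2 in Hy2.
  apply Hdel; [exact Hy1 | lra].
Qed.

Lemma continuous_on_affine {U : UniformSpace} (f : R -> U) (u v a b c d : R) :
  (forall t, c <= t <= d -> a <= u * t + v <= b) ->
  continuous_on (fun t => a <= t <= b) f ->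
  continuous_on (fun t => c <= t <= d) (fun t => f (u * t + v)).
Proof.
intros Hr H; apply continuous_on_intro; intros x Hx eps.
destruct (continuous_on_eps _ f (u * x + v) H (Hr x Hx) eps) as [del Hdel].
(* [Rabs u + 1] instead of [Rabs u] covers the case [u = 0]. *)
assert (Hu : 0 < Rabs u + 1) by (pose proof (Rabs_pos u); lra).
assert (Hd : 0 < del / (Rabs u + 1)) by (apply Rdiv_lt_0_compat; [apply cond_pos | lra]).
exists (mkposreal _ Hd); intros y Hy Hycd.
change (Rabs (y - x) < del / (Rabs u + 1)) in Hy.
apply Hdel; [| now apply Hr].
change (Rabs (u * y + v - (u * x + v)) < del).
replace (u * y + v - (u * x + v)) with (u * (y - x)) by ring; rewrite Rabs_mult.
apply Rle_lt_trans with ((Rabs u + 1) * Rabs (y - x)).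
- apply Rmult_le_compat_r; [apply Rabs_pos | lra].
- replace (pos del) with ((Rabs u + 1) * (del / (Rabs u + 1))) by (field; lra).
  now apply Rmult_lt_compat_l.
Qed.

Lemma continuous_on_pair {T U V : UniformSpace} (D : T -> Prop) (f : T -> U) (g : T -> V) :
  continuous_on D f -> continuous_on D g -> continuous_on D (fun t => (f t, g t)).
Proof.
intros Hf Hg; apply continuous_on_intro; intros x Hx eps.
destruct (continuous_on_eps D f x Hf Hx eps) as [d1 H1].
destruct (continuous_on_eps D g x Hg Hx eps) as [d2 H2].
assert (Hd : 0 < Rmin d1 d2) by (apply Rmin_glb_lt; apply cond_pos).
exists (mkposreal _ Hd); intros y Hy Hy'; split; simpl.
- apply H1; [apply ball_le with (2 := Hy), Rmin_l | exact Hy'].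
- apply H2; [apply ball_le with (2 := Hy), Rmin_r | exact Hy'].
Qed.

(** [Rmax a (Rmin t b)] is the nearest-point projection onto the interval, which does not increase
    distances. *)
Lemma continuous_on_clamp (f : R -> R) (a b x : R) : a <= b ->
  continuous_on (fun t => a <= t <= b) f ->
  continuous (fun t => f (Rmax a (Rmin t b))) x.
Proof.
intros Hab H; apply (proj2 (filterlim_locally _ _)); intros eps.
assert (Hc : forall t, a <= Rmax a (Rmin t b) <= b).
{ intros t; split; [apply Rmax_l |]; apply Rmax_lub; [exact Hab | apply Rmin_r]. }
destruct (continuous_on_eps _ f _ H (Hc x) eps) as [del Hdel].
exists del; intros y Hy; apply Hdel; [| apply Hc].
change (Rabs (y - x) < del) in Hy; apply Rabs_def2 in Hy.
change (Rabs (Rmax a (Rmin y b) - Rmax a (Rmin x b)) < del).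
apply Rabs_def1; unfold Rmax, Rmin; repeat destruct Rle_dec; lra.
Qed.

(* [f] and [g] are extended continuously to the whole line by their values at
   the end points, since Coquelicot's theorem asks for two-sided derivatives. *)
Lemma is_RInt_derive_closed (f g : R -> R) (a b : R) : a < b ->
  continuous_on (fun t => a <= t <= b) f ->
  continuous_on (fun t => a <= t <= b) g ->
  (forall t, a < t < b -> is_derive f t (g t)) ->
  is_RInt g a b (f b - f a).
Proof.
intros Hab Hf Hg Hd.
set (fc := fun t => f (Rmax a (Rmin t b))); set (gc := fun t => g (Rmax a (Rmin t b))).
assert (Cf : forall t, continuous fc t) by (intros; now apply continuous_on_clamp; [lra |]).
assert (Cg : forall t, continuous gc t) by (intros; now apply continuous_on_clamp; [lra |]).
assert (Ec : forall t, a <= t <= b -> Rmax a (Rmin t b) = t).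
{ intros t Ht; rewrite Rmin_left, Rmax_right; lra. }
assert (Ex : forall t, ex_RInt gc a t).
{ intros t; apply (ex_RInt_continuous (V := R_CompleteNormedModule)); auto. }
assert (Dphi : forall t, is_derive (fun t => RInt gc a t) t (gc t)).
{ intros t; apply (is_derive_RInt (V := R_NormedModule) gc (fun t => RInt gc a t) a t);
  [| apply Cg].
  exists (mkposreal 1 Rlt_0_1); intros s _.
  exact (RInt_correct (V := R_CompleteNormedModule) gc a s (Ex s)). }
(* [fc] and the integral of [gc] have the same derivative inside the interval, and their difference
   is continuous up to the ends, so it has equal values there. *)
destruct (MVT_gen (fun t => fc t - RInt gc a t) a b (fun _ => 0)) as [c [_ Hc]].
- rewrite Rmin_left, Rmax_right by lra; intros t Ht.
  assert (Dfc : is_derive fc t (gc t)).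
  { unfold gc; rewrite Ec by lra.
    apply (is_derive_ext_loc f); [| now apply Hd].
    assert (Hp : 0 < Rmin (t - a) (b - t)) by (apply Rmin_glb_lt; lra).
    exists (mkposreal _ Hp); intros s Hs; change (Rabs (s - t) < Rmin (t - a) (b - t)) in Hs.
    assert (Hs1 := Rlt_le_trans _ _ _ Hs (Rmin_l _ _)); apply Rabs_def2 in Hs1.
    assert (Hs2 := Rlt_le_trans _ _ _ Hs (Rmin_r _ _)); apply Rabs_def2 in Hs2.
    unfold fc; rewrite Ec; [reflexivity | lra]. }
  assert (D := is_derive_minus (V := R_NormedModule) _ _ _ _ _ Dfc (Dphi t)).
  unfold minus, plus, opp in D; simpl in D; rewrite Rplus_opp_r in D; exact D.
- intros t _; apply continuity_pt_filterlim.
  apply (continuous_Rminus fc (fun t => RInt gc a t)); [apply Cf |].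
  apply (ex_derive_continuous (V := R_NormedModule) (fun t => RInt gc a t) t).
  eexists; apply Dphi.
- rewrite RInt_point in Hc; unfold zero in Hc; simpl in Hc.
  unfold fc in Hc; rewrite !Ec in Hc by lra.
  replace (f b - f a) with (RInt gc a b) by lra.
  apply (is_RInt_ext (V := R_NormedModule) gc).
  + rewrite Rmin_left, Rmax_right by lra; intros t Ht; unfold gc; rewrite Ec; [reflexivity | lra].
  + exact (RInt_correct (V := R_CompleteNormedModule) gc a b (Ex b)).
Qed.

Lemma path_lifts_sub (A B : R -> R -> R) (X Y f : R -> R) (a b c d : R) :
  a <= c -> d <= b -> path_lifts A B X Y f a b -> path_lifts A B X Y f c d.
Proof.
intros Hc Hd H t Ht; destruct (H t ltac:(lra)) as (F & r & del & H1 & H2 & H3 & H4).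
exists F, r, del; repeat split; try assumption; intros; apply H4; lra || assumption.
Qed.

Lemma path_lifts_affine (A B : R -> R -> R) (X Y X' Y' f : R -> R) (a b c d u v : R) :
  (forall t, a <= t <= b -> c <= u * t + v <= d /\ X' t = X (u * t + v) /\
     Y' t = Y (u * t + v)) ->
  path_lifts A B X Y f c d ->
  path_lifts A B X' Y' (fun t => f (u * t + v)) a b.
Proof.
intros HX H t Ht; destruct (HX t Ht) as (Hr & E1 & E2).
destruct (H _ Hr) as (F & r & del & H1 & H2 & H3 & H4).
assert (Hu : 0 < Rabs u + 1) by (pose proof (Rabs_pos u); lra).
exists F, r, (del / (Rabs u + 1)); rewrite E1, E2; repeat split; try assumption.
{ apply Rdiv_lt_0_compat; assumption. }
intros t' Ht' N; destruct (HX t' Ht') as (Hr' & -> & ->); apply H4; [exact Hr' |].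
replace (u * t' + v - (u * t + v)) with (u * (t' - t)) by ring; rewrite Rabs_mult.
apply Rle_lt_trans with ((Rabs u + 1) * Rabs (t' - t)).
- apply Rmult_le_compat_r; [apply Rabs_pos | lra].
- replace del with ((Rabs u + 1) * (del / (Rabs u + 1))) by (field; lra).
  now apply Rmult_lt_compat_l.
Qed.

Lemma continuous_on_comp_2d (D : R -> Prop) (F : R -> R -> R) (X Y : R -> R) :
  (forall t, D t -> continuity_2d_pt F (X t) (Y t)) ->
  continuous_on D X -> continuous_on D Y ->
  continuous_on D (fun t => F (X t) (Y t)).
Proof.
intros HF HX HY; apply continuous_on_intro; intros t Ht eps.
destruct (HF t Ht eps) as [d Hd].
destruct (continuous_on_eps D X t HX Ht d) as [d1 H1].
destruct (continuous_on_eps D Y t HY Ht d) as [d2 H2].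
assert (Hm : 0 < Rmin d1 d2) by (apply Rmin_glb_lt; apply cond_pos).
exists (mkposreal _ Hm); intros s Hs HDs; apply Hd.
- apply H1; [apply ball_le with (2 := Hs), Rmin_l | exact HDs].
- apply H2; [apply ball_le with (2 := Hs), Rmin_r | exact HDs].
Qed.

(** Locally [f] is a primitive along the curve plus a constant, so by the chain rule its derivative
    is the integrand, and the fundamental theorem of calculus applies. *)
Lemma path_lifts_smooth_int (D : R * R -> Prop) (A B : R -> R -> R) (X Y f : R -> R) (a b : R) :
  a < b ->
  (forall x y, D (x, y) -> continuity_2d_pt A x y /\ continuity_2d_pt B x y) ->
  (forall t, a <= t <= b -> D (X t, Y t)) ->
  C1_on a b X -> C1_on a b Y -> path_lifts A B X Y f a b ->
  is_curve_int A B a b X Y (f b - f a).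
Proof.
intros Hab HAB HD [CX [dX [CdX DX]]] [CY [dY [CdY DY]]] HL.
assert (L : forall t, a <= t <= b -> exists F del, 0 < del /\
  differentiable_pt_lim F (X t) (Y t) (A (X t) (Y t)) (B (X t) (Y t)) /\
  forall t', a <= t' <= b -> Rabs (t' - t) < del ->
      f t' = F (X t') (Y t') + (f t - F (X t) (Y t))).
{ intros t Ht; destruct (HL t Ht) as (F & r & del & Hr & Hdel & P & E).
  exists F, del; repeat split; [exact Hdel | now apply P, near_sq_center |].
  intros t' Ht' N; specialize (E t' Ht' N); lra. }
unfold is_curve_int.
(* [Derive X] is identified with [dX] only inside the interval; the integral does not see the end
   points. *)
apply (is_RInt_ext (V := R_NormedModule)
  (fun t => A (X t) (Y t) * dX t + B (X t) (Y t) * dY t)).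
{ rewrite Rmin_left, Rmax_right by lra; intros t Ht.
  rewrite (is_derive_unique X t (dX t) (DX t Ht)), (is_derive_unique Y t (dY t) (DY t Ht)).
  reflexivity. }
apply is_RInt_derive_closed; [exact Hab | | |].
- apply continuous_on_intro; intros t Ht eps.
  destruct (L t Ht) as (F & del & Hdel & HF & E).
  assert (HC := differentiable_pt_lim_continuity _ _ _ _ _ HF).
  destruct (HC eps) as [d Hd].
  destruct (continuous_on_eps _ X t CX Ht d) as [d1 H1].
  destruct (continuous_on_eps _ Y t CY Ht d) as [d2 H2].
  assert (Hm : 0 < Rmin del (Rmin d1 d2)) by (repeat apply Rmin_glb_lt; lra || apply cond_pos).
  exists (mkposreal _ Hm); intros s Hs Hsab.
  change (Rabs (s - t) < Rmin del (Rmin d1 d2)) in Hs.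
  apply Rmin_Rgt in Hs; destruct Hs as [Hs1 Hs]; apply Rmin_Rgt in Hs; destruct Hs as [Hs2 Hs3].
  change (Rabs (f s - f t) < eps); rewrite (E s Hsab Hs1).
  match goal with |- Rabs ?w < _ => replace w with (F (X s) (Y s) - F (X t) (Y t)) by ring end.
  apply Hd; [now apply H1 | now apply H2].
- assert (CM : forall g h : R -> R, continuous_on (fun t => a <= t <= b) g ->
    continuous_on (fun t => a <= t <= b) h ->
    continuous_on (fun t => a <= t <= b) (fun t => g t * h t)).
  { intros g h Hg Hh; apply (continuous_on_comp_2d _ Rmult); try assumption.
    intros t _; apply continuity_2d_pt_mult;
    [apply continuity_2d_pt_id1 | apply continuity_2d_pt_id2]. }
  apply (continuous_on_comp_2d _ Rplus).
  + intros t _; apply continuity_2d_pt_plus;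
    [apply continuity_2d_pt_id1 | apply continuity_2d_pt_id2].
  + apply CM; [| exact CdX]; apply (continuous_on_comp_2d _ A); try assumption.
    intros t Ht; now apply HAB, HD.
  + apply CM; [| exact CdY]; apply (continuous_on_comp_2d _ B); try assumption.
    intros t Ht; now apply HAB, HD.
- intros t Ht.
  destruct (L t ltac:(lra)) as (F & del & Hdel & HF & E).
  assert (DF := derivable_pt_lim_comp_2d F X Y t _ _ _ _ HF
    (proj1 (is_derive_Reals X t (dX t)) (DX t Ht)) (proj1 (is_derive_Reals Y t (dY t)) (DY t Ht))).
  apply (is_derive_ext_loc (fun t' => F (X t') (Y t') + (f t - F (X t) (Y t)))).
  + assert (Hm : 0 < Rmin del (Rmin (t - a) (b - t))) by (repeat apply Rmin_glb_lt; lra).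
    exists (mkposreal _ Hm); intros s Hs.
    change (Rabs (s - t) < Rmin del (Rmin (t - a) (b - t))) in Hs.
    apply Rmin_Rgt in Hs; destruct Hs as [Hs1 Hs]; apply Rmin_Rgt in Hs; destruct Hs as [Hs2 Hs3].
    apply Rabs_def2 in Hs2; apply Rabs_def2 in Hs3.
    symmetry; apply E; [lra | exact Hs1].
  + apply is_derive_Reals.
    rewrite <- (Rplus_0_r (_ + _)).
    apply (derivable_pt_lim_plus (fun t' => F (X t') (Y t')) (fct_cte (f t - F (X t) (Y t))));
      [exact DF | apply derivable_pt_lim_const].
Qed.

Lemma subdivision_mono (n : nat) (t : nat -> R) :
  (forall i, (i < n)%nat -> t i < t (S i)) ->
  forall i j, (i <= j <= n)%nat -> t i <= t j.
Proof.
intros H i j [Hij Hj]; induction Hij as [| j Hij IH]; [lra |].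
assert (H1 := H j ltac:(lia)); assert (H2 := IH ltac:(lia)); lra.
Qed.

Lemma piecewise_smooth_continuous (a b : R) (X Y : R -> R) :
  piecewise_smooth a b X Y ->
  continuous_on (fun t => a <= t <= b) X /\ continuous_on (fun t => a <= t <= b) Y.
Proof.
intros (n & t & <- & <- & H).
assert (M := subdivision_mono n t (fun i Hi => proj1 (H i Hi))).
assert (K : forall i, (i <= n)%nat -> continuous_on (fun s => t 0%nat <= s <= t i) X /\
  continuous_on (fun s => t 0%nat <= s <= t i) Y).
{ induction i as [| i IH]; intros Hi.
  - split; apply continuous_on_intro; intros x Hx eps; exists (mkposreal 1 Rlt_0_1);
    intros y _ Hy; replace y with x by lra; apply ball_center.
  - destruct (IH ltac:(lia)) as [I1 I2].
    destruct (H i ltac:(lia)) as (Hlt & [C1 _] & [C2 _]).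
    assert (M' := M 0%nat i ltac:(lia)).
    split; apply (continuous_on_interval_glue _ _ (t i)); try assumption; lra. }
now apply K.
Qed.

Lemma path_lifts_int (D : R * R -> Prop) (A B : R -> R -> R) (X Y f : R -> R) (a b : R) :
  (forall x y, D (x, y) -> continuity_2d_pt A x y /\ continuity_2d_pt B x y) ->
  (forall t, a <= t <= b -> D (X t, Y t)) ->
  piecewise_smooth a b X Y -> path_lifts A B X Y f a b ->
  is_curve_int A B a b X Y (f b - f a).
Proof.
intros HAB HD (n & t & <- & <- & H) HL.
assert (M := subdivision_mono n t (fun i Hi => proj1 (H i Hi))).
assert (K : forall i, (i <= n)%nat ->
  is_curve_int A B (t 0%nat) (t i) X Y (f (t i) - f (t 0%nat))).
{ unfold is_curve_int; induction i as [| i IH]; intros Hi.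
  - rewrite Rminus_diag; exact (is_RInt_point (V := R_NormedModule) _ _).
  - destruct (H i ltac:(lia)) as (Hlt & CX & CY).
    assert (M1 := M 0%nat i ltac:(lia)); assert (M2 := M (S i) n ltac:(lia)).
    replace (f (t (S i)) - f (t 0%nat))
      with (plus (f (t i) - f (t 0%nat)) (f (t (S i)) - f (t i)))
      by (unfold plus; simpl; ring).
    apply (is_RInt_Chasles (V := R_NormedModule) _ _ (t i)); [now apply IH; lia |].
    apply (path_lifts_smooth_int D); try assumption.
    + intros s Hs; apply HD; lra.
    + apply (path_lifts_sub A B X Y f (t 0%nat) (t n)); assumption. }
now apply K.
Qed.

(** One curve followed by the reverse of the other is a loop; for its lift [f], with [f 0 = f 1],
    the increment [f (/ 2) - f 0] is the integral along either curve. Taking the same curve twice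
    yields the existence of its integral. *)
Lemma curve_integrals_agree (D : R * R -> Prop) (A B : R -> R -> R) (P Q : R * R)
  (a b a' b' : R) (X Y X' Y' : R -> R) :
  simply_connected D -> locally_exact D A B ->
  (forall x y, D (x, y) -> continuity_2d_pt A x y /\ continuity_2d_pt B x y) ->
  curve_in D P Q a b X Y -> curve_in D P Q a' b' X' Y' ->
  exists l, is_curve_int A B a b X Y l /\ is_curve_int A B a' b' X' Y' l.
Proof.
intros HS HE HAB (Hab & HX & HXD & HP & HQ) (Hab' & HX' & HXD' & HP' & HQ').
destruct (piecewise_smooth_continuous _ _ _ _ HX) as [CX CY].
destruct (piecewise_smooth_continuous _ _ _ _ HX') as [CX' CY'].
(* [u * t + a] runs from [a] to [b] on the first half of the unit interval, [u' * t + v'] from [b']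
   back to [a'] on the second. *)
set (u := 2 * (b - a)); set (u' := - 2 * (b' - a')); set (v' := b' - u' * / 2).
assert (Ru : forall t, 0 <= t <= / 2 -> a <= u * t + a <= b) by (intros; unfold u; nra).
assert (Ru' : forall t, / 2 <= t <= 1 -> a' <= u' * t + v' <= b')
  by (intros; unfold v', u'; nra).
set (g := fun t => if Rle_dec t (/ 2) then (X (u * t + a), Y (u * t + a))
                   else (X' (u' * t + v'), Y' (u' * t + v'))).
assert (Emid : (X (u * / 2 + a), Y (u * / 2 + a)) = (X' (u' * / 2 + v'), Y' (u' * / 2 + v'))).
{ replace (u * / 2 + a) with b by (unfold u; field).
  replace (u' * / 2 + v') with b' by (unfold v'; ring); congruence. }
assert (g1 : forall t, t <= / 2 -> g t = (X (u * t + a), Y (u * t + a))).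
{ intros t Ht; unfold g; destruct Rle_dec; [reflexivity | lra]. }
assert (g2 : forall t, / 2 <= t -> g t = (X' (u' * t + v'), Y' (u' * t + v'))).
{ intros t Ht; unfold g; destruct Rle_dec; [| reflexivity].
  replace t with (/ 2) by lra; exact Emid. }
destruct (loop_lift D A B g HS HE) as [f [Hf Lf]].
- apply (continuous_on_interval_glue g 0 (/ 2) 1); [lra | |].
  + apply (continuous_on_eq _ (fun t => (X (u * t + a), Y (u * t + a)))).
    { intros t Ht; symmetry; apply g1; lra. }
    apply continuous_on_pair; apply (continuous_on_affine _ u a a b); assumption.
  + apply (continuous_on_eq _ (fun t => (X' (u' * t + v'), Y' (u' * t + v')))).
    { intros t Ht; symmetry; apply g2; lra. }
    apply continuous_on_pair; apply (continuous_on_affine _ u' v' a' b'); assumption.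
- intros t Ht; destruct (Rle_dec t (/ 2)).
  + rewrite g1 by lra; apply HXD, Ru; lra.
  + rewrite g2 by lra; apply HXD', Ru'; lra.
- rewrite g1, g2 by lra.
  replace (u * 0 + a) with a by ring.
  replace (u' * 1 + v') with a' by (unfold v', u'; field); congruence.
- exists (f (/ 2) - f 0).
  (* The inverse slopes, which carry the lift back to the parameter intervals of the two curves. *)
  set (w := / (2 * (b - a))); set (w' := - / (2 * (b' - a'))).
  assert (Hw : 0 < w) by (apply Rinv_0_lt_compat; lra).
  assert (Hw' : 0 < / (2 * (b' - a'))) by (apply Rinv_0_lt_compat; lra).
  assert (Ew : u * w = 1) by (unfold u, w; field; lra).
  assert (Ew' : u' * w' = 1) by (unfold u', w'; field; lra).
  split.
  + assert (L1 : path_lifts A B X Y (fun t => f (w * t + - (w * a))) a b).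
    { apply (path_lifts_affine A B (fun t => fst (g t)) (fun t => snd (g t)) X Y f a b 0 1).
      - intros t Ht.
        assert (Hr : 0 <= w * t + - (w * a) <= / 2).
        { replace (/ 2) with (w * (b - a)) by (unfold w; field; lra); nra. }
        rewrite g1 by lra; simpl.
        replace (u * (w * t + - (w * a)) + a) with (u * w * (t - a) + a) by ring.
        rewrite Ew; replace (1 * (t - a) + a) with t by ring; repeat split; lra.
      - exact Lf. }
    assert (I := path_lifts_int D A B X Y _ a b HAB HXD HX L1); simpl in I.
    replace (w * b + - (w * a)) with (/ 2) in I by (unfold w; field; lra).
    replace (w * a + - (w * a)) with 0 in I by ring; exact I.
  + assert (L1 : path_lifts A B X' Y' (fun t => f (w' * t + (/ 2 - w' * b'))) a' b').
    { apply (path_lifts_affine A B (fun t => fst (g t)) (fun t => snd (g t)) X' Y' f a' b' 0 1).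
      - intros t Ht.
        assert (Hr : / 2 <= w' * t + (/ 2 - w' * b') <= 1).
        { assert (Hz : - w' * (b' - a') = / 2) by (unfold w'; field; lra).
          assert (0 < - w') by (unfold w'; lra); nra. }
        rewrite g2 by lra; simpl.
        replace (u' * (w' * t + (/ 2 - w' * b')) + v') with (u' * w' * (t - b') + b')
          by (unfold v'; ring).
        rewrite Ew'; replace (1 * (t - b') + b') with t by ring; repeat split; lra.
      - exact Lf. }
    assert (I := path_lifts_int D A B X' Y' _ a' b' HAB HXD' HX' L1); simpl in I.
    replace (w' * b' + (/ 2 - w' * b')) with (/ 2) in I by ring.
    replace (w' * a' + (/ 2 - w' * b')) with 1 in I by (unfold w'; field; lra).
    (* The reversed half gives [f (/ 2) - f 1]; the loop condition on [f] makes it the common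
       value. *)
    rewrite Hf; exact I.
Qed.

(** * Prolonging curves by segments *)

Lemma open_near_sq (D : R * R -> Prop) (x y : R) : open D -> D (x, y) ->
  exists r, 0 < r /\ forall x' y', near_sq x y r x' y' -> D (x', y').
Proof.
intros HD Hxy; destruct (HD _ Hxy) as [r Hr].
exists r; split; [apply cond_pos | intros x' y' [H1 H2]; apply Hr; now split].
Qed.

Definition extend_by_line (X : R -> R) (b q x t : R) : R :=
  if Rle_dec t b then X t else q + (t - b) * (x - q).

Lemma extend_by_line_left (X : R -> R) (b q x t : R) :
  t <= b -> extend_by_line X b q x t = X t.
Proof. intros H; unfold extend_by_line; destruct Rle_dec; [reflexivity | lra]. Qed.

Lemma extend_by_line_right (X : R -> R) (b q x t : R) :
  X b = q -> b <= t -> extend_by_line X b q x t = q + (t - b) * (x - q).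
Proof.
intros Hq H; unfold extend_by_line; destruct Rle_dec; [| reflexivity].
replace t with b by lra; rewrite Hq; ring.
Qed.

Lemma C1_on_eq (a b : R) (f g : R -> R) :
  (forall t, a <= t <= b -> f t = g t) -> C1_on a b f -> C1_on a b g.
Proof.
intros E [Cf [df [Cd Df]]]; split; [now apply (continuous_on_eq _ f) |].
exists df; split; [exact Cd |]; intros t Ht.
apply (is_derive_ext_loc f); [| now apply Df].
assert (Hm : 0 < Rmin (t - a) (b - t)) by (apply Rmin_glb_lt; lra).
exists (mkposreal _ Hm); intros s Hs; change (Rabs (s - t) < Rmin (t - a) (b - t)) in Hs.
apply Rmin_Rgt in Hs; destruct Hs as [H1 H2]; apply Rabs_def2 in H1; apply Rabs_def2 in H2.
apply E; lra.
Qed.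

Lemma C1_on_affine (a b q x c : R) : C1_on a b (fun t => q + (t - c) * (x - q)).
Proof.
assert (D : forall t, is_derive (fun t => q + (t - c) * (x - q)) t (x - q)).
{ intros t; auto_derive; [easy | ring]. }
assert (K : forall f : R -> R, (forall t, continuous f t) ->
  continuous_on (fun t => a <= t <= b) f).
{ intros f Hf t _.
  apply (filterlim_filter_le_1 f (filter_le_within (F := locally t) _)), Hf. }
split.
- apply K; intros t; apply (ex_derive_continuous (V := R_NormedModule)
    (fun t => q + (t - c) * (x - q)) t); eexists; apply D.
- exists (fun _ => x - q); split; [apply K; intros; apply continuous_const | intros; apply D].
Qed.

Lemma extend_by_line_C1 (X : R -> R) (b q x : R) : X b = q ->
  C1_on b (b + 1) (extend_by_line X b q x).
Proof.
intros Hq; apply (C1_on_eq _ _ (fun t => q + (t - b) * (x - q))).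
- intros t Ht; symmetry; apply extend_by_line_right; [exact Hq | lra].
- apply C1_on_affine.
Qed.

Lemma curve_extend (D : R * R -> Prop) (P : R * R) (qx qy x y a b : R) (X Y : R -> R) :
  (forall s, 0 <= s <= 1 -> D (qx + s * (x - qx), qy + s * (y - qy))) ->
  curve_in D P (qx, qy) a b X Y ->
  curve_in D P (x, y) a (b + 1) (extend_by_line X b qx x) (extend_by_line Y b qy y).
Proof.
intros HD (Hab & (n & t & Ht0 & Htn & H) & HXD & HP & HQ).
injection HQ; intros Ey Ex.
assert (M := subdivision_mono n t (fun i Hi => proj1 (H i Hi))).
split; [lra |]; split; [| split; [| split]].
(* The old nodes keep their indices up to [n]; the new last node [b + 1] has index [S n]. *)
- exists (S n), (fun i => if Nat.leb i n then t i else b + 1).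
  split; [exact Ht0 |]; split.
  { replace (Nat.leb (S n) n) with false; [reflexivity |].
    symmetry; apply Nat.leb_gt; lia. }
  intros i Hi; rewrite (proj2 (Nat.leb_le i n)) by lia.
  destruct (Nat.eq_dec i n) as [-> | Hin].
  + replace (Nat.leb (S n) n) with false by (symmetry; apply Nat.leb_gt; lia).
    rewrite Htn; split; [lra | split; now apply extend_by_line_C1].
  + rewrite (proj2 (Nat.leb_le (S i) n)) by lia.
    destruct (H i ltac:(lia)) as (Hlt & CX & CY).
    assert (M' := M (S i) n ltac:(lia)); rewrite Htn in M'.
    split; [exact Hlt | split].
    * apply (C1_on_eq _ _ X); [| exact CX].
      intros s Hs; symmetry; apply extend_by_line_left; lra.
    * apply (C1_on_eq _ _ Y); [| exact CY].
      intros s Hs; symmetry; apply extend_by_line_left; lra.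
- intros s Hs; destruct (Rle_dec s b).
  + rewrite !extend_by_line_left by assumption; apply HXD; lra.
  + rewrite !extend_by_line_right by (assumption || lra); apply HD; lra.
- rewrite !extend_by_line_left by lra; exact HP.
- rewrite !extend_by_line_right by (assumption || lra); apply (f_equal2 pair); ring.
Qed.

(** The added segment stays in a square with primitive [F], and [F] along it is a lift, so its
    integral is an increment of [F]. *)
Lemma curve_extend_int (D : R * R -> Prop) (A B F : R -> R -> R) (P : R * R)
  (qx qy x y a b r l : R) (X Y : R -> R) :
  (forall x y, D (x, y) -> continuity_2d_pt A x y /\ continuity_2d_pt B x y) ->
  (forall s, 0 <= s <= 1 -> D (qx + s * (x - qx), qy + s * (y - qy))) ->
  primitive_on A B F qx qy r -> near_sq qx qy r x y ->
  curve_in D P (qx, qy) a b X Y -> is_curve_int A B a b X Y l ->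
  is_curve_int A B a (b + 1) (extend_by_line X b qx x) (extend_by_line Y b qy y)
    (l + (F x y - F qx qy)).
Proof.
intros HAB HD HF Hxy HC HI.
assert (HC' := curve_extend D P qx qy x y a b X Y HD HC).
destruct HC as (Hab & _ & _ & _ & HQ); injection HQ; intros Ey Ex.
destruct HC' as (_ & _ & HXD & _ & _).
set (X' := extend_by_line X b qx x) in *; set (Y' := extend_by_line Y b qy y) in *.
assert (E1 : forall t, b <= t -> X' t = qx + (t - b) * (x - qx) /\ Y' t = qy + (t - b) * (y - qy)).
{ intros t Ht; split; now apply extend_by_line_right. }
assert (Hr : 0 < r) by (destruct Hxy as [H _]; pose proof (Rabs_pos (x - qx)); lra).
apply (is_RInt_Chasles (V := R_NormedModule) _ a b (b + 1) l (F x y - F qx qy)).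
- apply (is_RInt_ext (V := R_NormedModule)
    (fun t => A (X t) (Y t) * Derive X t + B (X t) (Y t) * Derive Y t)); [| exact HI].
  rewrite Rmin_left, Rmax_right by lra; intros t Ht.
  assert (DE : forall Z q z, Derive (extend_by_line Z b q z) t = Derive Z t).
  { intros Z q z; apply Derive_ext_loc.
    assert (Hm : 0 < b - t) by lra.
    exists (mkposreal _ Hm); intros s Hs; change (Rabs (s - t) < b - t) in Hs.
    apply Rabs_def2 in Hs; apply extend_by_line_left; lra. }
  unfold X', Y'; rewrite !DE, !extend_by_line_left by lra; reflexivity.
- assert (HN : forall t, b <= t <= b + 1 -> near_sq qx qy r (X' t) (Y' t)).
  { intros t Ht; destruct (E1 t) as [-> ->]; [lra |].
    apply near_sq_segment; [now apply near_sq_center | exact Hxy | lra]. }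
  replace (F x y - F qx qy) with (F (X' (b + 1)) (Y' (b + 1)) - F (X' b) (Y' b)).
  2:{ destruct (E1 (b + 1)) as [-> ->]; [lra |]; destruct (E1 b) as [-> ->]; [lra |].
      apply f_equal2; apply f_equal2; ring. }
  apply (path_lifts_smooth_int D A B X' Y' (fun t => F (X' t) (Y' t))); try assumption; try lra.
  + intros t Ht; apply HXD; lra.
  + now apply extend_by_line_C1.
  + now apply extend_by_line_C1.
  + intros t Ht; destruct (near_sq_open _ _ _ _ _ (HN t Ht)) as [r' [Hr' Hsub]].
    exists F, r', 1; repeat split; try lra.
    intros u v Huv; apply HF, Hsub, Huv.
Qed.

(** [curve_in] demands [a < b], so a point is joined to itself by a constant curve over an interval
    of positive length. *)
Lemma curve_constant (D : R * R -> Prop) (x y : R) : D (x, y) ->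
  curve_in D (x, y) (x, y) 0 1 (fun _ => x) (fun _ => y).
Proof.
intros Hxy; split; [lra |]; split; [| now repeat split].
exists 1%nat, INR; split; [reflexivity |]; split; [reflexivity |].
intros i Hi; replace i with 0%nat by lia; simpl; split; [lra |].
assert (K : forall z : R, C1_on 0 1 (fun _ => z)).
{ intros z; apply (C1_on_eq _ _ (fun t => z + (t - 0) * (z - z))); [intros; ring |].
  apply C1_on_affine. }
split; apply K.
Qed.

(** Reachability from [P] is unchanged inside a small square, because the segment between two of its
    points can be appended in either direction; the reachable and the unreachable points of [D] thus
    form open sets. *)
Lemma domain_curve_connected (D : R * R -> Prop) (P Q : R * R) :
  is_domain D -> D P -> D Q -> exists a b X Y, curve_in D P Q a b X Y.
Proof.
intros (Ho & _ & Hconn) HP HQ.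
set (reach := fun Q => exists a b X Y, curve_in D P Q a b X Y).
assert (Hstep : forall x y r x' y',
  (forall u v, near_sq x y r u v -> D (u, v)) -> near_sq x y r x' y' ->
  (reach (x, y) <-> reach (x', y'))).
{ intros x y r x' y' HD HN.
  assert (Hr : 0 < r) by (destruct HN as [H _]; pose proof (Rabs_pos (x' - x)); lra).
  assert (N0 := near_sq_center x y r Hr).
  split; intros (a & b & X & Y & HC).
  - eexists; eexists; eexists; eexists; apply (curve_extend D P x y); [| exact HC].
    intros s Hs; apply HD, near_sq_segment; assumption.
  - eexists; eexists; eexists; eexists; apply (curve_extend D P x' y'); [| exact HC].
    intros s Hs; apply HD, near_sq_segment; assumption. }
apply NNPP; intros Hno.
destruct (Hconn (fun Q => D Q /\ reach Q) (fun Q => D Q /\ ~ reach Q)) as (Z & _ & [_ H1] & [_ H2]).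
- intros [x y] [HD Hre]; destruct (open_near_sq D x y Ho HD) as [r [Hr HN]].
  exists (mkposreal r Hr); intros [x' y'] [B1 B2].
  assert (N : near_sq x y r x' y') by now split.
  split; [now apply HN | now apply (Hstep x y r x' y')].
- intros [x y] [HD Hre]; destruct (open_near_sq D x y Ho HD) as [r [Hr HN]].
  exists (mkposreal r Hr); intros [x' y'] [B1 B2].
  assert (N : near_sq x y r x' y') by now split.
  split; [now apply HN | intros Hre'; apply Hre; now apply (Hstep x y r x' y')].
- intros Z HZ; destruct (classic (reach Z)); [left | right]; now split.
- exists P; repeat split; try assumption.
  destruct P as [x y]; eexists; eexists; eexists; eexists; now apply curve_constant.
- exists Q; repeat split; assumption.
- now apply H2.
Qed.

(** Choice selects the integral along some curve, and path independence shows that every other curve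
    gives the same value. *)
Lemma curve_primitive_exists (D : R * R -> Prop) (A B : R -> R -> R) (P : R * R) (c : R) :
  is_domain D -> simply_connected D -> locally_exact D A B ->
  (forall x y, D (x, y) -> continuity_2d_pt A x y /\ continuity_2d_pt B x y) ->
  D P -> exists u, is_curve_primitive D A B P c u.
Proof.
intros HD HS HE HAB HP.
exists (fun x y => epsilon (inhabits 0) (fun l => exists a b X Y,
  curve_in D P (x, y) a b X Y /\ is_curve_int A B a b X Y l) + c).
intros x y Hxy.
destruct (domain_curve_connected D P (x, y) HD HP Hxy) as (a & b & X & Y & HC).
split; [now exists a, b, X, Y |].
intros a' b' X' Y' HC'.
match goal with |- context [epsilon ?i ?Q] => assert (HQ : Q (epsilon i Q)) end.
{ apply epsilon_spec.
  destruct (curve_integrals_agree D A B _ _ _ _ _ _ _ _ _ _ HS HE HAB HC HC) as [l [Hl _]].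
  now exists l, a, b, X, Y. }
destruct HQ as (a2 & b2 & X2 & Y2 & HC2 & HI2).
set (l := epsilon _ _) in *; clearbody l.
exists l; split; [| reflexivity].
destruct (curve_integrals_agree D A B _ _ _ _ _ _ _ _ _ _ HS HE HAB HC2 HC') as [l' [Hl2 Hl']].
replace l with l'; [exact Hl' |].
transitivity (RInt (fun t => A (X2 t) (Y2 t) * Derive X2 t + B (X2 t) (Y2 t) * Derive Y2 t) a2 b2).
- symmetry; exact (is_RInt_unique (V := R_CompleteNormedModule) _ _ _ _ Hl2).
- exact (is_RInt_unique (V := R_CompleteNormedModule) _ _ _ _ HI2).
Qed.

(** Extending one fixed curve ending at [(x, y)] by short segments shows that near this point [u] is
    a local primitive plus a constant. *)
Lemma curve_primitive_differentiable (D : R * R -> Prop) (A B : R -> R -> R) (P : R * R)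
  (c : R) (u : R -> R -> R) (x y : R) :
  open D -> locally_exact D A B ->
  (forall x y, D (x, y) -> continuity_2d_pt A x y /\ continuity_2d_pt B x y) ->
  is_curve_primitive D A B P c u -> D (x, y) ->
  differentiable_pt_lim u x y (A x y) (B x y).
Proof.
intros Ho HE HAB Hu Hxy.
destruct (HE x y Hxy) as (F & r1 & Hr1 & HF).
destruct (open_near_sq D x y Ho Hxy) as [r2 [Hr2 HD]].
assert (Hr : 0 < Rmin r1 r2) by now apply Rmin_glb_lt.
destruct (Hu x y Hxy) as [(a & b & X & Y & HC) Hall].
destruct (Hall a b X Y HC) as (l & Hl & El).
assert (N0 := near_sq_center x y r1 Hr1); assert (N0' := near_sq_center x y r2 Hr2).
apply differentiable_pt_lim_ext with (fun x' y' => 1 * F x' y' + 0 * F x' y' + (u x y - F x y)).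
- exists (mkposreal _ Hr); simpl; intros x' y' H1 H2.
  assert (N : near_sq x y (Rmin r1 r2) x' y') by now split.
  assert (N1 := near_sq_mono _ _ _ _ _ _ (Rmin_l _ _) N).
  assert (N2 := near_sq_mono _ _ _ _ _ _ (Rmin_r _ _) N).
  assert (Hseg : forall s, 0 <= s <= 1 -> D (x + s * (x' - x), y + s * (y' - y))).
  { intros s Hs; apply HD, near_sq_segment; assumption. }
  destruct (Hu x' y' (HD _ _ N2)) as [_ Hall'].
  destruct (Hall' _ _ _ _ (curve_extend D P x y x' y' a b X Y Hseg HC)) as (l' & Hl' & ->).
  assert (HI := curve_extend_int D A B F P x y x' y' a b r1 l X Y HAB Hseg HF N1 HC Hl).
  apply (is_RInt_unique (V := R_CompleteNormedModule)) in HI.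
  apply (is_RInt_unique (V := R_CompleteNormedModule)) in Hl'.
  assert (E : l' = l + (F x' y' - F x y)) by (rewrite <- HI, <- Hl'; reflexivity).
  rewrite E, El; ring.
- assert (H := differentiable_pt_lim_lin F F 1 0 (u x y - F x y) x y _ _ _ _ (HF _ _ N0) (HF _ _ N0)).
  match type of H with differentiable_pt_lim _ _ _ ?l1 ?l2 =>
    replace l1 with (A x y) in H by ring; replace l2 with (B x y) in H by ring end.
  exact H.
Qed.

(** * Idempotent components of monogenic functions *)

(** [a = (S1r a + i S1i a) I1 + (S2r a + i S2i a) I2]. *)
Definition S1r (a : B0) : R := Re (fst a) + Re (snd a).
Definition S1i (a : B0) : R := Im (fst a) + Im (snd a).
Definition S2r (a : B0) : R := Re (fst a) - Re (snd a).
Definition S2i (a : B0) : R := Im (fst a) - Im (snd a).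

(** Multiplication becomes complex multiplication in each component: the algebra is the product of
    two copies of [C]. *)
Lemma idempotent_mul (a b : B0) :
  S1r (B0mul a b) = S1r a * S1r b - S1i a * S1i b /\
  S1i (B0mul a b) = S1r a * S1i b + S1i a * S1r b /\
  S2r (B0mul a b) = S2r a * S2r b - S2i a * S2i b /\
  S2i (B0mul a b) = S2r a * S2i b + S2i a * S2r b.
Proof. unfold S1r, S1i, S2r, S2i; repeat split; B0_expand; ring. Qed.

Lemma idempotent_minus (a b : B0) :
  S1r (minus a b : B0) = S1r a - S1r b /\ S1i (minus a b : B0) = S1i a - S1i b /\
  S2r (minus a b : B0) = S2r a - S2r b /\ S2i (minus a b : B0) = S2i a - S2i b.
Proof. unfold S1r, S1i, S2r, S2i; repeat split; B0_expand; ring. Qed.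

Lemma zeta_components (p x y : R) :
  Re (fst (zeta p x y)) = x /\ Im (fst (zeta p x y)) = (1 + p) / 2 * y /\
  Re (snd (zeta p x y)) = 0 /\ Im (snd (zeta p x y)) = (1 - p) / 2 * y.
Proof. repeat split; B0_expand; field. Qed.

Lemma idempotent_zeta (p x y : R) :
  S1r (zeta p x y) = x /\ S1i (zeta p x y) = y /\
  S2r (zeta p x y) = x /\ S2i (zeta p x y) = p * y.
Proof.
unfold S1r, S1i, S2r, S2i; destruct (zeta_components p x y) as (-> & -> & -> & ->).
repeat split; field.
Qed.

Lemma zeta_plus (p x y a b : R) :
  plus (zeta p x y : B0) (zeta p a b : B0) = zeta p (x + a) (y + b).
Proof. B0_expand; apply f_equal2; apply f_equal2; field. Qed.

Lemma B0mul_inv_mul (p : R) (a h : B0) : 0 < p -> p <> 1 -> mu p h -> h <> zero ->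
  B0mul (B0mul a (B0inv h)) h = a.
Proof.
intros Hp Hp1 Hh Hn; assert (H := B0inv_mu p h Hp Hp1 Hh Hn).
transitivity (B0mul a (B0mul h (B0inv h))).
- unfold B0mul; apply injective_projections; cbn [fst snd]; ring.
- rewrite H; destruct a as [z w]; unfold B0mul, B0unit; cbn [fst snd].
  apply f_equal2; ring.
Qed.

Lemma B0_ball (a b : B0) (eps : R) : ball (a : B0) eps (b : B0) <->
  (Rabs (Re (fst b) - Re (fst a)) < eps /\ Rabs (Im (fst b) - Im (fst a)) < eps) /\
  (Rabs (Re (snd b) - Re (snd a)) < eps /\ Rabs (Im (snd b) - Im (snd a)) < eps).
Proof. reflexivity. Qed.

Lemma ball_idempotent (a b : B0) (eps : R) : ball (a : B0) eps (b : B0) ->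
  Rabs (S1r b - S1r a) <= 2 * eps /\ Rabs (S1i b - S1i a) <= 2 * eps /\
  Rabs (S2r b - S2r a) <= 2 * eps /\ Rabs (S2i b - S2i a) <= 2 * eps.
Proof.
intros H; destruct (proj1 (B0_ball a b eps) H) as [[H1 H2] [H3 H4]]; unfold S1r, S1i, S2r, S2i.
apply Rabs_def2 in H1; apply Rabs_def2 in H2; apply Rabs_def2 in H3; apply Rabs_def2 in H4.
repeat split; apply Rabs_le; lra.
Qed.

Lemma idempotent_ball (a b : B0) (eps : R) :
  Rabs (S1r b - S1r a) < eps -> Rabs (S1i b - S1i a) < eps ->
  Rabs (S2r b - S2r a) < eps -> Rabs (S2i b - S2i a) < eps ->
  ball (a : B0) eps (b : B0).
Proof.
unfold S1r, S1i, S2r, S2i; intros H1 H2 H3 H4; apply B0_ball.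
apply Rabs_def2 in H1; apply Rabs_def2 in H2; apply Rabs_def2 in H3; apply Rabs_def2 in H4.
repeat split; apply Rabs_def1; lra.
Qed.

(** The coordinate [(1 + p) / 2 * y] of [zeta] controls [y] with a factor above one half, whence the
    radius [eps / 2]. *)
Lemma zeta_ball (p x y x' y' eps : R) : 0 < p ->
  ball (zeta p x y : B0) (eps / 2) (zeta p x' y' : B0) -> near_sq x y eps x' y'.
Proof.
intros Hp H; destruct (proj1 (B0_ball _ _ _) H) as [[H1 H2] _]; revert H1 H2.
destruct (zeta_components p x y) as (-> & -> & _ & _).
destruct (zeta_components p x' y') as (-> & -> & _ & _); intros H1 H2.
pose proof (Rabs_pos (x' - x)); split; [lra |].
replace ((1 + p) / 2 * y' - (1 + p) / 2 * y) with ((1 + p) / 2 * (y' - y)) in H2 by ring.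
rewrite Rabs_mult, Rabs_pos_eq in H2 by lra.
pose proof (Rabs_pos (y' - y)); nra.
Qed.

Lemma ball_zeta (p x y x' y' eps : R) : 0 < p ->
  near_sq x y (eps / (1 + p)) x' y' ->
  ball (zeta p x y : B0) eps (zeta p x' y' : B0).
Proof.
intros Hp [H1 H2]; apply B0_ball.
assert (He : eps = (1 + p) * (eps / (1 + p))) by (field; lra).
set (e := eps / (1 + p)) in *; clearbody e; subst eps.
destruct (zeta_components p x y) as (-> & -> & -> & ->).
destruct (zeta_components p x' y') as (-> & -> & -> & ->).
apply Rabs_def2 in H1; apply Rabs_def2 in H2.
repeat split; apply Rabs_def1; nra.
Qed.

(** The two expressions are the parts of the complex product [(dr + i di) (a + i q b)]. *)
Lemma complex_product_bound (q e M dr di a b : R) : 0 < q ->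
  Rabs dr <= e -> Rabs di <= e -> Rabs a <= M -> Rabs b <= M ->
  Rabs (dr * a - di * (q * b)) <= e * (1 + q) * M /\
  Rabs (dr * (q * b) + di * a) <= e * (1 + q) * M.
Proof.
intros Hq H1 H2 H3 H4.
assert (T : forall d c, Rabs d <= e -> Rabs c <= M -> Rabs (d * c) <= e * M).
{ intros d c Hd Hc; rewrite Rabs_mult; apply Rmult_le_compat; try apply Rabs_pos; assumption. }
assert (T1 := T dr a H1 H3); assert (T2 := T di b H2 H4).
assert (T3 := T dr b H1 H4); assert (T4 := T di a H2 H3).
apply Rabs_le_between in T1; apply Rabs_le_between in T2;
apply Rabs_le_between in T3; apply Rabs_le_between in T4.
split; apply Rabs_le_between; nra.
Qed.

(** Multiplying [(dr + i di) (a + i q b)] by the conjugate [a - i q b] gives [dr + i di] times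
    [N = |a + i q b|^2], and [M^2] is at most [(1 + 1 / q^2) N]. This is a quantitative form of the
    invertibility of nonzero increments. *)
Lemma complex_quotient_bound (q e dr di a b : R) : 0 < q -> a <> 0 \/ b <> 0 ->
  Rabs (dr * a - di * (q * b)) <= e * Rmax (Rabs a) (Rabs b) ->
  Rabs (dr * (q * b) + di * a) <= e * Rmax (Rabs a) (Rabs b) ->
  Rabs dr <= e * ((1 + q) * (1 + / (q * q))) /\
  Rabs di <= e * ((1 + q) * (1 + / (q * q))).
Proof.
intros Hq Hab H1 H2.
set (M := Rmax (Rabs a) (Rabs b)) in *.
assert (Ma : Rabs a <= M) by apply Rmax_l.
assert (Mb : Rabs b <= M) by apply Rmax_r.
set (er := dr * a - di * (q * b)) in *; set (ei := dr * (q * b) + di * a) in *.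
set (N := a * a + q * q * (b * b)).
assert (HN : 0 < N).
{ unfold N; destruct Hab; [assert (0 < a * a) by nra; assert (0 <= q * q * (b * b)) by nra
   | assert (0 < b * b) by nra; assert (0 < q * q) by nra;
     assert (0 < q * q * (b * b)) by nra; assert (0 <= a * a) by nra]; lra. }
assert (HM : 0 < M).
{ destruct Hab as [Ha | Hb]; [apply Rabs_pos_lt in Ha | apply Rabs_pos_lt in Hb]; lra. }
assert (He : 0 <= e) by (pose proof (Rabs_pos er); nra).
assert (HMN : M * M <= (1 + / (q * q)) * N).
{ assert (Hi : 0 < / (q * q)) by (apply Rinv_0_lt_compat; nra).
  assert (Hqq : / (q * q) * (q * q) = 1) by (field; lra).
  assert (Hb2 : / (q * q) * (q * q * (b * b)) = b * b)
    by (rewrite <- Rmult_assoc, Hqq; ring).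
  assert (0 <= / (q * q) * (a * a)) by nra.
  assert (0 <= q * q * (b * b)) by nra.
  assert (M * M <= a * a + b * b).
  { unfold M; apply Rmax_case; rewrite <- Rabs_mult, Rabs_pos_eq by nra; nra. }
  unfold N; lra. }
assert (C1 := complex_product_bound q (e * M) M er ei a (- b) Hq H1 H2 Ma
  ltac:(rewrite Rabs_Ropp; exact Mb)).
replace (er * a - ei * (q * - b)) with (dr * N) in C1 by (unfold er, ei, N; ring).
replace (er * (q * - b) + ei * a) with (di * N) in C1 by (unfold er, ei, N; ring).
rewrite !Rabs_mult, (Rabs_pos_eq N) in C1 by lra.
assert (B : e * M * (1 + q) * M <= e * ((1 + q) * (1 + / (q * q))) * N).
{ replace (e * M * (1 + q) * M) with (e * (1 + q) * (M * M)) by ring.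
  replace (e * ((1 + q) * (1 + / (q * q))) * N) with (e * (1 + q) * ((1 + / (q * q)) * N)) by ring.
  apply Rmult_le_compat_l; [nra | exact HMN]. }
split; apply (Rmult_le_reg_r N); lra.
Qed.

Lemma zeta_neq_0 (p a b : R) : a <> 0 \/ b <> 0 -> zeta p a b <> zero.
Proof.
intros Hab H.
destruct (idempotent_zeta p a b) as (H1 & H2 & _).
rewrite H in H1, H2; revert H1 H2; unfold S1r, S1i, zero; simpl; lra.
Qed.

Definition component (p : R) (S : B0 -> R) (Phi : B0 -> B0) (x y : R) : R :=
  S (Phi (zeta p x y)).

(** Multiplying the difference quotient by the increment again trades the division in the algebra
    for one complex product in each idempotent component. *)
Lemma mono_derive_quotient (p : R) (Phi : B0 -> B0) (x y a b : R) :
  0 < p -> p <> 1 -> a <> 0 \/ b <> 0 ->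
  let w := B0mul (minus (Phi (plus (zeta p x y : B0) (zeta p a b : B0)))
                        (Phi (zeta p x y)) : B0) (B0inv (zeta p a b)) in
  let del S := component p S Phi (x + a) (y + b) - component p S Phi x y in
  del S1r = S1r w * a - S1i w * (1 * b) /\ del S1i = S1r w * (1 * b) + S1i w * a /\
  del S2r = S2r w * a - S2i w * (p * b) /\ del S2i = S2r w * (p * b) + S2i w * a.
Proof.
intros Hp Hp1 Hab w del.
assert (E : B0mul w (zeta p a b) = minus (Phi (zeta p (x + a) (y + b))) (Phi (zeta p x y))).
{ unfold w; rewrite zeta_plus.
  apply (B0mul_inv_mul p); [exact Hp | exact Hp1 | now exists a, b | now apply zeta_neq_0]. }
destruct (idempotent_mul w (zeta p a b)) as (M1 & M2 & M3 & M4).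
destruct (idempotent_minus (Phi (zeta p (x + a) (y + b))) (Phi (zeta p x y)))
  as (D1 & D2 & D3 & D4).
rewrite <- E in D1, D2, D3, D4.
destruct (idempotent_zeta p a b) as (Z1 & Z2 & Z3 & Z4).
rewrite Z1, Z2 in M1, M2; rewrite Z3, Z4 in M3, M4.
unfold del, component; repeat split; lra.
Qed.

Lemma mono_derive_cr (p : R) (Phi : B0 -> B0) (x y : R) (l : B0) :
  0 < p -> p <> 1 -> is_mono_derive p Phi (zeta p x y) l ->
  cr 1 (component p S1r Phi) (component p S1i Phi) (S1r l) (S1i l) x y /\
  cr p (component p S2r Phi) (component p S2i Phi) (S2r l) (S2i l) x y.
Proof.
intros Hp Hp1 H.
assert (HF : Filter (within (mu p) (locally' (zero : B0)))).
{ apply within_filter, within_filter, locally_filter. }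
assert (K : forall eps : posreal, locally_2d (fun u v =>
  let M := Rmax (Rabs (u - x)) (Rabs (v - y)) in
  let del S := component p S Phi u v - component p S Phi x y in
  Rabs (del S1r - (S1r l * (u - x) - S1i l * (1 * (v - y)))) <= eps * M /\
  Rabs (del S1i - (S1r l * (1 * (v - y)) + S1i l * (u - x))) <= eps * M /\
  Rabs (del S2r - (S2r l * (u - x) - S2i l * (p * (v - y)))) <= eps * M /\
  Rabs (del S2i - (S2r l * (p * (v - y)) + S2i l * (u - x))) <= eps * M) x y).
{ intros eps.
  (* [ball_idempotent] costs a factor 2 and [complex_product_bound] a factor [1 + q], with [q] equal
     to 1 or [p]; the constant covers both. *)
  assert (He : 0 < eps / (4 * (1 + p))) by (apply Rdiv_lt_0_compat; [apply cond_pos | lra]).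
  destruct (proj1 (filterlim_locally _ _) H (mkposreal _ He)) as [d Hd].
  assert (Hd' : 0 < d / (1 + p)) by (apply Rdiv_lt_0_compat; [apply cond_pos | lra]).
  exists (mkposreal _ Hd'); simpl; intros u v Hu Hv.
  set (a := u - x) in *; set (b := v - y) in *.
  set (M := Rmax (Rabs a) (Rabs b)).
  assert (Ma : Rabs a <= M) by apply Rmax_l.
  assert (Mb : Rabs b <= M) by apply Rmax_r.
  (* The limit is over nonzero increments, while differentiability also speaks of the zero one,
     where all terms vanish. *)
  destruct (classic (a <> 0 \/ b <> 0)) as [Hab | Hab].
  - assert (Q := mono_derive_quotient p Phi x y a b Hp Hp1 Hab); cbv zeta in Q.
    replace (x + a) with u in Q by (unfold a; ring).
    replace (y + b) with v in Q by (unfold b; ring).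
    specialize (Hd (zeta p a b)).
    set (w := B0mul _ _) in *.
    assert (Hw : ball (l : B0) (eps / (4 * (1 + p))) (w : B0)).
    { apply Hd; [| now apply zeta_neq_0 | now exists a, b].
      assert (Z : (zero : B0) = zeta p 0 0).
      { unfold zero; simpl; unfold prod_zero; B0_expand; apply f_equal2; apply f_equal2; ring. }
      rewrite Z; apply ball_zeta; [exact Hp |].
      split; rewrite Rminus_0_r; assumption. }
    apply ball_idempotent in Hw.
    set (e := 2 * (eps / (4 * (1 + p)))) in *.
    destruct Hw as (W1 & W2 & W3 & W4), Q as (Q1 & Q2 & Q3 & Q4).
    destruct (complex_product_bound 1 e M _ _ a b Rlt_0_1 W1 W2 Ma Mb) as [B1 B2].
    destruct (complex_product_bound p e M _ _ a b Hp W3 W4 Ma Mb) as [B3 B4].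
    assert (HM : 0 <= M) by (pose proof (Rabs_pos a); lra).
    assert (E1 : e * (1 + p) = eps / 2) by (unfold e; field; lra).
    assert (E2 : e * (1 + 1) <= eps).
    { assert (0 < e) by (unfold e; lra); assert (0 < e * p) by nra.
      pose proof (cond_pos eps); lra. }
    assert (E3 : e * (1 + p) * M <= eps * M).
    { rewrite E1; pose proof (cond_pos eps); apply Rmult_le_compat_r; lra. }
    assert (E4 : e * (1 + 1) * M <= eps * M) by (apply Rmult_le_compat_r; lra).
    rewrite Q1, Q2, Q3, Q4; repeat split.
    + apply Rle_trans with (2 := E4), Rle_trans with (2 := B1), Req_le, f_equal; ring.
    + apply Rle_trans with (2 := E4), Rle_trans with (2 := B2), Req_le, f_equal; ring.
    + apply Rle_trans with (2 := E3), Rle_trans with (2 := B3), Req_le, f_equal; ring.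
    + apply Rle_trans with (2 := E3), Rle_trans with (2 := B4), Req_le, f_equal; ring.
  - assert (Ha : a = 0) by (apply NNPP; tauto).
    assert (Hb : b = 0) by (apply NNPP; tauto).
    assert (Eu : u = x) by (unfold a in Ha; lra).
    assert (Ev : v = y) by (unfold b in Hb; lra).
    assert (HM : 0 <= eps * M).
    { apply Rmult_le_pos; [left; apply cond_pos | pose proof (Rabs_pos a); lra]. }
    rewrite Ha, Hb, Eu, Ev; repeat split;
    (match goal with |- Rabs ?z <= _ => replace z with 0 by ring end;
     rewrite Rabs_R0; exact HM). }
repeat split; intros eps; destruct (K eps) as [d Hd]; exists d; intros u v Hu Hv;
 destruct (Hd u v Hu Hv) as (K1 & K2 & K3 & K4).
- apply Rle_trans with (2 := K1), Req_le, f_equal; ring.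
- apply Rle_trans with (2 := K2), Req_le, f_equal; ring.
- apply Rle_trans with (2 := K3), Req_le, f_equal; ring.
- apply Rle_trans with (2 := K4), Req_le, f_equal; ring.
Qed.

Lemma cr_mono_derive (p : R) (Phi : B0 -> B0) (x y : R) (l : B0) :
  0 < p -> p <> 1 ->
  cr 1 (component p S1r Phi) (component p S1i Phi) (S1r l) (S1i l) x y ->
  cr p (component p S2r Phi) (component p S2i Phi) (S2r l) (S2i l) x y ->
  is_mono_derive p Phi (zeta p x y) l.
Proof.
intros Hp Hp1 [C1 C2] [C3 C4].
assert (HF : Filter (within (mu p) (locally' (zero : B0)))).
{ apply within_filter, within_filter, locally_filter. }
apply (proj2 (filterlim_locally _ _)); intros eps.
(* The constants of [complex_quotient_bound] for the two components. *)
set (k1 := (1 + 1) * (1 + / (1 * 1))); set (k2 := (1 + p) * (1 + / (p * p))).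
assert (Hk1 : 0 < k1) by (unfold k1; rewrite Rmult_1_r, Rinv_1; lra).
assert (Hk2 : 0 < k2).
{ unfold k2; apply Rmult_lt_0_compat; [lra |].
  assert (0 < / (p * p)) by (apply Rinv_0_lt_compat; nra); lra. }
set (e := eps / (k1 + k2)).
assert (He : 0 < e) by (apply Rdiv_lt_0_compat; [apply cond_pos | lra]).
assert (Ee : e * (k1 + k2) = eps) by (unfold e; field; lra).
assert (E1 : e * k1 < eps) by (assert (0 < e * k2) by nra; lra).
assert (E2 : e * k2 < eps) by (assert (0 < e * k1) by nra; lra).
destruct (C1 (mkposreal e He)) as [d1 H1]; destruct (C2 (mkposreal e He)) as [d2 H2].
destruct (C3 (mkposreal e He)) as [d3 H3]; destruct (C4 (mkposreal e He)) as [d4 H4].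
simpl in H1, H2, H3, H4.
(* Half of the common radius, because [zeta_ball] loses a factor 2. *)
assert (Hd : 0 < Rmin (Rmin d1 d2) (Rmin d3 d4) / 2).
{ apply Rdiv_lt_0_compat; [| lra]; repeat apply Rmin_glb_lt; apply cond_pos. }
exists (mkposreal _ Hd); simpl; intros h Hh Hn [a [b Ehab]]; subst h.
assert (Z : (zero : B0) = zeta p 0 0).
{ unfold zero; simpl; unfold prod_zero; B0_expand; apply f_equal2; apply f_equal2; ring. }
assert (Hab : a <> 0 \/ b <> 0).
{ apply NNPP; intros Hab; apply Hn.
  assert (Ha : a = 0) by (apply NNPP; tauto).
  assert (Hb : b = 0) by (apply NNPP; tauto); now rewrite Ha, Hb, Z. }
rewrite Z in Hh; apply zeta_ball in Hh; [| exact Hp].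
destruct Hh as [Ha Hb]; rewrite Rminus_0_r in Ha, Hb.
apply Rmin_Rgt in Ha; destruct Ha as [Ha Ha']; apply Rmin_Rgt in Ha; apply Rmin_Rgt in Ha'.
apply Rmin_Rgt in Hb; destruct Hb as [Hb Hb']; apply Rmin_Rgt in Hb; apply Rmin_Rgt in Hb'.
assert (Ex : x + a - x = a) by ring; assert (Ey : y + b - y = b) by ring.
specialize (H1 (x + a) (y + b)); specialize (H2 (x + a) (y + b));
specialize (H3 (x + a) (y + b)); specialize (H4 (x + a) (y + b)).
rewrite Ex, Ey in H1, H2, H3, H4.
specialize (H1 ltac:(tauto) ltac:(tauto)); specialize (H2 ltac:(tauto) ltac:(tauto));
specialize (H3 ltac:(tauto) ltac:(tauto)); specialize (H4 ltac:(tauto) ltac:(tauto)).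
assert (Q := mono_derive_quotient p Phi x y a b Hp Hp1 Hab); cbv zeta in Q.
set (w := B0mul _ _) in *; destruct Q as (Q1 & Q2 & Q3 & Q4).
rewrite Q1 in H1; rewrite Q2 in H2; rewrite Q3 in H3; rewrite Q4 in H4.
destruct (complex_quotient_bound 1 e (S1r w - S1r l) (S1i w - S1i l) a b Rlt_0_1 Hab) as [B1 B2].
{ apply Rle_trans with (2 := H1), Req_le, f_equal; ring. }
{ apply Rle_trans with (2 := H2), Req_le, f_equal; ring. }
destruct (complex_quotient_bound p e (S2r w - S2r l) (S2i w - S2i l) a b Hp Hab) as [B3 B4].
{ apply Rle_trans with (2 := H3), Req_le, f_equal; ring. }
{ apply Rle_trans with (2 := H4), Req_le, f_equal; ring. }
fold k1 in B1, B2; fold k2 in B3, B4.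
apply idempotent_ball; lra.
Qed.

(** * Reduction of the boundary value problems *)

Lemma U1_idempotent (p : R) (a : B0) : p <> 1 ->
  U1 p a = - p / (1 - p) * S1r a + / (1 - p) * S2r a.
Proof.
intros Hp; unfold S1r, S2r; destruct a as [[? ?] [? ?]]; B0_expand; field; lra.
Qed.

Lemma U3_idempotent (p : R) (a : B0) : p <> 1 ->
  p * U3 p a = p / (1 - p) * S1i a + - p / (1 - p) * S2i a.
Proof.
intros Hp; unfold S1i, S2i; destruct a as [[? ?] [? ?]]; B0_expand; field; lra.
Qed.

(** The y-derivative of [Phi] is [e2] times [l], and since [e2^2 = p e1 + i (p + 1) e2], the [e1]
    coordinate of this product is [p] times the [e2] coordinate of [l]. This is the source of the
    factor [p] in the boundary data. *)
Lemma U1_differentiable (p : R) (Phi : B0 -> B0) (x y : R) (l : B0) :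
  0 < p -> p <> 1 -> is_mono_derive p Phi (zeta p x y) l ->
  differentiable_pt_lim (fun x y => U1 p (Phi (zeta p x y))) x y (U1 p l) (p * U3 p l).
Proof.
intros Hp Hp1 H; destruct (mono_derive_cr p Phi x y l Hp Hp1 H) as [[C1 _] [C3 _]].
assert (D := differentiable_pt_lim_lin _ _ (- p / (1 - p)) (/ (1 - p)) 0 x y _ _ _ _ C1 C3).
rewrite U1_idempotent, U3_idempotent by assumption.
match type of D with differentiable_pt_lim _ _ _ ?l1 ?l2 =>
  replace (p / (1 - p) * S1i l + - p / (1 - p) * S2i l) with l2 by (field; lra) end.
apply differentiable_pt_lim_ext with (2 := D).
exists (mkposreal 1 Rlt_0_1); intros u v _ _.
rewrite U1_idempotent by assumption; unfold component; ring.
Qed.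

(** The x-derivative coincides with the y-derivative of [U1], which is the closedness of
    [U1 dx + p U3 dy]. *)
Lemma U3_differentiable (p : R) (Phi : B0 -> B0) (x y : R) (l : B0) :
  0 < p -> p <> 1 -> is_mono_derive p Phi (zeta p x y) l ->
  exists m, differentiable_pt_lim (fun x y => p * U3 p (Phi (zeta p x y))) x y (p * U3 p l) m.
Proof.
intros Hp Hp1 H; destruct (mono_derive_cr p Phi x y l Hp Hp1 H) as [[_ C2] [_ C4]].
assert (D := differentiable_pt_lim_lin _ _ (p / (1 - p)) (- p / (1 - p)) 0 x y _ _ _ _ C2 C4).
rewrite U3_idempotent by assumption.
eexists; apply differentiable_pt_lim_ext with (2 := D).
exists (mkposreal 1 Rlt_0_1); intros u v _ _.
rewrite U3_idempotent by assumption; unfold component; ring.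
Qed.

Lemma mono_derive_spec (p : R) (D : R * R -> Prop) (Phi : B0 -> B0) (x y : R) :
  monogenic p D Phi -> D (x, y) ->
  is_mono_derive p Phi (zeta p x y) (mono_derive p Phi (zeta p x y)).
Proof.
intros H Hxy; destruct (H (zeta p x y)) as [l Hl]; [now exists x, y |].
now rewrite (mono_derive_unique _ _ _ _ Hl).
Qed.

Lemma mono_derive_monogenic (p : R) (D : R * R -> Prop) (Phi : B0 -> B0) :
  0 < p -> p <> 1 -> open D -> monogenic p D Phi ->
  monogenic p D (mono_derive p Phi).
Proof.
intros Hp Hp1 Ho H z [x [y [Hxy ->]]].
destruct (open_near_sq D x y Ho Hxy) as [r [Hr HN]].
assert (K : forall u v, near_sq x y r u v -> _) by
  exact (fun u v Huv => mono_derive_cr p Phi u v _ Hp Hp1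
    (mono_derive_spec p D Phi u v H (HN u v Huv))).
destruct (cr_derivative 1 _ _ (component p S1r (mono_derive p Phi))
  (component p S1i (mono_derive p Phi)) x y r R1_neq_R0 Hr
  (fun u v Huv => proj1 (K u v Huv))) as [a1 [b1 H1]].
destruct (cr_derivative p _ _ (component p S2r (mono_derive p Phi))
  (component p S2i (mono_derive p Phi)) x y r ltac:(lra) Hr
  (fun u v Huv => proj2 (K u v Huv))) as [a2 [b2 H2]].
(* The element with idempotent components [a1 + i b1] and [a2 + i b2]. *)
set (l := (((a1 + a2) / 2, (b1 + b2) / 2), ((a1 - a2) / 2, (b1 - b2) / 2)) : B0).
exists l; apply cr_mono_derive; try assumption.
- replace (S1r l) with a1 by (unfold l, S1r, Re; simpl; field).
  replace (S1i l) with b1 by (unfold l, S1i, Im; simpl; field); exact H1.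
- replace (S2r l) with a2 by (unfold l, S2r, Re; simpl; field).
  replace (S2i l) with b2 by (unfold l, S2i, Im; simpl; field); exact H2.
Qed.

(** The factor [k] accommodates the [1 / p] between the boundary data of the two problems. *)
Lemma filterlim_zeta (p : R) (D : R * R -> Prop) (f : R * R -> R) (g : B0 -> R) (k : R)
  (x0 y0 l : R) : 0 < p ->
  (forall x y, D (x, y) -> g (zeta p x y) = k * f (x, y)) ->
  filterlim f (within D (locally (x0, y0))) (locally l) ->
  filterlim g (within (D_zeta p D) (locally (zeta p x0 y0))) (locally (k * l)).
Proof.
intros Hp E H.
assert (HF : Filter (within D (locally (x0, y0)))) by apply within_filter, locally_filter.
assert (HF' : Filter (within (D_zeta p D) (locally (zeta p x0 y0)))).
{ apply within_filter, locally_filter. }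
assert (H' : filterlim (fun P => k * f P) (within D (locally (x0, y0))) (locally (k * l))).
{ exact (filterlim_comp _ _ _ f (fun t => k * t) _ _ _ H
    (filterlim_scal_r (K := R_AbsRing) (V := R_NormedModule) k l)). }
apply (proj2 (filterlim_locally g (k * l))); intros eps.
destruct (proj1 (filterlim_locally (fun P => k * f P) (k * l)) H' eps) as [d Hd].
exists (pos_div_2 d); intros z Hz [x [y [Hxy Ez]]]; rewrite Ez in Hz |- *.
apply zeta_ball in Hz; [| exact Hp].
rewrite E by exact Hxy; apply (Hd (x, y)); [| exact Hxy].
destruct Hz; now split.
Qed.

Lemma filterlim_unzeta (p : R) (D : R * R -> Prop) (f : R * R -> R) (g : B0 -> R) (k : R)
  (x0 y0 l : R) : 0 < p ->
  (forall x y, D (x, y) -> f (x, y) = k * g (zeta p x y)) ->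
  filterlim g (within (D_zeta p D) (locally (zeta p x0 y0))) (locally l) ->
  filterlim f (within D (locally (x0, y0))) (locally (k * l)).
Proof.
intros Hp E H.
assert (HF : Filter (within D (locally (x0, y0)))) by apply within_filter, locally_filter.
assert (HF' : Filter (within (D_zeta p D) (locally (zeta p x0 y0)))).
{ apply within_filter, locally_filter. }
assert (H' : filterlim (fun z => k * g z) (within (D_zeta p D) (locally (zeta p x0 y0)))
  (locally (k * l))).
{ exact (filterlim_comp _ _ _ g (fun t => k * t) _ _ _ H
    (filterlim_scal_r (K := R_AbsRing) (V := R_NormedModule) k l)). }
apply (proj2 (filterlim_locally f (k * l))); intros eps.
destruct (proj1 (filterlim_locally (fun z => k * g z) (k * l)) H' eps) as [d Hd].
assert (Hd' : 0 < d / (1 + p)) by (apply Rdiv_lt_0_compat; [apply cond_pos | lra]).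
exists (mkposreal _ Hd'); intros [x y] [B1 B2] Hxy.
rewrite E by exact Hxy; apply Hd; [| now exists x, y].
apply ball_zeta; [exact Hp | now split].
Qed.

(** * Higher derivatives and the fourth-order equation *)

Definition partial_x (v : R -> R -> R) (x y : R) : R := Derive (fun t => v t y) x.
Definition partial_y (v : R -> R -> R) (x y : R) : R := Derive (fun t => v x t) y.

(** Derivatives in [x] alone suffice as building blocks, because the Cauchy-Riemann equations turn
    each y-derivative into an x-derivative. *)
Definition iter_partial_x (k : nat) (U : R -> R -> R) (x y : R) : R :=
  Derive_n (fun t => U t y) k x.

Definition cr_on (D : R * R -> Prop) (q : R) (U V : R -> R -> R) : Prop :=
  forall x y, D (x, y) -> exists a b, cr q U V a b x y.

(** The numbers [a] and [b] in [cr] are x-derivatives, so [cr_derivative] is the induction step. *)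
Lemma cr_iterate (q : R) (D : R * R -> Prop) (U V : R -> R -> R) : q <> 0 -> open D ->
  cr_on D q U V ->
  forall k x y, D (x, y) ->
    cr q (iter_partial_x k U) (iter_partial_x k V)
      (iter_partial_x (S k) U x y) (iter_partial_x (S k) V x y) x y.
Proof.
intros Hq Ho H.
assert (P : forall (F G : R -> R -> R) x y, (exists a b, cr q F G a b x y) ->
  cr q F G (partial_x F x y) (partial_x G x y) x y).
{ intros F G x y [a [b Hc]]; assert (Hc' := Hc); destruct Hc' as [H1 H2].
  unfold partial_x; rewrite (proj1 (differentiable_pt_lim_unique _ _ _ _ _ H1)).
  rewrite (proj1 (differentiable_pt_lim_unique _ _ _ _ _ H2)); exact Hc. }
induction k as [| k IH]; intros x y Hxy; [exact (P U V x y (H x y Hxy)) |].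
apply (P (iter_partial_x (S k) U) (iter_partial_x (S k) V)).
destruct (open_near_sq D x y Ho Hxy) as [r [Hr HN]].
apply (cr_derivative q (iter_partial_x k U) (iter_partial_x k V) _ _ x y r Hq Hr).
intros u v Huv; now apply IH, HN.
Qed.

(** On [D], [v] is the real part of
    [(al - i be) F1^(k)(x + i y) + (ga - i de) F2^(k)(x + i p y)], where
    [F1 = f1 + i g1] and [F2 = f2 + i g2]. *)
Definition wave (D : R * R -> Prop) (f1 g1 f2 g2 : R -> R -> R) (k : nat)
  (al be ga de : R) (v : R -> R -> R) : Prop :=
  forall x y, D (x, y) -> v x y =
    al * iter_partial_x k f1 x y + be * iter_partial_x k g1 x y +
    (ga * iter_partial_x k f2 x y + de * iter_partial_x k g2 x y).

(** Either derivative raises the order by one; the one in [y] also multiplies [al - i be] by [i] and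
    [ga - i de] by [i p]. *)
Lemma wave_differentiable (D : R * R -> Prop) (p : R) (f1 g1 f2 g2 : R -> R -> R) (k : nat)
  (al be ga de : R) (v : R -> R -> R) : p <> 0 -> open D ->
  cr_on D 1 f1 g1 -> cr_on D p f2 g2 ->
  wave D f1 g1 f2 g2 k al be ga de v ->
  (forall x y, D (x, y) ->
     differentiable_pt_lim v x y (partial_x v x y) (partial_y v x y)) /\
  wave D f1 g1 f2 g2 (S k) al be ga de (partial_x v) /\
  wave D f1 g1 f2 g2 (S k) be (- al) (p * de) (- (p * ga)) (partial_y v).
Proof.
intros Hp Ho H1 H2 Hv.
assert (K : forall x y, D (x, y) -> differentiable_pt_lim v x y
  (al * iter_partial_x (S k) f1 x y + be * iter_partial_x (S k) g1 x y +
   (ga * iter_partial_x (S k) f2 x y + de * iter_partial_x (S k) g2 x y))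
  (be * iter_partial_x (S k) f1 x y + - al * iter_partial_x (S k) g1 x y +
   (p * de * iter_partial_x (S k) f2 x y + - (p * ga) * iter_partial_x (S k) g2 x y))).
{ intros x y Hxy.
  destruct (cr_iterate 1 D f1 g1 R1_neq_R0 Ho H1 k x y Hxy) as [C1 C2].
  destruct (cr_iterate p D f2 g2 Hp Ho H2 k x y Hxy) as [C3 C4].
  assert (L := differentiable_pt_lim_lin _ _ 1 1 0 x y _ _ _ _
    (differentiable_pt_lim_lin _ _ al be 0 x y _ _ _ _ C1 C2)
    (differentiable_pt_lim_lin _ _ ga de 0 x y _ _ _ _ C3 C4)).
  destruct (open_near_sq D x y Ho Hxy) as [r [Hr HN]].
  match type of L with differentiable_pt_lim _ _ _ ?l1 ?l2 =>
    match goal with |- differentiable_pt_lim _ _ _ ?m1 ?m2 =>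
      replace m1 with l1 by ring; replace m2 with l2 by ring end end.
  apply differentiable_pt_lim_ext with (2 := L).
  exists (mkposreal r Hr); intros u w Hu Hw; rewrite Hv; [ring |].
  apply HN; now split. }
assert (Q : forall x y, D (x, y) ->
  partial_x v x y = al * iter_partial_x (S k) f1 x y + be * iter_partial_x (S k) g1 x y +
   (ga * iter_partial_x (S k) f2 x y + de * iter_partial_x (S k) g2 x y) /\
  partial_y v x y = be * iter_partial_x (S k) f1 x y + - al * iter_partial_x (S k) g1 x y +
   (p * de * iter_partial_x (S k) f2 x y + - (p * ga) * iter_partial_x (S k) g2 x y)).
{ intros x y Hxy; exact (differentiable_pt_lim_unique _ _ _ _ _ (K x y Hxy)). }
split; [| split].
- intros x y Hxy; destruct (Q x y Hxy) as [-> ->]; exact (K x y Hxy).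
- intros x y Hxy; exact (proj1 (Q x y Hxy)).
- intros x y Hxy; exact (proj2 (Q x y Hxy)).
Qed.

Lemma differentiable_pt_lim_ex_derive (v : R -> R -> R) (x y l1 l2 : R) :
  differentiable_pt_lim v x y l1 l2 ->
  ex_derive (fun t => v t y) x /\ ex_derive (fun t => v x t) y.
Proof.
intros H; split.
- exists l1; apply is_derive_Reals.
  replace l1 with (l1 * 1 + l2 * 0) by ring.
  apply (derivable_pt_lim_comp_2d v (fun t => t) (fun _ => y)); [exact H | |].
  + apply derivable_pt_lim_id.
  + apply derivable_pt_lim_const.
- exists l2; apply is_derive_Reals.
  replace l2 with (l1 * 0 + l2 * 1) by ring.
  apply (derivable_pt_lim_comp_2d v (fun _ => x) (fun t => t)); [exact H | |].
  + apply derivable_pt_lim_const.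
  + apply derivable_pt_lim_id.
Qed.

(** Functions of this form are differentiable, and their partial derivatives are again of this
    form. *)
Lemma wave_ex_diff_n (D : R * R -> Prop) (p : R) (f1 g1 f2 g2 : R -> R -> R) (n : nat) :
  p <> 0 -> open D -> cr_on D 1 f1 g1 -> cr_on D p f2 g2 ->
  forall k al be ga de v, wave D f1 g1 f2 g2 k al be ga de v ->
  forall x y, D (x, y) -> ex_diff_n v n x y.
Proof.
intros Hp Ho H1 H2; induction n as [| n IH]; intros k al be ga de v Hv x y Hxy;
destruct (wave_differentiable D p f1 g1 f2 g2 k al be ga de v Hp Ho H1 H2 Hv)
  as (Hd & Hx & Hy); specialize (Hd x y Hxy);
assert (Hc := differentiable_pt_lim_continuity _ _ _ _ _ Hd);
destruct (differentiable_pt_lim_ex_derive _ _ _ _ _ Hd) as [E1 E2].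
- split; [exact Hc | exact I].
- split; [exact Hc |]; split; [exact E1 |]; split; [exact E2 |]; split.
  + exact (IH _ _ _ _ _ _ Hx x y Hxy).
  + exact (IH _ _ _ _ _ _ Hy x y Hxy).
Qed.

(** Putting [u] itself in the form [wave] would call for primitives of [F1] and [F2] on all of [D];
    its first partials are already of order 0, and the argument starts there. *)
Lemma wave_potential (D : R * R -> Prop) (p : R) (f1 g1 f2 g2 A B u : R -> R -> R) :
  p <> 0 -> open D -> cr_on D 1 f1 g1 -> cr_on D p f2 g2 ->
  wave D f1 g1 f2 g2 0 1 0 1 0 A -> wave D f1 g1 f2 g2 0 0 (-1) 0 (- p) B ->
  (forall x y, D (x, y) -> differentiable_pt_lim u x y (A x y) (B x y)) ->
  forall x y, D (x, y) -> ex_diff_n u 4 x y /\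
     partial_derive 0 4 u x y + (p ^ 2 + 1) * partial_derive 2 2 u x y
       + p ^ 2 * partial_derive 4 0 u x y = 0.
Proof.
intros Hp Ho H1 H2 HA HB Hu.
assert (Q : forall x y, D (x, y) -> partial_x u x y = A x y /\ partial_y u x y = B x y).
{ intros x y Hxy; exact (differentiable_pt_lim_unique _ _ _ _ _ (Hu x y Hxy)). }
assert (Wx : wave D f1 g1 f2 g2 0 1 0 1 0 (partial_x u)).
{ intros x y Hxy; rewrite (proj1 (Q x y Hxy)); now apply HA. }
assert (Wy : wave D f1 g1 f2 g2 0 0 (-1) 0 (- p) (partial_y u)).
{ intros x y Hxy; rewrite (proj2 (Q x y Hxy)); now apply HB. }
assert (WD := fun k al be ga de v => wave_differentiable D p f1 g1 f2 g2 k al be ga de v Hp Ho H1 H2).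
intros x y Hxy; split.
- assert (Hd := Hu x y Hxy).
  assert (Hc := differentiable_pt_lim_continuity _ _ _ _ _ Hd).
  destruct (differentiable_pt_lim_ex_derive _ _ _ _ _ Hd) as [E1 E2].
  split; [exact Hc |]; split; [exact E1 |]; split; [exact E2 |]; split.
  + exact (wave_ex_diff_n D p f1 g1 f2 g2 3 Hp Ho H1 H2 _ _ _ _ _ _ Wx x y Hxy).
  + exact (wave_ex_diff_n D p f1 g1 f2 g2 3 Hp Ho H1 H2 _ _ _ _ _ _ Wy x y Hxy).
- destruct (WD _ _ _ _ _ _ Wx) as (_ & Wxx & _); destruct (WD _ _ _ _ _ _ Wxx) as (_ & Wxxx & _).
  destruct (WD _ _ _ _ _ _ Wxxx) as (_ & Wxxxx & _).
  destruct (WD _ _ _ _ _ _ Wy) as (_ & _ & Wyy); destruct (WD _ _ _ _ _ _ Wyy) as (_ & Wyyx & Wyyy).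
  destruct (WD _ _ _ _ _ _ Wyyx) as (_ & Wyyxx & _);
  destruct (WD _ _ _ _ _ _ Wyyy) as (_ & _ & Wyyyy).
  change (partial_derive 4 0 u x y) with (partial_x (partial_x (partial_x (partial_x u))) x y).
  change (partial_derive 2 2 u x y) with (partial_x (partial_x (partial_y (partial_y u))) x y).
  change (partial_derive 0 4 u x y) with (partial_y (partial_y (partial_y (partial_y u))) x y).
  (* In the order [yyyy], [yyxx], [xxxx] the coefficients are 1, -1, 1 on [F1] and [p^4], [-p^2], 1
     on [F2]. *)
  rewrite (Wxxxx x y Hxy), (Wyyxx x y Hxy), (Wyyyy x y Hxy); ring.
Qed.

Lemma cr_scal (q c : R) (U V : R -> R -> R) (a b x y : R) :
  cr q U V a b x y ->
  cr q (fun u v => c * U u v) (fun u v => c * V u v) (c * a) (c * b) x y.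
Proof.
intros [H1 H2]; split.
- replace (- (q * (c * b))) with (c * - (q * b)) by ring; now apply differentiable_pt_lim_scal.
- replace (q * (c * a)) with (c * (q * a)) by ring; now apply differentiable_pt_lim_scal.
Qed.

Theorem mainTheorem4 (p : R) (D : R * R -> Prop) (u1 u3 : R * R -> R)
  (Hp0 : 0 < p) (Hp1 : p <> 1)
  (HD : is_domain D) (HDb : bounded_set D) (HDsc : simply_connected D)
  (Hu1 : continuous_on (boundary D) u1)
  (Hu3 : continuous_on (boundary D) u3) :
  (forall (u : R -> R -> R) (Phi1 : B0 -> B0),
     problemA p D u1 u3 u ->
     monogenic p D Phi1 ->
     (forall x y : R, D (x, y) -> U1 p (Phi1 (zeta p x y)) = u x y) ->
     problemB p D u1 u3 (mono_derive p Phi1))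
  /\
  (forall Phi : B0 -> B0,
     problemB p D u1 u3 Phi ->
     forall (xs ys c : R), D (xs, ys) ->
       let is_integral :=
         is_curve_primitive D (fun x y => U1 p (Phi (zeta p x y)))
           (fun x y => p * U3 p (Phi (zeta p x y))) (xs, ys) c in
       (exists u : R -> R -> R, is_integral u) /\
       (forall u : R -> R -> R, is_integral u -> problemA p D u1 u3 u)).
Proof.
assert (Ho : open D) by apply HD.
assert (Hpn : p <> 0) by lra.
split.
- intros u Phi1 [_ HAb] Hmono Hu.
  split; [now apply mono_derive_monogenic |].
  (* On [D], [u] is the first component of [Phi1], so its gradient is read off the monogenic
     derivative. *)
  assert (Q : forall x y, D (x, y) ->
    partial_derive 1 0 u x y = U1 p (mono_derive p Phi1 (zeta p x y)) /\
    partial_derive 0 1 u x y = p * U3 p (mono_derive p Phi1 (zeta p x y))).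
  { intros x y Hxy.
    destruct (open_near_sq D x y Ho Hxy) as [r [Hr HN]].
    apply (differentiable_pt_lim_unique u x y).
    apply differentiable_pt_lim_ext with (fun x y => U1 p (Phi1 (zeta p x y))).
    - exists (mkposreal r Hr); intros s t Hs Ht; apply Hu, HN; now split.
    - apply U1_differentiable; try assumption; now apply (mono_derive_spec p D). }
  intros x0 y0 Hb; destruct (HAb x0 y0 Hb) as [L1 L3]; split.
  + rewrite <- (Rmult_1_l (u1 (x0, y0))).
    apply (filterlim_zeta p D _ _ 1 x0 y0 (u1 (x0, y0)) Hp0) with (2 := L1).
    intros x y Hxy; simpl fst; simpl snd; rewrite (proj1 (Q x y Hxy)); ring.
  + apply (filterlim_zeta p D _ _ (1 / p) x0 y0 (u3 (x0, y0)) Hp0) with (2 := L3).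
    intros x y Hxy; simpl fst; simpl snd; rewrite (proj2 (Q x y Hxy)); field; lra.
- intros Phi [Hmono HBb] xs ys c Hs is_integral.
  set (A := fun x y => U1 p (Phi (zeta p x y))) in *.
  set (B := fun x y => p * U3 p (Phi (zeta p x y))) in *.
  assert (Hcl : forall x y, D (x, y) -> closed_at A B x y).
  { intros x y Hxy; assert (Hl := mono_derive_spec p D Phi x y Hmono Hxy).
    destruct (U3_differentiable p Phi x y _ Hp0 Hp1 Hl) as [m Hm].
    eexists; eexists; exists m; split; [| exact Hm].
    now apply U1_differentiable. }
  assert (HAB := fun x y Hxy => closed_at_continuity A B x y (Hcl x y Hxy)).
  assert (HE : locally_exact D A B).
  { intros x y Hxy; destruct (open_near_sq D x y Ho Hxy) as [r [Hr HN]].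
    destruct (goursat_primitive A B x y r) as [F HF].
    - intros s t Hst; now apply Hcl, HN.
    - now exists F, r. }
  split; [now apply curve_primitive_exists |].
  intros u Hu.
  assert (Hd : forall x y, D (x, y) -> differentiable_pt_lim u x y (A x y) (B x y)).
  { intros x y Hxy;
    exact (curve_primitive_differentiable D A B (xs, ys) c u x y Ho HE HAB Hu Hxy). }
  assert (Q : forall x y, D (x, y) ->
    partial_derive 1 0 u x y = A x y /\ partial_derive 0 1 u x y = B x y).
  { intros x y Hxy; exact (differentiable_pt_lim_unique _ _ _ _ _ (Hd x y Hxy)). }
  split.
  (* The coefficients of [U1] on the two idempotent components; absorbed into [F1] and [F2], they
     give [U1] and [p * U3] the coefficients that [wave_potential] expects. *)
  + set (c1 := - p / (1 - p)); set (c2 := / (1 - p)).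
    apply (wave_potential D p (fun x y => c1 * component p S1r Phi x y)
      (fun x y => c1 * component p S1i Phi x y)
      (fun x y => c2 * component p S2r Phi x y)
      (fun x y => c2 * component p S2i Phi x y) A B u Hpn Ho); try exact Hd.
    * intros x y Hxy; eexists; eexists; apply cr_scal.
      exact (proj1 (mono_derive_cr p Phi x y _ Hp0 Hp1 (mono_derive_spec p D Phi x y Hmono Hxy))).
    * intros x y Hxy; eexists; eexists; apply cr_scal.
      exact (proj2 (mono_derive_cr p Phi x y _ Hp0 Hp1 (mono_derive_spec p D Phi x y Hmono Hxy))).
    * intros x y Hxy; unfold A; rewrite U1_idempotent by assumption.
      unfold iter_partial_x, component, c1, c2; simpl; ring.
    * intros x y Hxy; unfold B; rewrite U3_idempotent by assumption.
      unfold iter_partial_x, component, c1, c2; simpl; field; lra.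
  + intros x0 y0 Hb; destruct (HBb x0 y0 Hb) as [L1 L3]; split.
    * rewrite <- (Rmult_1_l (u1 (x0, y0))).
      apply (filterlim_unzeta p D _ (fun z => U1 p (Phi z)) 1 x0 y0 (u1 (x0, y0)) Hp0) with (2 := L1).
      intros x y Hxy; simpl fst; simpl snd; rewrite (proj1 (Q x y Hxy)); unfold A; ring.
    (* [U3] tends to [1 / p * u3], and the factor [p] in the form undoes the division. *)
    * replace (u3 (x0, y0)) with (p * (1 / p * u3 (x0, y0))) by (field; lra).
      apply (filterlim_unzeta p D _ (fun z => U3 p (Phi z)) p x0 y0 _ Hp0) with (2 := L3).
      intros x y Hxy; simpl fst; simpl snd; rewrite (proj2 (Q x y Hxy)); reflexivity.
Qed.
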